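(* Let $(\mathfrak b,H,\widehat\beta,\alpha,\beta,V)$ be a $C^*$-pseudo-multiplicative unitary, $\mathfrak b=(\mathfrak K,\mathfrak B,\mathfrak B^\dagger)$, with Fourier algebra $\widehat A_V^0=\widehat\pi_V(\tilde\Omega_{\beta,\alpha})$ and dual Fourier algebra $A_V^0=\pi_V(\tilde\Omega_{\alpha,\widehat\beta})$. (i) There exists a bilinear map $(\,\cdot\,|\,\cdot\,)\colon\widehat A_V^0\times A_V^0\to\mathcal L(\mathfrak K)$ such that $\omega(\pi_V(\upsilon))=\big(\widehat\pi_V(\omega)\,\big|\,\pi_V(\upsilon)\big)=\upsilon(\widehat\pi_V(\omega))$ for all $\omega\in\tilde\Omega_{\beta,\alpha}$, $\upsilon\in\tilde\Omega_{\alpha,\widehat\beta}$. (ii) This map is nondegenerate in the sense that for each nonzero $\hat a\in\widehat A_V^0$ and each nonzero $a\in A_V^0$ there exist $\hat a'\in\widehat A_V^0$ and $a'\in A_V^0$ such that $(\hat a|a')\neq0$ and $(\hat a'|a)\neq0$. (iii) $(\widehat\pi_V(\omega)\widehat\pi_V(\omega')|a)=(\omega\boxtimes\omega')(\Delta_V(a))$ and $(\hat a|\pi_V(\upsilon)\pi_V(\upsilon'))=(\upsilon\boxtimes\upsilon')(\widehat\Delta_V(\hat a))$ for all $\omega,\omega'\in\tilde\Omega_{\beta,\alpha}$, $a\in A_V^0$, $\upsilon,\upsilon'\in\tilde\Omega_{\alpha,\widehat\beta}$, $\hat a\in\widehat A_V^0$.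
   Context: General notions. $[Y]$ denotes the closed linear span of $Y$; products of sets of operators are elementwise; $X'$ is the commutant of $X$. A $C^*$-base is a triple $\mathfrak b=(\mathfrak K,\mathfrak B,\mathfrak B^\dagger)$ of a Hilbert space and two commuting nondegenerate $C^*$-algebras $\mathfrak B,\mathfrak B^\dagger\subseteq\mathcal L(\mathfrak K)$; $\mathfrak b^\dagger=(\mathfrak K,\mathfrak B^\dagger,\mathfrak B)$. A $C^*$-$\mathfrak b$-module $H_\alpha=(H,\alpha)$ is a Hilbert space $H$ with a closed subspace $\alpha\subseteq\mathcal L(\mathfrak K,H)$ such that $[\alpha\mathfrak K]=H$, $[\alpha\mathfrak B]=\alpha$, $[\alpha^*\alpha]=\mathfrak B$; it carries the representation $\rho_\alpha\colon\mathfrak B^\dagger\to\mathcal L(H)$, $\rho_\alpha(b^\dagger)\xi\zeta=\xi b^\dagger\zeta$ ($\xi\in\alpha,\zeta\in\mathfrak K$). For $C^*$-$\mathfrak b^\dagger$-modules the roles of $\mathfrak B,\mathfrak B^\dagger$ are swapped. A $C^*$-$(\mathfrak b_1,\dots,\mathfrak b_n)$-module is a tuple $(H,\alpha_1,\dots,\alpha_n)$ with each $(H,\alpha_i)$ a $C^*$-$\mathfrak b_i$-module and $[\rho_{\alpha_i}(\mathfrak B_i^\dagger)\alpha_j]=\alpha_j$ for $i\neq j$. Relative tensor product. For a $C^*$-$\mathfrak b$-module $H_\beta$ and a $C^*$-$\mathfrak b^\dagger$-module $K_\gamma$, $H\,{}_\beta\otimes_\gamma K$ (the base is suppressed in the notation;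 the same definition applies with $\mathfrak b$, $\mathfrak b^\dagger$ interchanged) is the Hilbert space generated by elements $\xi\otimes\zeta\otimes\eta$ ($\xi\in\beta,\zeta\in\mathfrak K,\eta\in\gamma$) with $\langle\xi\otimes\zeta\otimes\eta|\xi'\otimes\zeta'\otimes\eta'\rangle=\langle\zeta|\xi^*\xi'\eta^*\eta'\zeta'\rangle$. The operators $|\xi\rangle_1\colon K\to H\,{}_\beta\otimes_\gamma K$ and $|\eta\rangle_2\colon H\to H\,{}_\beta\otimes_\gamma K$ are given by $|\xi\rangle_1\eta\zeta=\xi\otimes\zeta\otimes\eta=|\eta\rangle_2\xi\zeta$; $\langle\xi|_1,\langle\eta|_2$ are their adjoints; $|\beta\rangle_1=\{|\xi\rangle_1:\xi\in\beta\}$, and similarly $\langle\beta|_1,|\gamma\rangle_2,\langle\gamma|_2$. For further module structures $\alpha$ on $H$, $\delta$ on $K$ put $\alpha\triangleleft\gamma=[|\gamma\rangle_2\alpha]$, $\beta\triangleright\delta=[|\beta\rangle_1\delta]$; these are module structures on $H\,{}_\beta\otimes_\gamma K$. Operators $S\otimes\mathrm{id}$ and $\mathrm{id}\otimes T$ are determined by $(S\otimes\mathrm{id})|\eta\rangle_2=|\eta\rangle_2S$ and $(\mathrm{id}\otimes T)|\xi\rangle_1=|\xi\rangle_1T$ whenever $S$ intertwines the representations $\rho_\beta$ of the first leg, resp. $T$ the representations $\rho_\gamma$ of the second leg. Iterated relative tensor products are identified via the canonical associativity isomorphisms; $\Sigma$ denotes the flip $\xi\otimes\zeta\otimes\eta\mapsto\eta\otimes\zeta\otimes\xi$.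 $C^*$-pseudo-multiplicative unitary: a tuple $(\mathfrak b,H,\widehat\beta,\alpha,\beta,V)$ with $\mathfrak b$ a $C^*$-base, $(H,\widehat\beta,\alpha,\beta)$ a $C^*$-$(\mathfrak b^\dagger,\mathfrak b,\mathfrak b^\dagger)$-module and $V\colon H\,{}_{\widehat\beta}\otimes_\alpha H\to H\,{}_\alpha\otimes_\beta H$ a unitary with $V(\alpha\triangleleft\alpha)=\alpha\triangleright\alpha$, $V(\widehat\beta\triangleright\beta)=\widehat\beta\triangleleft\beta$, $V(\widehat\beta\triangleright\widehat\beta)=\alpha\triangleright\widehat\beta$, $V(\beta\triangleleft\alpha)=\beta\triangleleft\beta$, satisfying the pentagon equation $V_{23}V_{12}=V_{12}V_{13}V_{23}$ as operators $H\,{}_{\widehat\beta}\otimes_\alpha H\,{}_{\widehat\beta}\otimes_\alpha H\to H\,{}_\alpha\otimes_\beta H\,{}_\alpha\otimes_\beta H$. Here $V_{12}=V\otimes\mathrm{id}$, $V_{23}=\mathrm{id}\otimes V$, and $V_{13}\colon H\,{}_{\widehat\beta}\otimes_{\alpha\triangleright\alpha}(H\,{}_\alpha\otimes_\beta H)\to(H\,{}_{\widehat\beta}\otimes_\alpha H)\,{}_{\alpha\triangleleft\alpha}\otimes_\beta H$ is $\Sigma_{23}(V\otimes\mathrm{id})(\mathrm{id}\otimes\Sigma)$, where $\Sigma_{23}\colon(H\,{}_\alpha\otimes_\beta H)\,{}_{\widehat\beta\triangleleft\beta}\otimes_\alpha H\to(H\,{}_{\widehat\beta}\otimes_\alpha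 H)\,{}_{\alpha\triangleleft\alpha}\otimes_\beta H$ sends $|\eta\rangle_2|\xi\rangle_2\omega$ to $|\xi\rangle_2|\eta\rangle_2\omega$ ($\omega\in H,\xi\in\beta,\eta\in\alpha$). Comultiplications. $\widehat\Delta_V\colon\rho_\beta(\mathfrak B)'\to\mathcal L(H\,{}_{\widehat\beta}\otimes_\alpha H)$, $y\mapsto V^*(\mathrm{id}\otimes y)V$; $\Delta_V\colon\rho_{\widehat\beta}(\mathfrak B)'\to\mathcal L(H\,{}_\alpha\otimes_\beta H)$, $z\mapsto V(z\otimes\mathrm{id})V^*$. Spaces of maps. For a module structure $\alpha\subseteq\mathcal L(\mathfrak K,H)$ let $\alpha^\infty$ be the space of sequences $\eta=(\eta_k)_{k\in\mathbb N}$ in $\alpha$ such that $\sum_k\eta_k^*\eta_k$ converges in norm. For module structures $\beta,\alpha$ on $H$ and a $C^*$-algebra $A\subseteq\mathcal L(H)$, each $\eta\in\beta^\infty,\eta'\in\alpha^\infty$ defines $\omega_{\eta,\eta'}\colon A\to\mathcal L(\mathfrak K)$, $T\mapsto\sum_k\eta_k^*T\eta_k'$ (norm convergent); $\Omega_{\beta,\alpha}(A)$ is the vector space of all these maps. Put $\tilde\Omega_{\beta,\alpha}=\Omega_{\beta,\alpha}(\rho_{\widehat\beta}(\mathfrak B)')$, $\tilde\Omega_{\alpha,\widehat\beta}=\Omega_{\alpha,\widehat\beta}(\rho_\beta(\mathfrak B)')$. For $\xi,\xi'\in\beta^\infty$, $\eta,\eta'\in\alpha^\infty$, $\zeta,\zeta'\in\widehat\beta^\infty$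 one has well-defined bilinear operations $\omega_{\xi,\eta}\boxtimes\omega_{\xi',\eta'}\colon T\mapsto\sum_{m,n}\xi_m^*\langle\xi'_n|_2T|\eta_m\rangle_1\eta'_n$ (a map on $(\rho_{\widehat\beta}(\mathfrak B)\otimes\rho_{\widehat\beta}(\mathfrak B))'\subseteq\mathcal L(H\,{}_\alpha\otimes_\beta H)$) and $\omega_{\eta,\zeta}\boxtimes\omega_{\eta',\zeta'}\colon T\mapsto\sum_{m,n}\eta_m^*\langle\eta'_n|_2T|\zeta_m\rangle_1\zeta'_n$ (a map on $(\rho_\beta(\mathfrak B)\otimes\rho_\beta(\mathfrak B))'\subseteq\mathcal L(H\,{}_{\widehat\beta}\otimes_\alpha H)$). The spaces $\tilde\Omega_{\beta,\alpha}$, $\tilde\Omega_{\alpha,\widehat\beta}$ are algebras with products $(\omega\boxtimes\omega')\circ\Delta_V$, resp. $(\omega\boxtimes\omega')\circ\widehat\Delta_V$, and there are well-defined algebra homomorphisms $\widehat\pi_V\colon\tilde\Omega_{\beta,\alpha}\to\mathcal L(H)$, $\widehat\pi_V(\omega_{\xi,\eta})=\sum_n\langle\xi_n|_2V|\eta_n\rangle_2$, and $\pi_V\colon\tilde\Omega_{\alpha,\widehat\beta}\to\mathcal L(H)$, $\pi_V(\omega_{\eta,\zeta})=\sum_n\langle\eta_n|_1V|\zeta_n\rangle_1$. One has $\widehat A_V^0\subseteq\rho_\beta(\mathfrak B)'$ and $A_V^0\subseteq\rho_{\widehat\beta}(\mathfrak B)'$. *)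

(* Defs.v *)
From HB Require Import structures.
From mathcomp Require Import all_boot all_order all_algebra.
From mathcomp Require Import sesquilinear complex.
From mathcomp Require Import boolp classical_sets functions reals topology.
From mathcomp Require Import normedtype sequences summability.
Set Implicit Arguments.
Unset Strict Implicit.
Unset Printing Implicit Defensive.
Import Order.TTheory GRing.Theory Num.Theory.
Import numFieldNormedType.Exports.
Local Open Scope classical_set_scope.
Local Open Scope ring_scope.
Local Open Scope complex_scope.

(* [hdot] is linear in its first argument, as the library's {dot _ for _};
   the inner product <x|y> of the text, linear in y, is [ip x y]. *)
Record hilbert (R : realType) := Hilbert {
  hspace :> completeNormedModType R[i];
  hdot : {dot hspace for @Num.conj R[i]};
  hdotE : forall x : hspace, hdot x x = `|x| ^+ 2 }.

Definition ip (R : realType) (H : hilbert R) (x y : H) : R[i] := hdot H y x.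

Section BoundedOperators.
Variables (R : realType) (H K : hilbert R).

Definition bounded_op : {pred (H -> K)} :=
  mem [set f : H -> K | linear f /\ continuous f].

Lemma bounded_op_submod : submod_closed bounded_op.
Proof.
split=> [|c f g].
  rewrite inE/=; split; last exact: cst_continuous.
  by move=> a x y; rewrite /= scaler0 addr0.
rewrite !inE/= => -[lf cf] [lg cg]; split.
  move=> a x y; rewrite !fctE lf lg !scalerDr !scalerA addrACA.
  by rewrite (mulrC c a).
by move=> x; apply: cvgD; [exact: cvgZl_tmp (cf x)|exact: cg].
Qed.

HB.instance Definition _ :=
  GRing.isSubmodClosed.Build R[i] (H -> K) bounded_op bounded_op_submod.

Record bop := BOp { bop_fun :> H -> K; bop_subproof : bop_fun \in bounded_op }.

HB.instance Definition _ := [isSub for bop_fun].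
HB.instance Definition _ := [Choice of bop by <:].
HB.instance Definition _ := [SubChoice_isSubLmodule of bop by <:].

Lemma bop_linear (T : bop) : linear T.
Proof. by case: T => f /= /[!inE] -[]. Qed.

Lemma bop_continuous (T : bop) : continuous T.
Proof. by case: T => f /= /[!inE] -[]. Qed.

HB.instance Definition _ (T : bop) :=
  GRing.isLinear.Build R[i] H K *:%R T (@bop_linear T).

Lemma bopP (S T : bop) : (forall x, S x = T x) -> S = T.
Proof. by move=> ST; apply/val_inj/funext. Qed.

Definition opnorm (T : bop) : R[i] :=
  (sup [set complex.Re `|T x| | x in [set x : H | `|x| <= 1]])%:C.

Lemma bop_bounded (T : bop) :
  exists M : R, forall x : H, `|x| <= 1 -> `|T x| <= M%:C.
Proof.
have /linear_bounded_continuous/linear_boundedP TM :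
  continuous (T : {linear H -> K}) by exact: bop_continuous.
have [M [M0 TMx]] := pinfty_ex_gt0 TM.
exists (complex.Re M) => x x1; rewrite RRe_real ?gtr0_real//.
by rewrite (le_trans (TMx x))// ler_piMr// ltW.
Qed.

Lemma opnorm_ub (T : bop) (x : H) : `|x| <= 1 -> `|T x| <= opnorm T.
Proof.
move=> x1; rewrite -[`|T x|]RRe_real ?normr_real// /opnorm lecR.
apply: ub_le_sup; last by exists x.
have [M TM] := bop_bounded T; exists M => _ [y y1 <-].
by rewrite -lecR RRe_real ?normr_real//; exact: TM.
Qed.

Lemma opnorm_le (T : bop) (M : R[i]) :
  (forall x : H, `|x| <= 1 -> `|T x| <= M) -> opnorm T <= M.
Proof.
move=> TM; have M0 : 0 <= M.
  by rewrite (le_trans _ (TM 0 _))// normr0.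
rewrite -[M]RRe_real ?ger0_real// /opnorm lecR; apply: ge_sup.
  by exists (complex.Re `|T 0|), 0 => //=; rewrite normr0.
move=> _ [x x1 <-].
by rewrite -lecR !RRe_real ?normr_real ?ger0_real//; exact: TM.
Qed.

Lemma opnormD (S T : bop) : opnorm (S + T) <= opnorm S + opnorm T.
Proof.
apply: opnorm_le => x x1; rewrite (le_trans (ler_normD _ _))//.
by rewrite lerD// opnorm_ub.
Qed.

Lemma opnormZ_le (c : R[i]) (T : bop) : opnorm (c *: T) <= `|c| * opnorm T.
Proof.
apply: opnorm_le => x x1; rewrite [X in `|X|](_ : _ = c *: T x)// normrZ.
by rewrite ler_wpM2l// opnorm_ub.
Qed.

Lemma opnormZ (c : R[i]) (T : bop) : opnorm (c *: T) = `|c| * opnorm T.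
Proof.
apply/eqP; rewrite eq_le opnormZ_le/=.
have [->|c0] := eqVneq c 0.
  rewrite normr0 mul0r.
  by rewrite (le_trans _ (@opnorm_ub _ 0 _))// normr0.
rewrite -ler_pdivlMl ?normr_gt0//.
by rewrite -normfV -{1}[T]scale1r -(mulVf c0) -scalerA opnormZ_le.
Qed.

Lemma opnorm0_eq0 (T : bop) : opnorm T = 0 -> T = 0.
Proof.
move=> T0; apply: bopP => x; apply/eqP; rewrite -normr_le0.
have [->|x0] := eqVneq x 0; first by rewrite linear0 normr0.
have nx0 : `|x| != 0 by rewrite normr_eq0.
have := @opnorm_ub T (`|x|^-1 *: x).
rewrite T0 linearZ/= !normrZ normfV normr_id mulVf// => /(_ (lexx _)).
by rewrite pmulr_rle0// invr_gt0 normr_gt0.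
Qed.

HB.instance Definition _ :=
  Lmodule_isNormed.Build R[i] bop opnormD opnormZ opnorm0_eq0.

End BoundedOperators.

Section Composition.
Variables (R : realType) (H K L : hilbert R).

Lemma comp_subproof (S : bop K L) (T : bop H K) :
  (S \o T : H -> L) \in @bounded_op R H L.
Proof.
rewrite inE/=; split; first by move=> c x y /=; rewrite !linearP.
by move=> x; apply: continuous_comp; exact: bop_continuous.
Qed.

Definition compo (S : bop K L) (T : bop H K) : bop H L :=
  BOp (comp_subproof S T).

End Composition.
Notation "S ** T" := (compo S T) (at level 40, left associativity).

Lemma id_subproof (R : realType) (H : hilbert R) :
  (idfun : H -> H) \in @bounded_op R H H.
Proof. by rewrite inE/=; split=> // x; exact: cvg_id. Qed.

Definition opid (R : realType) (H : hilbert R) : bop H H :=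
  BOp (id_subproof H).

(* In the rest of the file an object determined by a characteristic property
   ("the unique bounded operator W such that ...") is [xget x0 P]: an element
   satisfying P, and the junk value x0 only if there is none. *)

Definition adj (R : realType) (H K : hilbert R) (T : bop H K) : bop K H :=
  xget 0 [set S : bop K H | forall x y, ip (S x) y = ip x (T y)].

Definition unitary (R : realType) (H K : hilbert R) (U : bop H K) : Prop :=
  adj U ** U = opid H /\ U ** adj U = opid K.

Section ClosedSpan.
Variables (R : realType) (E : normedModType R[i]).

Definition lspan (Y : set E) : set E :=
  [set v | exists (n : nat) (c : 'I_n -> R[i]) (y : 'I_n -> E),
     (forall i, Y (y i)) /\ v = \sum_(i < n) c i *: y i].

Definition cspan (Y : set E) : set E := closure (lspan Y).

Definition closed_subspace (Y : set E) : Prop :=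
  [/\ closed Y, Y 0 & forall (c : R[i]) u v, Y u -> Y v -> Y (c *: u + v)].

End ClosedSpan.

Definition mulset (R : realType) (H K L : hilbert R)
    (S : set (bop K L)) (T : set (bop H K)) : set (bop H L) :=
  [set s ** t | s in S & t in T].

Definition adjset (R : realType) (H K : hilbert R) (S : set (bop H K)) :
    set (bop K H) :=
  [set adj s | s in S].

Definition rangeset (R : realType) (H K : hilbert R) (S : set (bop H K)) :
    set K :=
  [set s x | s in S & x in [set: H]].

Definition commutant (R : realType) (H : hilbert R) (S : set (bop H H)) :
    set (bop H H) :=
  [set T | forall s, S s -> T ** s = s ** T].

Definition cstar_alg (R : realType) (H : hilbert R) (A : set (bop H H)) :
    Prop :=
  [/\ closed_subspace A, mulset A A `<=` A & adjset A `<=` A].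

Definition nondegenerate (R : realType) (H : hilbert R) (A : set (bop H H)) :
    Prop :=
  cspan (rangeset A) = [set: H].

Record cbase (R : realType) := CBase {
  cK : hilbert R;
  cB : set (bop cK cK);
  cBd : set (bop cK cK);
  cB_cstar : cstar_alg cB;
  cBd_cstar : cstar_alg cBd;
  cB_nondeg : nondegenerate cB;
  cBd_nondeg : nondegenerate cBd;
  cBBd : forall x y, cB x -> cBd y -> x ** y = y ** x }.
Arguments cB {R} c.
Arguments cBd {R} c.

Definition dag (R : realType) (b : cbase R) : cbase R :=
  CBase (cBd_cstar b) (cB_cstar b) (cBd_nondeg b) (cB_nondeg b)
    (fun x y Bx By => esym (cBBd By Bx)).

Definition is_cmodule (R : realType) (b : cbase R) (H : hilbert R)
    (a : set (bop (cK b) H)) : Prop :=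
  [/\ closed_subspace a,
      cspan (rangeset a) = [set: H],
      cspan (mulset a (cB b)) = a &
      cspan (mulset (adjset a) a) = cB b].

Definition rho (R : realType) (K H : hilbert R) (a : set (bop K H))
    (c : bop K K) : bop H H :=
  xget 0 [set T | forall xi, a xi -> T ** xi = xi ** c].

Definition rho_stable (R : realType) (b : cbase R) (H L : hilbert R)
    (a : set (bop (cK b) H)) (a' : set (bop L H)) : Prop :=
  cspan (mulset (rho a @` cBd b) a') = a'.

Definition is_cmodule3 (R : realType) (b1 b2 b3 : cbase R) (H : hilbert R)
    (a1 : set (bop (cK b1) H)) (a2 : set (bop (cK b2) H))
    (a3 : set (bop (cK b3) H)) : Prop :=
  [/\ [/\ is_cmodule a1, is_cmodule a2 & is_cmodule a3],
      [/\ rho_stable a1 a2 & rho_stable a1 a3],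
      [/\ rho_stable a2 a1 & rho_stable a2 a3] &
      [/\ rho_stable a3 a1 & rho_stable a3 a2]].

Record rtmodel (R : realType) (K0 H K : hilbert R) := RTModel {
  rt_space : hilbert R;
  rt_elt : bop K0 H -> K0 -> bop K0 K -> rt_space }.

Section RelativeTensorProduct.
Variables (R : realType) (K0 H K : hilbert R).
Variables (b : set (bop K0 H)) (g : set (bop K0 K)).

Definition is_rtensor (M : rtmodel K0 H K) : Prop :=
  (forall xi xi' z z' eta eta', b xi -> b xi' -> g eta -> g eta' ->
     ip (rt_elt M xi z eta) (rt_elt M xi' z' eta') =
     ip z ((adj xi ** xi' ** adj eta ** eta') z')) /\
  cspan [set t | exists xi z eta, [/\ b xi, g eta & t = rt_elt M xi z eta]] =
  [set: rt_space M].

(* The Hilbert space generated by the elements xi (x) z (x) eta with the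
   prescribed inner products, determined up to a unique unitary compatible
   with the generators ([xget] is not available here for universe reasons;
   the junk value is again irrelevant, since C*-modules over b and b^dagger
   do have a relative tensor product). *)
Definition rtensor_model : rtmodel K0 H K :=
  if pselect (exists M, is_rtensor M) is left e then sval (cid e)
  else RTModel (fun _ _ _ => 0 : K0).

Definition rtensor : hilbert R := rt_space rtensor_model.

Definition tens (xi : bop K0 H) (z : K0) (eta : bop K0 K) : rtensor :=
  rt_elt rtensor_model xi z eta.

Definition ket1 (xi : bop K0 H) : bop K rtensor :=
  xget 0 [set W : bop K rtensor |
    forall eta z, g eta -> W (eta z) = tens xi z eta].

Definition ket2 (eta : bop K0 K) : bop H rtensor :=
  xget 0 [set W : bop H rtensor |
    forall xi z, b xi -> W (xi z) = tens xi z eta].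

(* [ltri a] is a <| g and [rtri d] is b |> d, as subsets of L(K0, rtensor). *)
Definition ltri (a : set (bop K0 H)) : set (bop K0 rtensor) :=
  cspan (mulset (ket2 @` g) a).

Definition rtri (d : set (bop K0 K)) : set (bop K0 rtensor) :=
  cspan (mulset (ket1 @` b) d).

End RelativeTensorProduct.
Arguments tens {R K0 H K} b g xi z eta.
Arguments ket1 {R K0 H K} b g xi.
Arguments ket2 {R K0 H K} b g eta.
Arguments ltri {R K0 H K} b g a.
Arguments rtri {R K0 H K} b g d.

Section TensorOperators.
Variables (R : realType) (K0 : hilbert R).

(* S (x) id. *)
Definition opl (H H' K : hilbert R) (b : set (bop K0 H)) (b' : set (bop K0 H'))
    (g : set (bop K0 K)) (S : bop H H') : bop (rtensor b g) (rtensor b' g) :=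
  xget 0 [set W | forall eta, g eta -> W ** ket2 b g eta = ket2 b' g eta ** S].

(* id (x) T. *)
Definition opr (H K K' : hilbert R) (b : set (bop K0 H)) (g : set (bop K0 K))
    (g' : set (bop K0 K')) (T : bop K K') : bop (rtensor b g) (rtensor b g') :=
  xget 0 [set W | forall xi, b xi -> W ** ket1 b g xi = ket1 b g' xi ** T].

(* The flip: |eta>_2 h = xi (x) z (x) eta goes to eta (x) z (x) xi = |eta>_1 h
   for h = xi z. *)
Definition flip (H K : hilbert R) (b : set (bop K0 H)) (g : set (bop K0 K)) :
    bop (rtensor b g) (rtensor g b) :=
  xget 0 [set W | forall eta, g eta -> W ** ket2 b g eta = ket1 g b eta].

(* The associativity isomorphism
   (H b(x)g K) b|>d (x)e L -> H b(x) g<|e (K d(x)e L),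
   (xi (x) k) (x) eta |-> xi (x) (k (x) eta). *)
Definition assoc (H K L : hilbert R) (b : set (bop K0 H))
    (g d : set (bop K0 K)) (e : set (bop K0 L)) :
    bop (rtensor (rtri b g d) e) (rtensor b (ltri d e g)) :=
  xget 0 [set W | forall xi eta, b xi -> e eta ->
    W ** ket2 (rtri b g d) e eta ** ket1 b g xi =
    ket1 b (ltri d e g) xi ** ket2 d e eta].

(* Sigma_23 : (H alpha(x)beta H) bhat<|beta (x)alpha H
               -> (H bhat(x)alpha H) alpha<|alpha (x)beta H,
   |eta>_2 |xi>_2 w |-> |xi>_2 |eta>_2 w. *)
Definition sigma23 (H : hilbert R) (bhat alpha beta : set (bop K0 H)) :
    bop (rtensor (ltri alpha beta bhat) alpha)
        (rtensor (ltri bhat alpha alpha) beta) :=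
  xget 0 [set W | forall xi eta, beta xi -> alpha eta ->
    W ** ket2 (ltri alpha beta bhat) alpha eta ** ket2 alpha beta xi =
    ket2 (ltri bhat alpha alpha) beta xi ** ket2 bhat alpha eta].

End TensorOperators.

Section Unitary.
Variables (R : realType) (K0 H : hilbert R) (bhat alpha beta : set (bop K0 H)).
Variable V : bop (rtensor bhat alpha) (rtensor alpha beta).

Definition V13 : bop (rtensor bhat (rtri alpha beta alpha))
    (rtensor (ltri bhat alpha alpha) beta) :=
  sigma23 bhat alpha beta **
  opl (rtri bhat alpha beta) (ltri alpha beta bhat) alpha V **
  adj (assoc bhat alpha beta alpha) **
  opr bhat (rtri alpha beta alpha) (ltri beta alpha alpha) (flip alpha beta).

(* V_23 V_12 = V_12 V_13 V_23 as operators from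
   (H bhat(x)alpha H) bhat|>bhat (x)alpha H to
   H alpha(x) beta<|beta (H alpha(x)beta H). *)
Definition pentagon : Prop :=
  opr alpha (ltri bhat alpha beta) (ltri alpha beta beta) V **
  assoc alpha beta bhat alpha **
  opl (rtri bhat alpha bhat) (rtri alpha beta bhat) alpha V =
  assoc alpha beta alpha beta **
  opl (ltri bhat alpha alpha) (rtri alpha beta alpha) beta V **
  V13 **
  opr bhat (ltri bhat alpha alpha) (rtri alpha beta alpha) V **
  assoc bhat alpha bhat alpha.

End Unitary.

Record is_pmu (R : realType) (B : cbase R) (H : hilbert R)
    (bhat alpha beta : set (bop (cK B) H))
    (V : bop (rtensor bhat alpha) (rtensor alpha beta)) : Prop := IsPMU {
  pmu_module : @is_cmodule3 R (dag B) B (dag B) H bhat alpha beta;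
  pmu_unitary : unitary V;
  pmu_alpha_alpha :
    mulset [set V] (ltri bhat alpha alpha) = rtri alpha beta alpha;
  pmu_bhat_beta : mulset [set V] (rtri bhat alpha beta) = ltri alpha beta bhat;
  pmu_bhat_bhat : mulset [set V] (rtri bhat alpha bhat) = rtri alpha beta bhat;
  pmu_beta_alpha : mulset [set V] (ltri bhat alpha beta) = ltri alpha beta beta;
  pmu_pentagon : pentagon V }.

Section OmegaMaps.
Variables (R : realType) (K0 H : hilbert R).

Definition sqsum (a : set (bop K0 H)) : set (nat -> bop K0 H) :=
  [set eta | (forall k, a (eta k)) /\
             cvgn (series (fun k => adj (eta k) ** eta k))].

(* A map defined on A only is encoded by its extension by 0, so that equality
   of such maps is equality on A. *)
Definition omega (A : set (bop H H)) (eta eta' : nat -> bop K0 H) :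
    bop H H -> bop K0 K0 :=
  patch (fun=> 0) A
    (fun T => limn (series (fun k => adj (eta k) ** T ** eta' k))).

Definition Omega (b a : set (bop K0 H)) (A : set (bop H H)) :
    set (bop H H -> bop K0 K0) :=
  [set omega A xi eta | xi in sqsum b & eta in sqsum a].

(* The map T |-> sum_(m,n) xi_m^* <xi'_n|_2 T |eta_m>_1 eta'_n on a set D of
   operators on H c(x)d H, for xi, xi' in d and eta, eta' in c. *)
Definition omega2 (c d : set (bop K0 H))
    (D : set (bop (rtensor c d) (rtensor c d)))
    (xi eta xi' eta' : nat -> bop K0 H) :
    bop (rtensor c d) (rtensor c d) -> bop K0 K0 :=
  patch (fun=> 0) D (fun T => summability.sum (fun mn : nat * nat =>
    adj (xi mn.1) ** adj (ket2 c d (xi' mn.2)) ** T **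
    ket1 c d (eta mn.1) ** eta' mn.2)).

(* omega_(xi,eta) [x] omega_(xi',eta') on H c(x)d H; the result does not depend
   on the sequences that represent the two maps. *)
Definition boxtimes (c d : set (bop K0 H)) (A : set (bop H H))
    (D : set (bop (rtensor c d) (rtensor c d)))
    (w w' : bop H H -> bop K0 K0) :
    bop (rtensor c d) (rtensor c d) -> bop K0 K0 :=
  xget (fun=> 0) [set F | exists xi eta xi' eta',
    [/\ [/\ sqsum d xi, sqsum c eta, sqsum d xi' & sqsum c eta'],
        w = omega A xi eta, w' = omega A xi' eta' &
        F = omega2 D xi eta xi' eta']].

End OmegaMaps.

Section FourierAlgebras.
Variables (R : realType) (B : cbase R) (H : hilbert R).
Variables bhat alpha beta : set (bop (cK B) H).
Variable V : bop (rtensor bhat alpha) (rtensor alpha beta).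

(* rho_bhat(B)' and rho_beta(B)', the domains of Delta_V and hatDelta_V. *)
Definition dom : set (bop H H) := commutant (rho bhat @` cB B).
Definition hatdom : set (bop H H) := commutant (rho beta @` cB B).

Definition Omega_beta_alpha := Omega beta alpha dom.
Definition Omega_alpha_bhat := Omega alpha bhat hatdom.

Definition Delta (z : bop H H) :
    bop (rtensor alpha beta) (rtensor alpha beta) :=
  V ** opl bhat bhat alpha z ** adj V.

Definition hatDelta (y : bop H H) :
    bop (rtensor bhat alpha) (rtensor bhat alpha) :=
  adj V ** opr alpha beta beta y ** V.

(* (rho_bhat(B) (x) rho_bhat(B))' on H alpha(x)beta H. *)
Definition dom2 : set (bop (rtensor alpha beta) (rtensor alpha beta)) :=
  commutant [set opl alpha alpha beta (rho bhat c) **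
                 opr alpha beta beta (rho bhat c')
            | c in cB B & c' in cB B].

(* (rho_beta(B) (x) rho_beta(B))' on H bhat(x)alpha H. *)
Definition hatdom2 : set (bop (rtensor bhat alpha) (rtensor bhat alpha)) :=
  commutant [set opl bhat bhat alpha (rho beta c) **
                 opr bhat alpha alpha (rho beta c')
            | c in cB B & c' in cB B].

Definition box := @boxtimes R (cK B) H alpha beta dom dom2.
Definition hatbox := @boxtimes R (cK B) H bhat alpha hatdom hatdom2.

(* hatpi_V and pi_V; the values do not depend on the representing sequences. *)
Definition hatpiV (w : bop H H -> bop (cK B) (cK B)) : bop H H :=
  xget 0 [set x | exists xi eta, [/\ sqsum beta xi, sqsum alpha eta,
    w = omega dom xi eta &
    x = limn (series (fun n => adj (ket2 alpha beta (xi n)) ** V **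
                               ket2 bhat alpha (eta n)))]].

Definition piV (u : bop H H -> bop (cK B) (cK B)) : bop H H :=
  xget 0 [set x | exists eta z, [/\ sqsum alpha eta, sqsum bhat z,
    u = omega hatdom eta z &
    x = limn (series (fun n => adj (ket1 alpha beta (eta n)) ** V **
                               ket1 bhat alpha (z n)))]].

Definition hatA0 : set (bop H H) := hatpiV @` Omega_beta_alpha.
Definition A0 : set (bop H H) := piV @` Omega_alpha_bhat.

End FourierAlgebras.

Definition bilinear_on (R : realType) (E F G : lmodType R[i]) (X : set E)
    (Y : set F) (f : E -> F -> G) : Prop :=
  (forall (c : R[i]) x x' y, X x -> X x' -> Y y ->
     f (c *: x + x') y = c *: f x y + f x' y) /\
  (forall (c : R[i]) x y y', X x -> Y y -> Y y' ->
     f x (c *: y + y') = c *: f x y + f x y').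

(* Main.v *)
(* Everything rests on slices of [V]. For [xi] in beta, [eta], [e] in alpha and
   [z] in bhat, the identity [|eta>_1 xi = |xi>_2 eta] gives
     e^* (<xi|_2 V |eta>_2) z = xi^* (<e|_1 V |z>_1) eta,
   and summing over square summable sequences yields omega (pi upsilon) =
   upsilon (hatpi omega). Hence this value depends only on hatpi omega and on
   pi upsilon, which defines the pairing; it is nondegenerate because the ranges
   of alpha, beta and bhat are dense. Slicing the pentagon equation at its first
   leg computes Delta (<e|_1 V |z>_1), at its third leg
   hatDelta (<xi|_2 V |eta>_2), and the intertwining relations of [V] turn the
   results into products of slices, which is the last assertion for single terms.

   To have the operators in the pentagon equation at all one must construct the
   relative tensor products and the maps between them. Both follow from one
   fact: commuting positive operators have a positive product. It makes the
   defining kernel positive definite, so that the tensor product is a reproducing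
   kernel Hilbert space, and it bounds operators defined on generators. *)
Require Import Defs.
From HB Require Import structures.
From mathcomp Require Import all_boot all_order all_algebra finmap sesquilinear complex.
From mathcomp Require Import boolp classical_sets functions reals topology.
From mathcomp Require Import normedtype sequences summability ring.
Set Implicit Arguments.
Unset Strict Implicit.
Unset Printing Implicit Defensive.
Import Order.TTheory GRing.Theory Num.Theory.
Import numFieldNormedType.Exports.
Local Open Scope complex_scope.
Local Open Scope classical_set_scope.
Local Open Scope ring_scope.

(** * Hilbert spaces and bounded operators *)

Section ComplexOrder.
Variable R : realType.

Lemma pos_min (d e : R[i]) : 0 < d -> 0 < e -> exists c : R[i], [/\ 0 < c, c <= d & c <= e].
Proof.
move=> d0 e0; have [ee|ee] : d <= e \/ e <= d.
- by apply/orP; rewrite real_leVge// ger0_real// ltW.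
- by exists d.
- by exists e.
Qed.

Lemma approx_ge0 (r : R[i]) :
  (forall e : R[i], 0 < e -> exists2 t, `|t| <= e & 0 <= r - t) -> 0 <= r.
Proof.
move=> h; have rr : r \is Num.real.
  suff : complex.Im r = 0 by case: (r) => a b /= ->; rewrite complex_real.
  apply/eqP; rewrite -normr_le0; apply/ler_addgt0Pr => e e0; rewrite add0r.
  have [|t te rt] := h e%:C; first by rewrite ltcR.
  have -> : complex.Im r = complex.Im t.
    by move/ger0_Im : rt; rewrite raddfB => /eqP; rewrite subr_eq0 => /eqP.
  rewrite -lecR (le_trans _ te)// normc_def lecR -sqrtr_sqr ler_wsqrtr//.
  by rewrite lerDr sqr_ge0.
apply/ler_addgt0Pr => e e0.
have [t te rt] := h e e0.
have -> : r + e = (r - t) + (t + e) by ring.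
rewrite addr_ge0//.
have tr : t \is Num.real by rewrite -(subKr r t) rpredB// ger0_real.
by rewrite -lerBlDr sub0r; move: te; rewrite real_ler_norml// => /andP[].
Qed.

End ComplexOrder.

(* [lin a x y] stands for [a *: x + y]; it is a parameter because the lemma is
   also applied to formal linear combinations, which do not form a module. *)
Section SemiInner.
Variables (R : realType) (E : Type) (lin : R[i] -> E -> E -> E).
Variable f : E -> E -> R[i].
Hypothesis fP : forall a x y z, f x (lin a y z) = a * f x y + f x z.
Hypothesis fC : forall x y, f y x = (f x y)^*.
Hypothesis f_ge0 : forall x, 0 <= f x x.

Lemma semi_CS x y : `|f x y| ^+ 2 <= f x x * f y y.
Proof.
have fl a u v w : f (lin a u v) w = a^* * f u w + f v w.
  by rewrite fC fP rmorphD rmorphM /= -!fC.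
have ex a : 0 <= f y y + a * f y x + (a * f y x)^* + a * a^* * f x x.
  have := f_ge0 (lin a x y); rewrite fP !fl.
  rewrite rmorphM /= -(fC y x); congr (0 <= _).
  by ring.
have nE : `|f x y| ^+ 2 = f x y * f y x by rewrite normCK -fC.
have [fx0|fx0] := eqVneq (f x x) 0.
  rewrite fx0 mul0r; have [->|c0] := eqVneq (f x y) 0.
    by rewrite normr0 expr0n.
  have c2 : 0 < `|f x y| ^+ 2 by rewrite exprn_gt0// normr_gt0.
  have /negP[] : ~~ (0 <= f y y - (f y y + 1) * 2).
    rewrite -real_ltNge ?realE ?lexx// -?realE; last first.
      by rewrite rpredB ?rpredM ?rpredD ?rpred1 ?realn// ger0_real.
    rewrite subr_lt0 mulrDl mul1r mulr_natr mulr2n -addrA ltrDl.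
    by rewrite ltr_wpDl.
  have := ex (- ((f y y + 1) / `|f x y| ^+ 2) * f x y).
  rewrite fx0 mulr0 addr0 -mulrA -nE mulNr divfK ?gt_eqF//.
  rewrite rmorphN rmorphD rmorph1 /= -fC -addrA -opprD.
  by rewrite [(_ + 1) * 2]mulr_natr mulr2n.
have fx : 0 < f x x by rewrite lt_def fx0 f_ge0.
have := ex (- f x y / f x x).
have -> : (- f x y / f x x)^* = - f y x / f x x.
  by rewrite rmorphM rmorphN fmorphV /= -!fC.
have -> : - f x y / f x x * f y x = - (`|f x y| ^+ 2 / f x x).
  by rewrite nE !mulNr mulrAC.
have -> : (- (`|f x y| ^+ 2 / f x x))^* = - (`|f x y| ^+ 2 / f x x).
  by rewrite nE rmorphN rmorphM fmorphV rmorphM /= -!fC [f y x * _]mulrC.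
have -> : - f x y / f x x * (- f y x / f x x) * f x x = `|f x y| ^+ 2 / f x x.
  by rewrite nE; field.
by rewrite subrK subr_ge0 ler_pdivrMr// mulrC.
Qed.

End SemiInner.

Section InnerProduct.
Variables (R : realType) (H : hilbert R).
Implicit Types (x y z : H) (a : R[i]).

Lemma ipP x a y z : ip x (a *: y + z) = a * ip x y + ip x z.
Proof. exact: linearPl. Qed.

Lemma ipC x y : ip y x = (ip x y)^*.
Proof. by rewrite /ip (hermC (hdot H)) expr0 mul1r. Qed.

Lemma ip_norm x : ip x x = `|x| ^+ 2.
Proof. exact: hdotE. Qed.

Lemma ipDr x y z : ip x (y + z) = ip x y + ip x z.
Proof. by rewrite -{1}[y]scale1r ipP mul1r. Qed.

Lemma ip0r x : ip x 0 = 0.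
Proof. by apply: (addrI (ip x 0)); rewrite -ipDr !addr0. Qed.

Lemma ipZr x a y : ip x (a *: y) = a * ip x y.
Proof. by rewrite -[_ *: _]addr0 ipP ip0r addr0. Qed.

Lemma ipNr x y : ip x (- y) = - ip x y.
Proof. by rewrite -scaleN1r ipZr mulN1r. Qed.

Lemma ipBr x y z : ip x (y - z) = ip x y - ip x z.
Proof. by rewrite ipDr ipNr. Qed.

Lemma ipDl x y z : ip (x + y) z = ip x z + ip y z.
Proof. by rewrite ipC ipDr rmorphD /= -!ipC. Qed.

Lemma ipZl a x y : ip (a *: x) y = a^* * ip x y.
Proof. by rewrite ipC ipZr rmorphM /= -ipC. Qed.

Lemma ip0l x : ip 0 x = 0. Proof. by rewrite ipC ip0r rmorph0. Qed.

Lemma ipNl x y : ip (- x) y = - ip x y.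
Proof. by rewrite ipC ipNr rmorphN /= -ipC. Qed.

Lemma ipBl x y z : ip (x - y) z = ip x z - ip y z.
Proof. by rewrite ipDl ipNl. Qed.

Lemma ip_sumr x I (r : seq I) P (F : I -> H) :
  ip x (\sum_(i <- r | P i) F i) = \sum_(i <- r | P i) ip x (F i).
Proof. exact: (big_morph _ (ipDr x) (ip0r x)). Qed.

Lemma ip_suml x I (r : seq I) P (F : I -> H) :
  ip (\sum_(i <- r | P i) F i) x = \sum_(i <- r | P i) ip (F i) x.
Proof. exact: (big_morph (fun y => ip y x) (fun y z => ipDl y z x) (ip0l x)). Qed.

Lemma ip_ge0 x : 0 <= ip x x.
Proof. by rewrite ip_norm exprn_ge0. Qed.

Lemma ip_CS x y : `|ip x y| <= `|x| * `|y|.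
Proof.
have := @semi_CS R H (fun a u v => a *: u + v) _ (fun a u v w => ipP u a v w) ipC ip_ge0 x y.
by rewrite !ip_norm -exprMn ler_pXn2r// nnegrE// mulr_ge0.
Qed.

Lemma ip_inj x y : (forall z, ip z x = ip z y) -> x = y.
Proof.
move=> e; apply/eqP; rewrite -subr_eq0 -normr_eq0 -sqrf_eq0 -ip_norm.
by rewrite ipBr e subrr.
Qed.

End InnerProduct.

Section Spans.
Variables (R : realType) (E : normedModType R[i]).
Implicit Types (A Y P : set E).

Lemma closure_normP A x :
  closure A x <-> forall e : R[i], 0 < e -> exists2 a, A a & `|x - a| <= e.
Proof.
split=> [Ax e e0|Ax U].
  have [|a [Aa /=]] := Ax (ball x e); first exact: nbhsx_ballx.
  by rewrite -ball_normE /= => /ltW; exists a.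
move=> /nbhs_ballP[e /= e0 eU].
have [a Aa xa] := Ax _ (divr_gt0 e0 (ltr0n _ 2)); exists a; split=> //.
apply: eU; rewrite -ball_normE /= (le_lt_trans xa)//.
by rewrite ltr_pdivrMr// ltr_pMr// ltr1n.
Qed.

Lemma closed_subspace0 P : closed_subspace P -> P 0. Proof. by case. Qed.

Lemma closed_subspaceD P x y : closed_subspace P -> P x -> P y -> P (x + y).
Proof. by case=> _ _ h Px Py; rewrite -[x]scale1r; apply: h. Qed.

Lemma closed_subspaceZ P c x : closed_subspace P -> P x -> P (c *: x).
Proof. by case=> _ P0 h Px; rewrite -[_ *: _]addr0; apply: h. Qed.

Lemma closed_subspace_sum P I (r : seq I) (Q : pred I) (F : I -> E) : closed_subspace P ->
  (forall i, Q i -> P (F i)) -> P (\sum_(i <- r | Q i) F i).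
Proof.
move=> cP; apply: big_ind; first exact: closed_subspace0.
by move=> x y; apply: closed_subspaceD.
Qed.

Lemma closed_subspace_lim P (x : E) : closed_subspace P ->
  (forall e : R[i], 0 < e -> exists2 a, P a & `|x - a| <= e) -> P x.
Proof. by move=> [cP _ _] h; apply: cP; apply/closure_normP. Qed.

Lemma sub_cspan Y : Y `<=` cspan Y.
Proof.
move=> y Yy; apply: subset_closure; exists 1%N, (fun=> 1), (fun=> y).
by rewrite big_ord1 scale1r.
Qed.

Lemma cspan_sub Y P : closed_subspace P -> Y `<=` P -> cspan Y `<=` P.
Proof.
move=> cP YP x xY; apply: closed_subspace_lim => // e e0.
have [a [n [c [y [Yy ->]]]] xa] := (closure_normP _ _).1 xY e e0.
exists (\sum_(i < n) c i *: y i) => //.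
by apply: closed_subspace_sum => // i _; apply: closed_subspaceZ => //; apply: YP.
Qed.

Lemma lspan_lin Y a u v : lspan Y u -> lspan Y v -> lspan Y (a *: u + v).
Proof.
move=> [n [c [y [Yy ->]]]] [m [d [z [Yz ->]]]].
exists (n + m)%N, (fun i => match fintype.split i with inl j => a * c j | inr j => d j end),
  (fun i => match fintype.split i with inl j => y j | inr j => z j end); split.
  by move=> i; case: fintype.split.
rewrite big_split_ord /= scaler_sumr; congr (_ + _); apply: eq_bigr => i _.
  by rewrite (unsplitK (inl _ i)) scalerA.
by rewrite (unsplitK (inr _ i)).
Qed.

Lemma cspan_closed_subspace Y : closed_subspace (cspan Y).
Proof.
split; first exact: closed_closure.
  by apply: subset_closure; exists 0%N, (fun=> 0), (fun=> 0); split; [case|rewrite big_ord0].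
move=> c u v /closure_normP uY /closure_normP vY; apply/closure_normP => e e0.
have e2 : 0 < e / 2 by rewrite divr_gt0.
have c0 : 0 < `|c| + 1 by rewrite ltr_wpDl.
have [a Ya ua] := uY _ (divr_gt0 e2 c0); have [b Yb vb] := vY _ e2.
exists (c *: a + b); first exact: lspan_lin.
rewrite opprD addrACA -scalerBr (le_trans (ler_normD _ _))//.
rewrite [leRHS]splitr lerD// normrZ (le_trans (ler_wpM2l _ ua))//.
by rewrite mulrA ler_pdivrMr// mulrC ler_wpM2l ?ltW// ltrDl.
Qed.

Lemma cspanS Y Y' : Y `<=` cspan Y' -> cspan Y `<=` cspan Y'.
Proof. by move=> YY'; apply: cspan_sub => //; apply: cspan_closed_subspace. Qed.

End Spans.

Section Operators.
Variables (R : realType) (H K : hilbert R).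

Lemma bop_le (T : bop H K) x : `|T x| <= `|T| * `|x|.
Proof.
have [->|x0] := eqVneq x 0; first by rewrite linear0 !normr0 mulr0.
have nx0 : 0 < `|x| by rewrite normr_gt0.
have := @opnorm_ub _ _ _ T (`|x|^-1 *: x).
rewrite linearZ/= !normrZ normfV normr_id mulVf ?gt_eqF// => /(_ (lexx _)).
by rewrite mulrC ler_pdivrMr.
Qed.

Lemma bop_norm_le (T : bop H K) M : 0 <= M ->
  (forall x, `|T x| <= M * `|x|) -> `|T| <= M.
Proof.
move=> M0 h; apply: opnorm_le => x x1; rewrite (le_trans (h x))//.
by rewrite ler_piMr.
Qed.

Lemma mkbop (f : H -> K) M : 0 <= M -> linear f -> (forall x, `|f x| <= M * `|x|) ->
  exists T : bop H K, forall x, T x = f x.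
Proof.
move=> M0 lf fM.
have cf : continuous f.
  move=> x; apply/cvgrPdist_le => e e0.
  have M1 : 0 < M + 1 by rewrite ltr_wpDl.
  near=> y; have -> : f x - f y = f (x - y).
    by rewrite addrC -[- f y]scaleN1r -lf scaleN1r addrC.
  rewrite (le_trans (fM _))// (@le_trans _ _ ((M + 1) * `|x - y|))//.
    by rewrite ler_wpM2r// lerDl.
  rewrite mulrC -ler_pdivlMr//; near: y.
  by apply: cvgr_dist_le; [exact: cvg_id|rewrite divr_gt0].
have fP : f \in @bounded_op R H K by rewrite inE.
by exists (BOp fP).
Unshelve. all: by end_near. Qed.

End Operators.

Section Completeness.
Variable R : realType.

Lemma complex_lim T (F : set_system T) (FF : ProperFilter F) (f : T -> R[i]) :
  (forall e : R[i], 0 < e -> exists z, F [set w | `|z - f w| < e]) ->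
  exists l, forall e : R[i], 0 < e -> F [set w | `|l - f w| <= e].
Proof.
move=> cF.
have re (p : R[i] -> R) (pB : forall x y, p (x - y) = p x - p y)
    (pn : forall z, `|p z|%:C <= `|z|) : exists l : R, p (f z) @[z --> F] --> l.
  suff : cvg (p (f z) @[z --> F]) by move=> h; exists (lim (p (f z) @[z --> F])).
  apply: (@cauchy_cvg R); apply/cauchyP => e e0.
  have e0' : 0 < e%:C by rewrite ltcR.
  have [z zF] := cF e%:C e0'.
  exists (p z); rewrite -ball_normE /= /nbhs/=.
  apply: filterS zF => w /= zw.
  by rewrite -ltcR (le_lt_trans _ zw)// -pB.
have [a aF] := re (@complex.Re R)
  (fun x y => raddfB (@complex.Re R : {additive Rcomplex R -> R}) x y) (@normc_ge_Re R).
have [|b bF] := re (@complex.Im R)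
  (fun x y => raddfB (@complex.Im R : {additive Rcomplex R -> R}) x y).
  move=> z; rewrite normc_def lecR -[leLHS]sqrtr_sqr.
  by rewrite ler_wsqrtr// lerDr sqr_ge0.
exists (a +i* b) => e e0.
have e2 : 0 < complex.Re e / 2 by rewrite divr_gt0// -ltcR RRe_real// gtr0_real.
have A : F [set w | `|a - complex.Re (f w)| <= complex.Re e / 2].
  exact: cvgr_dist_le.
have B : F [set w | `|b - complex.Im (f w)| <= complex.Re e / 2].
  exact: cvgr_dist_le.
apply: filterS2 A B => w /= aw bw.
have -> : a +i* b - f w = (a - complex.Re (f w))%:C + 'i%C * (b - complex.Im (f w))%:C.
  by case: (f w) => c d; simpc.
rewrite (le_trans (ler_normD _ _))// normrM !normc_def/= !expr0n/= !addr0 add0r expr1n.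
rewrite sqrtr1 mul1r !sqrtr_sqr -rmorphD/= -[e]RRe_real ?gtr0_real// lecR.
by rewrite [leRHS]splitr lerD.
Qed.

Variables H K : hilbert R.

Lemma compo_le (L : hilbert R) (S : bop K L) (T : bop H K) : `|S ** T| <= `|S| * `|T|.
Proof.
apply: bop_norm_le; first exact: mulr_ge0.
move=> x; rewrite (le_trans (bop_le S _))// -mulrA ler_wpM2l//.
exact: bop_le.
Qed.

Lemma bop_complete (F : set_system (bop H K)) (FF : ProperFilter F) :
  cauchy F -> cvg F.
Proof.
move=> cF; have cF' e : 0 < e -> exists S : bop H K, F [set T | `|S - T| < e].
  move=> e0; have [z zF] := (cauchyP F).1 cF e e0.
  by exists z; move: zF; rewrite -ball_normE.
have /choice[g gF] x : exists y : K, (T : bop H K) x @[T --> F] --> y.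
  suff : cvg ((T : bop H K) x @[T --> F]).
    by move=> h; exists (lim ((T : bop H K) x @[T --> F])).
  apply: cauchy_cvg; apply/cauchyP => e e0.
  have x1 : 0 < `|x| + 1 by rewrite ltr_wpDl.
  have [S SF] := cF' _ (divr_gt0 e0 x1); exists (S x).
  rewrite -ball_normE /nbhs/=; apply: filterS SF => T /= ST.
  have -> : S x - T x = (S - T) x by [].
  rewrite (le_lt_trans (bop_le _ _))// (@le_lt_trans _ _ (`|S - T| * (`|x| + 1)))//.
    by rewrite ler_wpM2l// lerDl.
  by rewrite -ltr_pdivlMr.
have gd S e x : F [set T | `|S - T| < e] -> `|S x - g x| <= e * `|x|.
  move=> SF; apply/ler_addgt0Pr => d d0.
  have gx : F [set T : bop H K | `|g x - T x| <= d] by exact: (cvgr_dist_le _ _ (gF x)).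
  have [T [/= ST gT]] := filter_ex (filterI SF gx).
  rewrite -(subrKA (T x)) (le_trans (ler_normD _ _))// lerD//; last by rewrite distrC.
  have -> : S x - T x = (S - T) x by [].
  by rewrite (le_trans (bop_le _ _))// ler_wpM2r// ltW.
have gl : linear g.
  move=> a x y; apply: (@cvg_unique _ (@norm_hausdorff _ _) (((T : bop H K) (a *: x + y)) @[T --> F])).
    exact: gF.
  have -> : (fun T : bop H K => T (a *: x + y)) = (fun T : bop H K => a *: T x + T y).
    by apply/funext => T; rewrite linearP.
  by apply: cvgD; [apply: cvgZl_tmp; exact: gF|exact: gF].
have [S0 S0F] := cF' 1 ltr01.
have [T TE] : exists T : bop H K, forall x, T x = g x.
  apply: (@mkbop _ _ _ g (`|S0| + 1)) => [|//|x]; first by rewrite addr_ge0.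
  rewrite mulrDl -[g x](subKr (S0 x)) (le_trans (ler_normB _ _))// lerD//.
    exact: bop_le.
  exact: gd.
apply/cvg_ex; exists T; apply/cvgrPdist_le => e e0 /=.
have e2 : 0 < e / 2 by rewrite divr_gt0.
have [S SF] := cF' _ e2.
apply: filterS (SF) => S' /= SS'.
rewrite -(subrKA S) (le_trans (ler_normD _ _))// [leRHS]splitr lerD//; last exact: ltW.
apply: bop_norm_le => [|x]; first exact: ltW.
have -> : (T - S) x = T x - S x by [].
by rewrite TE distrC; exact: gd.
Qed.

(* The representing vector minimizes [J x = |x|^2 - 2 Re (f x)]: the sublevel
   sets of [J] form a Cauchy filter. *)
Lemma riesz (f : H -> R[i]) M :
  (forall a x y, f (a *: x + y) = a * f x + f y) ->
  (forall x, `|f x| <= M * `|x|) -> exists v, forall x, f x = ip v x.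
Proof.
move=> fl fM; have f0 : f 0 = 0 by have := fl (-1) 0 0; rewrite scaler0 addr0 mulN1r addNr.
pose J x := `|x| ^+ 2 - f x - (f x)^*.
have M0 : (M \is Num.real) \/ forall x : H, x = 0.
  have [h|/existsNP[x /eqP x0]] := pselect (forall x : H, x = 0); [by right|left].
  have nx : 0 < `|x| by rewrite normr_gt0.
  by rewrite -(mulfK (lt0r_neq0 nx) M) rpredM ?rpredV ?normr_real// ger0_real// (le_trans _ (fM x)).
case: M0 => [Mr|H0]; last by exists 0 => x; rewrite (H0 x) f0 ip0r.
have Jr x : (complex.Re (J x))%:C = J x.
  by apply: RRe_real; rewrite /J -addrA -opprD rpredB ?realX ?normr_real// CrealE rmorphD/= conjCK addrC.
have fM2 x : f x + (f x)^* <= (M * `|x|) *+ 2.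
  rewrite (le_trans (real_ler_norm _))//; first by rewrite CrealE rmorphD/= conjCK addrC.
  by rewrite (le_trans (ler_normD _ _))// norm_conjC mulr2n lerD.
have Jge x : - M ^+ 2 <= J x.
  have -> : J x = - M ^+ 2 + ((`|x| - M) ^+ 2 + ((M * `|x|) *+ 2 - (f x + (f x)^*))).
    by rewrite /J; ring.
  rewrite lerDl addr_ge0 ?subr_ge0//.
  by rewrite real_exprn_even_ge0// rpredB// normr_real.
have JD x a h : J (x + a *: h) = J x + `|a| ^+ 2 * `|h| ^+ 2
   + a * (ip x h - f h) + (a * (ip x h - f h))^*.
  rewrite /J [x + _]addrC -!ip_norm fl !(ipDl, ipDr, ipZl, ipZr) (ipC x h) normCK.
  by rewrite !rmorphM !rmorphD rmorphN !rmorphM /=; ring.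
pose d := inf [set complex.Re (J x) | x in [set: H]].
have dJ x : d%:C <= J x.
  rewrite -Jr lecR; apply: ge_inf; last by exists x.
  exists (complex.Re (- M ^+ 2)) => _ [y _ <-]; rewrite -lecR Jr RRe_real//.
  by rewrite rpredN rpredX.
have dE e : 0 < e -> exists x, J x <= d%:C + e ^+ 2.
  move=> e0.
  have er : 0 < complex.Re (e ^+ 2) by rewrite -ltcR RRe_real ?exprn_gt0// gtr0_real// exprn_gt0.
  have hinf : has_inf [set complex.Re (J x) | x in [set: H]].
    split; first by exists (complex.Re (J 0)), 0.
    exists (complex.Re (- M ^+ 2)) => _ [y _ <-]; rewrite -lecR Jr RRe_real//.
    by rewrite rpredN rpredX.
  have [_ [x _ <-] xd] := inf_adherent er hinf; exists x.
  rewrite -Jr -(@RRe_real _ (e ^+ 2)) ?gtr0_real ?exprn_gt0// -rmorphD lecR; exact: ltW.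
have key x e h : 0 < e -> J x <= d%:C + e ^+ 2 -> `|ip x h - f h| <= e * `|h|.
  move=> e0 xd; have [->|h0] := eqVneq h 0; first by rewrite ip0r f0 subrr !normr0 mulr0.
  have nh : 0 < `|h| ^+ 2 by rewrite exprn_gt0// normr_gt0.
  set c := ip x h - f h.
  have D := dJ (x + (- c^* / `|h| ^+ 2) *: h); rewrite JD -/c in D.
  have {D} := le_trans D (lerD (lerD (lerD xd (lexx _)) (lexx _)) (lexx _)).
  rewrite -(addrA d%:C) -2!(addrA (d%:C)) lerDl -!addrA.
  have -> : - c^* / `|h| ^+ 2 * c = - (`|c| ^+ 2 / `|h| ^+ 2).
    by rewrite normCK; field; rewrite normr_eq0.
  have -> : (- (`|c| ^+ 2 / `|h| ^+ 2))^* = - (`|c| ^+ 2 / `|h| ^+ 2).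
    by apply/CrealP; rewrite rpredN rpredM ?rpredV ?rpredX// normr_real.
  have -> : `|- c^* / `|h| ^+ 2| = `|c| / `|h| ^+ 2.
    by rewrite normrM normrN norm_conjC normfV normrX normr_id.
  have -> : e ^+ 2 + ((`|c| / `|h| ^+ 2) ^+ 2 * `|h| ^+ 2 +
     (- (`|c| ^+ 2 / `|h| ^+ 2) - `|c| ^+ 2 / `|h| ^+ 2)) =
     e ^+ 2 - `|c| ^+ 2 / `|h| ^+ 2 by field; rewrite normr_eq0.
  rewrite subr_ge0 ler_pdivrMr// -exprMn ler_pXn2r ?nnegrE ?mulr_ge0 ?(ltW e0)//.
pose G := filter_from [set e : R[i] | 0 < e] (fun e => [set x | J x <= d%:C + e ^+ 2]).
have GF : ProperFilter G.
  apply: filter_from_proper; last by move=> e /dE[x xe]; exists x.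
  apply: filter_from_filter; first by exists 1; exact: ltr01.
  move=> e e' /= e0 e0'; have [ee|ee] : e <= e' \/ e' <= e.
    by apply/orP; rewrite real_leVge// ger0_real// ltW.
    exists e => // x /= xe; split=> //; rewrite (le_trans xe)// lerD2l.
    by rewrite ler_pXn2r// nnegrE ltW.
  exists e' => // x /= xe; split=> //; rewrite (le_trans xe)// lerD2l.
  by rewrite ler_pXn2r// nnegrE ltW.
have : cauchy G.
  apply/cauchyP => e e0; have e4 : 0 < e / 4 by rewrite divr_gt0.
  have [x xe] := dE _ e4; exists x; exists (e / 4) => // y /= ye.
  rewrite -ball_normE /=.
  have : `|ip (x - y) (x - y)| <= (e / 2) * `|x - y|.
    rewrite ipBl -(subrKA (f (x - y))) (le_trans (ler_normD _ _))//.
    have -> : e / 2 = e / 4 + e / 4 by field.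
    rewrite mulrDl lerD//; first exact: (key _ _ _ e4 xe).
    by rewrite [leLHS]distrC; exact: (key _ _ _ e4 ye).
  rewrite ip_norm normrX normr_id expr2 => h.
  have [->|xy] := eqVneq x y; first by rewrite subrr normr0.
  move: h; rewrite ler_pM2r ?normr_gt0 ?subr_eq0// => /le_lt_trans; apply.
  by rewrite ltr_pdivrMr// ltr_pMr// ltr1n.
move=> /cauchy_cvg /cvg_ex[v vG]; exists v => h; apply/eqP.
rewrite -subr_eq0 -normr_le0; apply/ler_addgt0Pr => e e0; rewrite add0r.
have h1 : 0 < `|h| + 1 by rewrite ltr_wpDl.
have e2 : 0 < e / 2 / (`|h| + 1) by rewrite !divr_gt0.
have vG2 : G [set x | `|v - x| <= e / 2 / (`|h| + 1)] by exact: (@cvgr_dist_le _ _ _ G _ id v vG).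
have Ge : G [set x | J x <= d%:C + (e / 2 / (`|h| + 1)) ^+ 2] by exists (e / 2 / (`|h| + 1)).
have [x [/= xv xe]] := filter_ex (filterI vG2 Ge).
rewrite distrC -(subrKA (ip x h)) (le_trans (ler_normD _ _))// -ipBl [leRHS]splitr.
have hle z : z <= e / 2 / (`|h| + 1) -> z * `|h| <= e / 2.
  move=> ze; rewrite (@le_trans _ _ (e / 2 / (`|h| + 1) * `|h|))//.
    by rewrite ler_wpM2r.
  by rewrite mulrAC ler_pdivrMr// ler_wpM2l// ?lerDl// divr_ge0// ltW.
rewrite lerD//; first by rewrite (le_trans (ip_CS _ _))// hle.
by rewrite (le_trans (key _ _ _ e2 xe))// hle.
Qed.

End Completeness.

Section Composition.
Variables (R : realType).
Implicit Types H K L : hilbert R.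

Lemma compoA H K L M (S : bop L M) (T : bop K L) (U : bop H K) :
  S ** (T ** U) = S ** T ** U.
Proof. exact: bopP. Qed.

Lemma comp1o H K (T : bop H K) : opid K ** T = T.
Proof. exact: bopP. Qed.

Lemma compo1 H K (T : bop H K) : T ** opid H = T.
Proof. exact: bopP. Qed.

Lemma compoPl H K L a (S : bop H K) (S' : bop H K) (T : bop L H) :
  (a *: S + S') ** T = a *: (S ** T) + S' ** T.
Proof. exact: bopP. Qed.

Lemma compoPr H K L a (S : bop L K) (T T' : bop H L) :
  S ** (a *: T + T') = a *: (S ** T) + S ** T'.
Proof. by apply: bopP => x /=; rewrite linearP. Qed.

Lemma compoDr H K L (S : bop L K) (T T' : bop H L) :
  S ** (T + T') = S ** T + S ** T'.
Proof. by apply: bopP => x /=; rewrite linearD. Qed.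

Lemma compoBr H K L (S : bop L K) (T T' : bop H L) :
  S ** (T - T') = S ** T - S ** T'.
Proof. by apply: bopP => x /=; rewrite linearB. Qed.

Lemma compoBl H K L (S S' : bop L K) (T : bop H L) :
  (S - S') ** T = S ** T - S' ** T.
Proof. exact: bopP. Qed.

Lemma compo0r H K L (S : bop L K) : S ** (0 : bop H L) = 0.
Proof. by apply: bopP => x /=; rewrite linear0. Qed.

Lemma compo0l H K L (T : bop H L) : (0 : bop L K) ** T = 0.
Proof. exact: bopP. Qed.

Lemma bop_sumE H K I (r : seq I) (P : pred I) (F : I -> bop H K) x :
  (\sum_(i <- r | P i) F i) x = \sum_(i <- r | P i) F i x.
Proof. by elim/big_rec2: _ => // i y T _ <-. Qed.

Lemma compo_sumr H K L (S : bop L K) I (r : seq I) (P : pred I) (F : I -> bop H L) :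
  S ** (\sum_(i <- r | P i) F i) = \sum_(i <- r | P i) S ** F i.
Proof. exact: (big_morph (compo S) (compoDr S) (compo0r _ S)). Qed.

Lemma compo_suml H K L (S : bop H L) I (r : seq I) (P : pred I) (F : I -> bop L K) :
  (\sum_(i <- r | P i) F i) ** S = \sum_(i <- r | P i) F i ** S.
Proof. by apply: (big_morph (fun T => compo T S)) => [T T'|]; exact: bopP. Qed.

Lemma adjP H K (T : bop H K) x y : ip (adj T x) y = ip x (T y).
Proof.
suff [S SE] : exists S : bop K H, forall x y, ip (S x) y = ip x (T y).
  exact: (@xgetPex _ 0 [set S : bop K H | forall x y, ip (S x) y = ip x (T y)] (ex_intro _ S SE) x y).
have /choice[g gE] u : exists v : H, forall y, ip u (T y) = ip v y.
  apply: (@riesz _ H (fun y => ip u (T y)) (`|u| * `|T|)) => [a v w|v]; first by rewrite linearP ipP.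
  by rewrite (le_trans (ip_CS _ _))// -mulrA ler_wpM2l// bop_le.
have gl : linear g.
  move=> a u v; apply: ip_inj => z; rewrite ipC [RHS]ipC.
  by rewrite (ipDl _ (g v)) ipZl -!gE ipDl ipZl.
have gM u : `|g u| <= `|T| * `|u|.
  have [->|gu] := eqVneq (g u) 0; first by rewrite normr0 mulr_ge0.
  rewrite -(@ler_pM2r _ `|g u|) ?normr_gt0// -expr2 -ip_norm -gE.
  rewrite -[X in X <= _]ger0_norm; last by rewrite gE ip_ge0.
  by rewrite (le_trans (ip_CS _ _))// mulrC mulrAC ler_wpM2r// bop_le.
have [S SE] := mkbop (normr_ge0 T) gl gM.
by exists S => u v; rewrite SE gE.
Qed.

Lemma adjPr H K (T : bop H K) x y : ip x (adj T y) = ip (T x) y.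
Proof. by rewrite ipC adjP -ipC. Qed.

Lemma bop_ip_eq H K (S T : bop H K) : (forall x y, ip x (S y) = ip x (T y)) -> S = T.
Proof. by move=> e; apply: bopP => x; apply: ip_inj => z; exact: e. Qed.

Lemma adjK H K (T : bop H K) : adj (adj T) = T.
Proof. by apply: bop_ip_eq => x y; rewrite adjPr adjP. Qed.

Lemma adj_comp H K L (S : bop K L) (T : bop H K) : adj (S ** T) = adj T ** adj S.
Proof. by apply: bop_ip_eq => x y; rewrite /= !adjPr. Qed.

Lemma adj_lin H K a (S T : bop H K) : adj (a *: S + T) = a^* *: adj S + adj T.
Proof.
apply: bop_ip_eq => x y; rewrite adjPr.
have -> z : (a *: S + T) z = a *: S z + T z by [].
have -> z : (a^* *: adj S + adj T) z = a^* *: adj S z + adj T z by [].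
by rewrite ipDl ipZl ipP !adjPr.
Qed.

Lemma adjD H K (S T : bop H K) : adj (S + T) = adj S + adj T.
Proof. by rewrite -{1}[S]scale1r adj_lin rmorph1 scale1r. Qed.

Lemma adj0 H K : adj (0 : bop H K) = 0.
Proof. by apply: (addrI (adj 0)); rewrite -adjD !addr0. Qed.

Lemma adjB H K (S T : bop H K) : adj (S - T) = adj S - adj T.
Proof. by rewrite addrC -scaleN1r adj_lin rmorphN rmorph1 scaleN1r addrC. Qed.

Lemma norm_ip_le H K (T : bop H K) M : 0 <= M ->
  (forall x y, `|ip x (T y)| <= M * `|x| * `|y|) -> `|T| <= M.
Proof.
move=> M0 h; apply: bop_norm_le => // x.
have [->|Tx] := eqVneq (T x) 0; first by rewrite normr0 mulr_ge0.
rewrite -(@ler_pM2r _ `|T x|) ?normr_gt0// mulrAC (le_trans _ (h _ _))//.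
by rewrite ip_norm normrX normr_id.
Qed.

Lemma norm_adj H K (T : bop H K) : `|adj T| = `|T|.
Proof.
have le H' K' (S : bop H' K') : `|adj S| <= `|S|.
  apply: norm_ip_le => // x y; rewrite adjPr (le_trans (ip_CS _ _))//.
  by rewrite ler_wpM2r// bop_le.
by apply/le_anti; rewrite le//= -{1}[T]adjK le.
Qed.

Lemma adj_norm2 H K (T : bop H K) x : `|T x| ^+ 2 = ip x ((adj T ** T) x).
Proof. by rewrite /= adjPr ip_norm. Qed.

End Composition.

Section Density.
Variables (R : realType).
Implicit Types H K L : hilbert R.

Definition dense_range H K (S : set (bop H K)) := cspan (rangeset S) = [set: K].

Lemma ker_closed_subspace (E F : normedModType R[i]) (f : E -> F) M : 0 <= M ->
  linear f -> (forall x, `|f x| <= M * `|x|) -> closed_subspace [set x | f x = 0].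
Proof.
move=> M0 fl fM; split.
- move=> x /closure_normP cx /=; apply/eqP; rewrite -normr_le0.
  apply/ler_addgt0Pr => e e0; rewrite add0r.
  have M1 : 0 < M + 1 by rewrite ltr_wpDl.
  have [a /= a0 xa] := cx _ (divr_gt0 e0 M1).
  have -> : f x = f (x - a) by rewrite addrC -scaleN1r fl a0 scaler0 add0r.
  rewrite (le_trans (fM _))// (@le_trans _ _ (M * (e / (M + 1))))// ?ler_wpM2l//.
  by rewrite mulrA ler_pdivrMr// mulrC ler_wpM2l ?(ltW e0)// lerDl.
- by have := fl (-1) 0 0; rewrite scaler0 add0r scaleN1r addNr.
- by move=> c u v /= u0 v0; rewrite fl u0 v0 scaler0 addr0.
Qed.

Lemma dense_ext H K L (S : set (bop H K)) (T T' : bop K L) : dense_range S ->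
  (forall s, S s -> T ** s = T' ** s) -> T = T'.
Proof.
move=> dS TT'; apply: bopP => x; apply/eqP; rewrite -subr_eq0; apply/eqP.
have -> : T x - T' x = (T - T') x by [].
have cs : closed_subspace [set x | (T - T') x = 0].
  apply: (ker_closed_subspace (normr_ge0 (T - T'))).
    by move=> a u v; rewrite linearP.
  exact: bop_le.
have : [set: K] x by [].
rewrite -dS; apply: (cspan_sub cs) => _ [s Ss [y _ <-]] /=.
have /= := congr1 (fun f : bop _ _ => f y) (TT' s Ss).
by move=> e; rewrite [LHS](_ : _ = T (s y) - T' (s y))// e subrr.
Qed.

Lemma sub_dense H K L (S : set (bop H K)) (S' : set (bop L K)) :
  dense_range S -> rangeset S `<=` cspan (rangeset S') -> dense_range S'.
Proof.
move=> dS SS'; apply/seteqP; split=> // x _.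
by have : [set: K] x by []; rewrite -dS; apply: cspanS.
Qed.

Lemma dense_comp H K L (S : set (bop H K)) (T : set (bop K L)) :
  dense_range S -> dense_range T -> dense_range (mulset T S).
Proof.
move=> dS dT; apply: (sub_dense dT) => _ [t Tt [x _ <-]].
have cs : closed_subspace [set x | cspan (rangeset (mulset T S)) (t x)].
  have [c0 c1 c2] := cspan_closed_subspace (rangeset (mulset T S)).
  split=> /=; [|by rewrite linear0|by move=> c u v cu cv; rewrite linearP; apply: c2].
  by apply: (@preimage_closed _ _ t) => // y _; exact: bop_continuous.
have : [set: K] x by [].
rewrite -dS; apply: (cspan_sub cs) => _ [s Ss [y _ <-]] /=.
by apply: sub_cspan; exists (t ** s); [exists t => //; exists s|exists y].
Qed.

End Density.

(** * Products of commuting positive operators *)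

Section CommutingPositive.
Variables (R : realType) (E : lmodType R[i]) (f : E -> E -> R[i]).
Hypothesis fP : forall a x y z, f x (a *: y + z) = a * f x y + f x z.
Hypothesis fC : forall x y, f y x = (f x y)^*.
Hypothesis f_ge0 : forall x, 0 <= f x x.

Let f0 x : f x 0 = 0.
Proof. by have := fP (-1) x 0 0; rewrite scaler0 addr0 mulN1r addNr. Qed.

Let fB x y z : f x (y - z) = f x y - f x z.
Proof. by rewrite addrC -scaleN1r fP mulN1r addrC. Qed.

Let fZ a x y : f x (a *: y) = a * f x y.
Proof. by rewrite -[_ *: _]addr0 fP f0 addr0. Qed.

Let fBl x y z : f (x - y) z = f x z - f y z.
Proof. by rewrite fC fB rmorphB /= -!fC. Qed.

(* With [Q 0 = P] and [Q k.+1 = Q k - (Q k)^2] one has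
   [P = \sum_(k < N) (Q k)^2 + Q N], where [(Q k)^2 D = Q k D Q k] is positive
   and [Q k x] becomes arbitrarily small. No square root of [P] is needed. *)
Lemma comm_pos_contr (P D : E -> E) : linear P -> linear D ->
  (forall x y, f x (P y) = f (P x) y) ->
  (forall x, 0 <= f x (P x)) -> (forall x, f x (P x) <= f x x) ->
  (forall x, 0 <= f x (D x)) -> (forall x, P (D x) = D (P x)) ->
  forall x, 0 <= f x (P (D x)).
Proof.
move=> Pl Dl Ph P0 P1 D0 PD x.
pose fix Q k := if k is k'.+1 then fun y => Q k' y - Q k' (Q k' y) else P.
have linB (g : E -> E) : linear g -> forall y z, g (y - z) = g y - g z.
  by move=> gl y z; have := gl (-1) z y; rewrite !scaleN1r ![- _ + _]addrC.
have Qp k : [/\ linear (Q k), forall y z, f y (Q k z) = f (Q k y) z,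
    forall y, 0 <= f y (Q k y) & forall y, f y (Q k y) <= f y y] /\
    forall y, Q k (D y) = D (Q k y).
  elim: k => [//|k [[Ql Qh Q0 Q1] QD]]; split; last first.
    by move=> y /=; rewrite !QD linB.
  split=> /=.
  - by move=> a y z; rewrite !Ql scalerBr opprD addrACA.
  - by move=> y z; rewrite fB fBl -!Qh.
  - move=> y; have -> : f y (Q k y - Q k (Q k y)) =
      f (y - Q k y) (Q k (y - Q k y)) + (f (Q k y) (Q k y) - f (Q k y) (Q k (Q k y))).
      rewrite (linB _ Ql) !fB !fBl -!Qh; ring.
    by rewrite addr_ge0// subr_ge0 Q1.
  - by move=> y; rewrite fB (Qh _ (Q k y)) (le_trans _ (Q1 y))// gerBl.
pose p k := f (Q k x) (Q k x).
have sump N : \sum_(k < N) p k = f x (P x) - f x (Q N x).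
  elim: N => [|N IH]; first by rewrite big_ord0 subrr.
  have [[_ Qh _ _] _] := Qp N.
  by rewrite big_ord_recr /= IH fB (Qh _ (Q N x)) /p; ring.
have sumD N : \sum_(k < N) f (Q k x) (D (Q k x)) = f x (P (D x)) - f x (Q N (D x)).
  elim: N => [|N IH]; first by rewrite big_ord0 subrr.
  have [[_ Qh _ _] QD] := Qp N.
  by rewrite big_ord_recr /= IH fB (Qh _ (Q N (D x))) QD; ring.
apply: approx_ge0 => e e0.
have e2 : 0 < e ^+ 2 by rewrite exprn_gt0.
have G1 : 0 < f (D x) (D x) + 1 by rewrite ltr_wpDl.
pose F := f x x * (f (D x) (D x) + 1) / e ^+ 2.
have Fr : F \is Num.real by rewrite ger0_real// divr_ge0 ?(ltW e2)// mulr_ge0 ?(ltW G1)//.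
have [N FN] : exists N : nat, F <= N.+1%:R.
  exists (Num.trunc (complex.Re F)).
  rewrite -[F]RRe_real// -[_%:R](rmorph_nat (real_complex R)) lecR.
  exact: ltW (truncnS_gt _).
have [k kp] : exists k : 'I_N.+1, p k <= f x x / N.+1%:R.
  have pr i : p i \is Num.real by rewrite ger0_real ?f_ge0.
  have fr : f x x / N.+1%:R \is Num.real by rewrite ger0_real// divr_ge0.
  apply: contrapT => /forallNP np.
  have := sump N.+1; have -> : f x (P x) - f x (Q N.+1 x) = f x x - (f x x - f x (P x)) - f x (Q N.+1 x) by ring.
  have : f x x < \sum_(k < N.+1) p k.
    have -> : f x x = \sum_(k < N.+1) f x x / N.+1%:R.
      by rewrite sumr_const card_ord -[RHS]mulr_natr divfK// pnatr_eq0.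
    apply: ltr_sum => [|i _]; first by apply/hasP; exists ord0 => //; rewrite mem_index_enum.
    by have /negP := np i; rewrite -real_ltNge.
  move=> + e1; rewrite e1 -subr_gt0; apply/negP.
  have -> : f x x - (f x x - f x (P x)) - f x (Q N.+1 x) - f x x =
     - ((f x x - f x (P x)) + f x (Q N.+1 x)) by ring.
  have h0 : 0 <= (f x x - f x (P x)) + f x (Q N.+1 x).
    have [[_ _ Q0 _] _] := Qp N.+1.
    by rewrite addr_ge0// subr_ge0.
  by rewrite oppr_gt0 le_gtF.
exists (f x (Q k (D x))); last first.
  by rewrite -sumD sumr_ge0// => i _.
have [[_ Qh _ _] _] := Qp k; rewrite Qh.
rewrite -(@ler_pXn2r _ 2) ?nnegrE ?(ltW e0)// (le_trans (semi_CS (lin := fun a u v => a *: u + v) fP fC f_ge0 _ _))//.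
rewrite (@le_trans _ _ (f x x / N.+1%:R * (f (D x) (D x) + 1)))//.
  by apply: ler_pM => //; rewrite lerDl.
rewrite mulrAC ler_pdivrMr ?ltr0Sn// [leRHS]mulrC.
by move: FN; rewrite /F ler_pdivrMr.
Qed.

Lemma comm_pos (P D : E -> E) c : linear P -> linear D -> 0 < c ->
  (forall x y, f x (P y) = f (P x) y) ->
  (forall x, 0 <= f x (P x)) -> (forall x, f x (P x) <= c * f x x) ->
  (forall x, 0 <= f x (D x)) -> (forall x, P (D x) = D (P x)) ->
  forall x, 0 <= f x (P (D x)).
Proof.
move=> Pl Dl c0 Ph P0 P1 D0 PD x.
have Pl' : linear (fun y => c^-1 *: P y).
  by move=> a y z; rewrite Pl scalerDr !scalerA mulrC.
have D0' : D 0 = 0 by have := Dl (-1) 0 0; rewrite scaler0 addr0 scaleN1r addNr.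
have := @comm_pos_contr (fun y => c^-1 *: P y) D Pl' Dl _ _ _ D0 _ x.
rewrite fZ pmulr_rge0 ?invr_gt0//; apply.
- move=> y z; rewrite fZ Ph [RHS]fC fZ rmorphM/= -fC; congr (_ * _).
  by apply/esym/CrealP; rewrite rpredV gtr0_real.
- by move=> y; rewrite fZ mulr_ge0// invr_ge0 ltW.
- by move=> y; rewrite fZ ler_pdivrMl.
- by move=> y; rewrite PD -[_ *: P y]addr0 Dl D0' addr0.
Qed.

End CommutingPositive.

(** * Reproducing kernel Hilbert spaces *)

Record pdkernel (R : realType) := PDKernel {
  pd_type : Type;
  pd_fun :> pd_type -> pd_type -> R[i];
  pd_C : forall x y, pd_fun y x = (pd_fun x y)^*;
  pd_ge0 : forall s : seq (R[i] * pd_type),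
    0 <= \sum_(p <- s) \sum_(q <- s) p.1^* * (q.1 * pd_fun p.2 q.2) }.

(* The reproducing kernel Hilbert space: functions on [X] approximable, in the
   norm dual to the seminorm of the kernel, by formal combinations [s] of
   points. *)
Section KernelSpace.
Variables (R : realType) (k : pdkernel R).
Let X := pd_type k.
Implicit Types (s t : seq (R[i] * X)) (g h : X -> R[i]) (e d : R[i]).

Definition pairing s g : R[i] := \sum_(p <- s) p.1^* * g p.2.
Definition combine s : X -> R[i] := fun x => \sum_(p <- s) p.1 * k x p.2.
Definition kform s t : R[i] := pairing s (combine t).
Definition klin (a : R[i]) s t := [seq (a * p.1, p.2) | p <- s] ++ t.
Definition knorm s := sqrtC (kform s s).

Lemma pairingP s a g h : pairing s (a *: g + h) = a * pairing s g + pairing s h.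
Proof.
rewrite /pairing mulr_sumr -big_split/=; apply: eq_bigr => p _.
by rewrite !fctE /GRing.scale/=; ring.
Qed.

Lemma combine_lin a s t : combine (klin a s t) = a *: combine s + combine t.
Proof.
apply/funext => x; rewrite !fctE /combine big_cat big_map /=; congr (_ + _).
by rewrite /GRing.scale/= mulr_sumr; apply: eq_bigr => p _; rewrite mulrA.
Qed.

Lemma kformP a s t u : kform s (klin a t u) = a * kform s t + kform s u.
Proof. by rewrite /kform combine_lin pairingP. Qed.

Lemma kformE s t : kform s t = \sum_(p <- s) \sum_(q <- t) p.1^* * (q.1 * k p.2 q.2).
Proof. by apply: eq_bigr => p _; rewrite mulr_sumr. Qed.

Lemma kformC s t : kform t s = (kform s t)^*.
Proof.
rewrite !kformE exchange_big/= rmorph_sum; apply: eq_bigr => p _.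
rewrite rmorph_sum; apply: eq_bigr => q _.
by rewrite !rmorphM/= conjCK -pd_C; ring.
Qed.

Lemma kform_ge0 s : 0 <= kform s s.
Proof. by rewrite kformE pd_ge0. Qed.

Lemma knorm_ge0 s : 0 <= knorm s. Proof. by rewrite sqrtC_ge0 kform_ge0. Qed.

Lemma kform_CS s t : `|kform s t| <= knorm s * knorm t.
Proof.
rewrite -(@ler_pXn2r _ 2) ?nnegrE ?mulr_ge0 ?knorm_ge0// exprMn !sqrtCK.
exact: (semi_CS kformP kformC kform_ge0).
Qed.

Definition kdist g s e := forall t, `|pairing t g - kform t s| <= e * knorm t.

Lemma kdist_le g s e d : kdist g s e -> e <= d -> kdist g s d.
Proof.
by move=> h ed t; rewrite (le_trans (h t))// ler_wpM2r// knorm_ge0.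
Qed.

Definition kspace : {pred (X -> R[i])} :=
  mem [set g | forall e, 0 < e -> exists s, kdist g s e].

Lemma kspaceP g : reflect (forall e, 0 < e -> exists s, kdist g s e) (g \in kspace).
Proof. by apply: (iffP idP); rewrite inE. Qed.

Lemma kdist_lin a g h s t d e : kdist g s d -> kdist h t e ->
  kdist (a *: g + h) (klin a s t) (`|a| * d + e).
Proof.
move=> gs ht u; rewrite pairingP kformP.
have -> : a * pairing u g + pairing u h - (a * kform u s + kform u t) =
   a * (pairing u g - kform u s) + (pairing u h - kform u t) by ring.
rewrite (le_trans (ler_normD _ _))// mulrDl lerD// normrM -mulrA ler_wpM2l//.
Qed.

Lemma kdist0 s : kdist (combine s) s 0.
Proof. by move=> t; rewrite -/(kform t s) subrr normr0 mul0r. Qed.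

Lemma combine_kspace s : combine s \in kspace.
Proof. by apply/kspaceP => e e0; exists s; apply: kdist_le (kdist0 s) (ltW e0). Qed.

Lemma kspace_submod : submod_closed kspace.
Proof.
split=> [|a g h /kspaceP gk /kspaceP hk].
  have -> : 0 = combine [::] by apply/funext => x; rewrite /combine big_nil.
  exact: combine_kspace.
apply/kspaceP => e e0; have a1 : 0 < `|a| + 1 by rewrite ltr_wpDl.
have [s gs] := gk _ (divr_gt0 e0 a1); have [t ht] := hk _ (divr_gt0 e0 a1).
exists (klin a s t); apply: kdist_le (kdist_lin a gs ht) _.
by rewrite -[X in _ + X]mul1r -mulrDl mulrC divfK// gt_eqF.
Qed.

HB.instance Definition _ :=
  GRing.isSubmodClosed.Build R[i] (X -> R[i]) kspace kspace_submod.

Record kvec := KVec { kvec_fun :> X -> R[i]; kvec_subproof : kvec_fun \in kspace }.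

HB.instance Definition _ := [isSub for kvec_fun].
HB.instance Definition _ := [Choice of kvec by <:].
HB.instance Definition _ := [SubChoice_isSubLmodule of kvec by <:].
Implicit Types u v w : kvec.

Definition kcomb s : kvec := KVec (combine_kspace s).

Lemma kvecP u e : 0 < e -> exists s, kdist u s e.
Proof. by case: u => g gk /=; move/kspaceP : gk; apply. Qed.

Lemma pairing_bound v : exists2 M : R[i], 0 < M & forall t, `|pairing t v| <= M * knorm t.
Proof.
have [s sv] := kvecP v ltr01; exists (knorm s + 1); first by rewrite ltr_wpDl// knorm_ge0.
move=> t; rewrite -[pairing t v](subrK (kform t s)) (le_trans (ler_normD _ _))//.
by rewrite addrC mulrDl lerD ?sv// mulrC kform_CS.
Qed.

Lemma pairing_lin a s t g : pairing (klin a s t) g = a^* * pairing s g + pairing t g.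
Proof.
rewrite /pairing big_cat big_map /=; congr (_ + _).
by rewrite mulr_sumr; apply: eq_bigr => p _; rewrite rmorphM mulrA.
Qed.

Lemma knorm_dist_le u M s d : (forall t, `|pairing t u| <= M * knorm t) ->
  kdist u s d -> 0 <= M + d -> knorm s <= M + d.
Proof.
move=> uM us Md; have [->//|s0] := eqVneq (knorm s) 0.
have sp : 0 < knorm s by rewrite lt_def s0 knorm_ge0.
rewrite -(ler_pM2r sp) -expr2 sqrtCK -[kform s s]ger0_norm ?kform_ge0//.
rewrite -[kform s s](subKr (pairing s u)) (le_trans (ler_normB _ _))//.
by rewrite mulrDl lerD.
Qed.

Lemma kdist_norm u s t d e : 0 <= d -> 0 <= e -> kdist u s d -> kdist u t e ->
  knorm (klin (-1) s t) <= d + e.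
Proof.
move=> d0 e0 us ut; set r := klin _ _ _.
have h : kdist (-1 *: (u : X -> R[i]) + u) r (`|-1| * d + e) by apply: kdist_lin.
rewrite scaleN1r addNr normrN1 mul1r in h.
rewrite -[d + e]add0r (@knorm_dist_le (0 : kvec))// ?add0r ?addr_ge0//.
move=> w; rewrite mul0r /pairing big1 ?normr0// => p _.
by rewrite mulr0.
Qed.

Definition kip_spec u v (z : R[i]) := forall e, 0 < e ->
  exists2 d, 0 < d & forall s, kdist u s d -> `|z - pairing s v| <= e.

Lemma kip_ex u v : exists z, kip_spec u v z.
Proof.
have [M M0 vM] := pairing_bound v.
pose F := filter_from [set e : R[i] | 0 < e] (fun e => [set s | kdist u s e]).
have FF : ProperFilter F.
  apply: filter_from_proper; last by move=> e /= /(kvecP u)[s]; exists s.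
  apply: filter_from_filter; first by exists 1; exact: ltr01.
  move=> e e' /= e0 e0'; have [c [c0 ce ce']] := pos_min e0 e0'.
  by exists c => // s /= us; split; apply: kdist_le us _.
have [|z zF] := @complex_lim R _ F FF (fun s => pairing s v).
  move=> e e0; have e3 : 0 < e / (M * 3) by rewrite divr_gt0// mulr_gt0.
  have [s us] := kvecP u e3; exists (pairing s v), (e / (M * 3)) => // t /= ut.
  rewrite distrC.
  have -> : pairing t v - pairing s v = pairing (klin (-1) s t) v.
    by rewrite pairing_lin rmorphN rmorph1 mulN1r addrC.
  rewrite (le_lt_trans (vM _))//.
  rewrite (@le_lt_trans _ _ (M * (e / (M * 3) + e / (M * 3))))//.
    by rewrite ler_wpM2l ?(ltW M0)//; apply: kdist_norm => //; exact: ltW.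
  have -> : M * (e / (M * 3) + e / (M * 3)) = e * (2 / 3) by field; rewrite gt_eqF.
  by rewrite gtr_pMr// ltr_pdivrMr// mul1r ltr_nat.
by exists z => e /zF[d d0 dF]; exists d => // s us; exact: dF.
Qed.

Definition kip u v : R[i] := sval (cid (kip_ex u v)).

Lemma kipP u v : kip_spec u v (kip u v). Proof. exact: svalP. Qed.

Lemma kip_uniq u v z : kip_spec u v z -> kip u v = z.
Proof.
move=> zP; apply/eqP; rewrite -subr_eq0 -normr_le0; apply/ler_addgt0Pr => e e0.
have e2 : 0 < e / 2 by rewrite divr_gt0.
have [d d0 dz] := zP _ e2; have [d' d0' dz'] := kipP u v e2.
have [c [c0 cd cd']] := pos_min d0 d0'; have [s us] := kvecP u c0.
rewrite add0r -(subrKA (pairing s v)) (le_trans (ler_normD _ _))// [leRHS]splitr.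
rewrite lerD//; first by apply: dz'; apply: kdist_le us _.
by rewrite [leLHS]distrC; apply: dz; apply: kdist_le us _.
Qed.

Lemma kip_lin u a v w : kip u (a *: v + w) = a * kip u v + kip u w.
Proof.
apply: kip_uniq => e e0; have a1 : 0 < `|a| + 1 by rewrite ltr_wpDl.
have [d d0 dz] := kipP u v (divr_gt0 e0 a1).
have [d' d0' dz'] := kipP u w (divr_gt0 e0 a1).
have [c [c0 cd cd']] := pos_min d0 d0'; exists c => // s us.
have -> : a * kip u v + kip u w - pairing s (a *: v + w) =
  a * (kip u v - pairing s v) + (kip u w - pairing s w).
  by rewrite pairingP; ring.
rewrite (le_trans (ler_normD _ _))// normrM.
rewrite (@le_trans _ _ (`|a| * (e / (`|a| + 1)) + e / (`|a| + 1)))//.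
  rewrite lerD// ?ler_wpM2l//; [apply: dz|apply: dz']; exact: kdist_le us _.
by rewrite -[X in _ + X]mul1r -mulrDl mulrC divfK// gt_eqF.
Qed.

Lemma kipC u v : kip v u = (kip u v)^*.
Proof.
apply: kip_uniq => e e0; have [M M0 uM] := pairing_bound u.
have M1 : 0 < M + 1 by rewrite addr_gt0.
have e3 : 0 < e / 3 by rewrite divr_gt0.
have e3M : 0 < e / 3 / (M + 1) by rewrite divr_gt0.
exists (e / 3 / (M + 1)) => // t vt.
have n1 : 0 < knorm t + 1 by rewrite ltr_wpDl// knorm_ge0.
have e3N : 0 < e / 3 / (knorm t + 1) by rewrite divr_gt0.
have [d1 d10 dz] := kipP u v e3.
have [d2 [d20 d21 d2N]] := pos_min d10 e3N.
have [c [c0 c2 c1]] := pos_min d20 ltr01.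
have [s us] := kvecP u c0.
rewrite -norm_conjC rmorphB/= conjCK.
have -> : kip u v - (pairing t u)^* = (kip u v - pairing s v) +
   ((pairing s v - kform s t) - (pairing t u - kform t s)^*).
  by rewrite rmorphB/= -kformC; ring.
have -> : e = e / 3 + (e / 3 + e / 3) by field.
rewrite (le_trans (ler_normD _ _))// lerD//.
  by apply: dz; apply: kdist_le us _; exact: le_trans d21.
rewrite (le_trans (ler_normB _ _))// lerD//.
  rewrite (le_trans (vt s))// -[leRHS](divfK (lt0r_neq0 M1)) ler_wpM2l ?(ltW e3M)//.
  by apply: (knorm_dist_le uM) => //; [apply: kdist_le us _|exact: ltW].
rewrite norm_conjC (le_trans (us t))//.
rewrite (@le_trans _ _ (e / 3 / (knorm t + 1) * knorm t))//.
  by rewrite ler_wpM2r ?knorm_ge0// (le_trans c2).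
by rewrite mulrAC ler_pdivrMr// ler_wpM2l ?(ltW e3)// lerDl.
Qed.

Lemma kip_ge0 u : 0 <= kip u u.
Proof.
apply: approx_ge0 => e e0; have [M M0 uM] := pairing_bound u.
have M1 : 0 < M + 1 by rewrite addr_gt0.
have e2 : 0 < e / 2 by rewrite divr_gt0.
have e2M : 0 < e / 2 / (M + 1) by rewrite divr_gt0.
have [d1 d10 dz] := kipP u u e2.
have [d2 [d20 d21 d2N]] := pos_min d10 e2M.
have [c [c0 c2 c1]] := pos_min d20 ltr01.
have [s us] := kvecP u c0; exists (kip u u - kform s s).
  rewrite -(subrKA (pairing s u)) (le_trans (ler_normD _ _))// [leRHS]splitr lerD//.
    by apply: dz; apply: kdist_le us _; exact: le_trans d21.
  rewrite (le_trans (us s))// -[leRHS](divfK (lt0r_neq0 M1)).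
  rewrite ler_pM ?knorm_ge0 ?(ltW c0)//; first exact: le_trans d2N.
  by apply: (knorm_dist_le uM) => //; [apply: kdist_le us _|exact: ltW].
by rewrite subKr kform_ge0.
Qed.

Lemma kip_comb s v : kip (kcomb s) v = pairing s v.
Proof.
apply: kip_uniq => e e0; have [M M0 vM] := pairing_bound v.
exists (e / M) => [|t st]; first by rewrite divr_gt0.
have -> : pairing s v - pairing t v = pairing (klin (-1) t s) v.
  by rewrite pairing_lin rmorphN rmorph1 mulN1r addrC.
rewrite (le_trans (vM _))// mulrC -ler_pdivlMr// -[leRHS]addr0.
apply: (@kdist_norm (kcomb s) t s (e / M) 0) => //; last exact: kdist0.
by rewrite divr_ge0 ?(ltW e0) ?(ltW M0).
Qed.

Lemma kip0_eq0 u : kip u u = 0 -> u = 0.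
Proof.
move=> u0; apply/val_inj/funext => x /=.
have := @semi_CS R kvec (fun a v w => a *: v + w) kip (fun a x y z => kip_lin x a y z)
   kipC kip_ge0 (kcomb [:: (1, x)]) u.
rewrite u0 mulr0 kip_comb /pairing big_seq1 rmorph1 mul1r.
by rewrite -normrX normr_le0 sqrf_eq0 => /eqP.
Qed.

Definition kvnorm u : R[i] := sqrtC (kip u u).

Lemma kvnorm_ge0 u : 0 <= kvnorm u. Proof. by rewrite sqrtC_ge0 kip_ge0. Qed.

Lemma kip_CS u v : `|kip u v| <= kvnorm u * kvnorm v.
Proof.
rewrite -(@ler_pXn2r _ 2) ?nnegrE ?mulr_ge0 ?kvnorm_ge0// exprMn !sqrtCK.
exact: (@semi_CS R kvec (fun a v w => a *: v + w) kip (fun a x y z => kip_lin x a y z)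
   kipC kip_ge0).
Qed.

Lemma kipDr u v w : kip u (v + w) = kip u v + kip u w.
Proof. by rewrite -{1}[v]scale1r kip_lin mul1r. Qed.

Lemma kipDl u v w : kip (u + v) w = kip u w + kip v w.
Proof. by rewrite kipC kipDr rmorphD /= -!kipC. Qed.

Lemma kip0r u : kip u 0 = 0.
Proof. by apply: (addrI (kip u 0)); rewrite -kipDr !addr0. Qed.

Lemma kipZr u a v : kip u (a *: v) = a * kip u v.
Proof. by rewrite -[_ *: _]addr0 kip_lin kip0r addr0. Qed.

Lemma kipZl u a v : kip (a *: u) v = a^* * kip u v.
Proof. by rewrite kipC kipZr rmorphM /= -kipC. Qed.

Lemma kvnormD u v : kvnorm (u + v) <= kvnorm u + kvnorm v.
Proof.
rewrite -(@ler_pXn2r _ 2) ?nnegrE ?addr_ge0 ?kvnorm_ge0// sqrrD !sqrtCK.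
have -> : kip (u + v) (u + v) = kip u u + (kip u v + kip v u) + kip v v.
  by rewrite kipDr !kipDl; ring.
rewrite lerD2r lerD2l.
rewrite (kipC u v) (le_trans (real_ler_norm _))//.
  by rewrite CrealE rmorphD/= conjCK addrC.
by rewrite (le_trans (ler_normD _ _))// norm_conjC mulr2n lerD// kip_CS.
Qed.

Lemma kvnormZ a u : kvnorm (a *: u) = `|a| * kvnorm u.
Proof.
rewrite /kvnorm kipZr kipZl mulrA -normCK sqrtCM ?nnegrE ?kip_ge0 ?exprn_ge0//.
by rewrite sqrCK.
Qed.

Lemma kvnorm0_eq0 u : kvnorm u = 0 -> u = 0.
Proof. by move=> /eqP; rewrite sqrtC_eq0 => /eqP /kip0_eq0. Qed.

HB.instance Definition _ :=
  Lmodule_isNormed.Build R[i] kvec kvnormD kvnormZ kvnorm0_eq0.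

Lemma pairing_le s v : `|pairing s v| <= knorm s * `|v|.
Proof.
rewrite -kip_comb (le_trans (kip_CS _ _))// /kvnorm kip_comb.
exact: lexx.
Qed.

Lemma kvec_le u M : 0 <= M -> (forall s, `|pairing s u| <= M * knorm s) -> `|u| <= M.
Proof.
move=> M0 uM; change (kvnorm u <= M); have [->//|u0] := eqVneq (kvnorm u) 0.
have up : 0 < kvnorm u by rewrite lt_def u0 kvnorm_ge0.
rewrite -(ler_pM2r up) -expr2 sqrtCK; apply/ler_addgt0Pr => e e0.
have M1 : 0 < M + 1 by rewrite ltr_wpDl.
have e2 : 0 < e / 2 by rewrite divr_gt0.
have e2M : 0 < e / 2 / (M + 1) by rewrite divr_gt0.
have [d1 d10 dz] := kipP u u e2.
have [d2 [d20 d21 d2N]] := pos_min d10 e2M.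
have [s us] := kvecP u d20.
rewrite -[kip u u]ger0_norm ?kip_ge0// -[kip u u](subrK (pairing s u)).
rewrite (le_trans (ler_normD _ _))//.
have -> : M * kvnorm u + e = e / 2 + (M * kvnorm u + e / 2) by field.
rewrite lerD//; first by apply: dz; apply: kdist_le us _.
rewrite (le_trans (uM s))//.
have uk t : `|pairing t u| <= kvnorm u * knorm t.
  by rewrite mulrC pairing_le.
rewrite (@le_trans _ _ (M * (kvnorm u + d2)))//.
  by rewrite ler_wpM2l// (knorm_dist_le uk)// addr_ge0 ?(ltW d20) ?(ltW up).
rewrite mulrDr lerD2l (@le_trans _ _ (M * (e / 2 / (M + 1))))// ?ler_wpM2l//.
by rewrite mulrA ler_pdivrMr// mulrC ler_wpM2l ?(ltW e2)// lerDl.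
Qed.

Lemma kvec_complete (F : set_system kvec) : ProperFilter F -> cauchy F -> cvg F.
Proof.
move=> FF cF; have cF' e : 0 < e -> exists v, F [set w | `|v - w| < e].
  move=> e0; have [z zF] := (cauchyP F).1 cF e e0.
  by exists z; move: zF; rewrite -ball_normE.
have /choice[g gF] x : exists l, forall e : R[i], 0 < e -> F [set w : kvec | `|l - w x| <= e].
  apply: complex_lim => e e0.
  have n1 : 0 < knorm [:: (1, x)] + 1 by rewrite ltr_wpDl// knorm_ge0.
  have [v vF] := cF' _ (divr_gt0 e0 n1); exists (v x).
  apply: filterS vF => w /= vw.
  have -> : v x - w x = pairing [:: (1, x)] (v - w).
    by rewrite /pairing big_seq1 rmorph1 mul1r.
  rewrite (le_lt_trans (pairing_le _ _))//.
  rewrite (@le_lt_trans _ _ ((knorm [:: (1, x)] + 1) * `|v - w|))//.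
    by rewrite ler_wpM2r// lerDl.
  by rewrite mulrC -ltr_pdivlMr.
have gp s e : 0 < e -> F [set w : kvec | `|pairing s g - pairing s w| <= e].
  elim: s e => [|p s IH] e e0.
    apply: filterE => w /=; rewrite /pairing !big_nil subrr normr0; exact: ltW.
  have e2 : 0 < e / 2 by rewrite divr_gt0.
  have p1 : 0 < `|p.1| + 1 by rewrite ltr_wpDl.
  apply: filterS2 (IH _ e2) (gF p.2 _ (divr_gt0 e2 p1)) => w /= sw pw.
  rewrite /pairing !big_cons opprD addrACA -mulrBr (le_trans (ler_normD _ _))//.
  rewrite [leRHS]splitr lerD// normrM norm_conjC.
  rewrite (@le_trans _ _ (`|p.1| * (e / 2 / (`|p.1| + 1))))// ?ler_wpM2l//.
  by rewrite mulrA ler_pdivrMr// mulrC ler_wpM2l ?(ltW e2)// lerDl.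
have gd v e s : F [set w | `|v - w| < e] -> `|pairing s g - pairing s v| <= e * knorm s.
  move=> vF; apply/ler_addgt0Pr => d d0.
  have [w [/= vw gw]] := filter_ex (filterI vF (gp s d d0)).
  rewrite -(subrKA (pairing s w)) (le_trans (ler_normD _ _))// addrC lerD//.
  have -> : pairing s w - pairing s v = pairing s (-1 *: v + w :> (X -> R[i])).
    by rewrite pairingP mulN1r addrC.
  rewrite (le_trans (pairing_le s (-1 *: v + w)))// mulrC ler_wpM2r ?knorm_ge0//.
  by rewrite scaleN1r addrC distrC ltW.
have gk : g \in kspace.
  apply/kspaceP => e e0; have e2 : 0 < e / 2 by rewrite divr_gt0.
  have [v vF] := cF' _ e2; have [s vs] := kvecP v e2; exists s => t.
  rewrite -(subrKA (pairing t v)) (le_trans (ler_normD _ _))//.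
  by rewrite [e]splitr mulrDl lerD// gd.
apply/cvg_ex; exists (KVec gk); apply/cvgrPdist_le => e e0.
have e2 : 0 < e / 2 by rewrite divr_gt0.
have [v vF] := cF' _ e2; apply: filterS (vF) => w /= vw.
rewrite -(subrKA v) (le_trans (ler_normD _ _))// [leRHS]splitr lerD//; last exact: ltW.
apply: kvec_le => [|s]; first exact: ltW.
have -> : pairing s (KVec gk - v) = pairing s g - pairing s v.
  have -> : (KVec gk - v : X -> R[i]) = -1 *: (v : X -> R[i]) + g.
    by apply/funext => x; rewrite scaleN1r addrC.
  by rewrite pairingP mulN1r addrC.
exact: gd.
Qed.

HB.instance Definition _ := Uniform_isComplete.Build kvec kvec_complete.

Definition kdot u v := kip v u.

Lemma kdot_bilinear : bilinear_for
  (GRing.Scale.Law.clone _ _ ( *%R) _) (GRing.Scale.Law.clone _ _ (@Num.conj R[i] \; *%R) _) kdot.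
Proof.
split=> u a v w /=; first by rewrite /kdot kip_lin.
by rewrite /kdot kipDl kipZl.
Qed.

HB.instance Definition _ :=
  bilinear_isBilinear.Build R[i] kvec kvec R[i] _ _ kdot kdot_bilinear.

Lemma kdot_herm u v : kdot u v = (-1) ^+ false * (kdot v u)^*.
Proof. by rewrite expr0 mul1r /kdot kipC. Qed.

HB.instance Definition _ :=
  isHermitianSesquilinear.Build R[i] kvec false (@Num.conj R[i]) kdot kdot_herm.

Lemma kdot_gt0 u : u != 0 -> 0 < kdot u u.
Proof.
move=> u0; rewrite lt_def kip_ge0 andbT; apply: contra u0 => /eqP uu.
by apply/eqP/kip0_eq0.
Qed.

HB.instance Definition _ := isDotProduct.Build R[i] kvec kdot kdot_gt0.

Lemma kdotE u : kdot u u = `|u| ^+ 2.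
Proof. by rewrite /kdot; exact/esym/sqrtCK. Qed.

Definition khilbert : hilbert R := @Hilbert R kvec kdot kdotE.

Lemma kernel_hilbert : exists (H : hilbert R) (j : X -> H),
  (forall x y, ip (j x) (j y) = k x y) /\ cspan (range j) = [set: H].
Proof.
exists khilbert, (fun x => kcomb [:: (1, x)]); split=> [x y|].
  rewrite [LHS](_ : _ = kip (kcomb [:: (1, x)]) (kcomb [:: (1, y)]))//.
  rewrite kip_comb /pairing big_seq1 rmorph1 mul1r /= /combine big_seq1.
  by rewrite mul1r.
apply/seteqP; split=> // u _; apply/closure_normP => e e0.
have [s us] := kvecP u e0.
exists (kcomb s); last first.
  apply: kvec_le => [|t]; first exact: ltW.
  have -> : pairing t (u - kcomb s) = pairing t u - kform t s.
    have -> : (u - kcomb s : X -> R[i]) = -1 *: (combine s) + u.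
      by apply/funext => x; rewrite scaleN1r addrC.
    by rewrite pairingP mulN1r addrC.
  exact: us.
exists (size s), (fun i => (tnth (in_tuple s) i).1),
  (fun i => kcomb [:: (1, (tnth (in_tuple s) i).2)]); split.
  by move=> i; exists (tnth (in_tuple s) i).2.
apply/val_inj/funext => x /=.
have sumE n (f : 'I_n -> kvec) : (\sum_(i < n) f i) x = \sum_(i < n) f i x.
  by elim/big_rec2: _ => // i y v _ <-.
rewrite sumE /combine big_tnth; apply: eq_bigr => i _.
by rewrite [RHS](_ : _ = (tnth (in_tuple s) i).1 *
  combine [:: (1, (tnth (in_tuple s) i).2)] x)// /combine big_seq1 mul1r.
Qed.

End KernelSpace.

Section MatrixPositivity.
Variable R : realType.
Implicit Types H K L : hilbert R.

Definition famip (I : finType) H (v w : I -> H) : R[i] := \sum_i ip (v i) (w i).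

Lemma famipP (I : finType) H (x : I -> H) a y z :
  famip x (a *: y + z) = a * famip x y + famip x z.
Proof.
by rewrite /famip mulr_sumr -big_split; apply: eq_bigr => i _; rewrite !fctE ipP.
Qed.

Lemma famipC (I : finType) H (x y : I -> H) : famip y x = (famip x y)^*.
Proof. by rewrite /famip rmorph_sum; apply: eq_bigr => i _; exact: ipC. Qed.

Lemma famip_ge0 (I : finType) H (x : I -> H) : 0 <= famip x x.
Proof. by apply: sumr_ge0 => i _; apply: ip_ge0. Qed.

Lemma row_norm_le (I : finType) H L (xi : I -> bop H L) (v : I -> H) :
  `|\sum_i xi i (v i)| ^+ 2 <= ((\sum_i `|xi i|) ^+ 2 + 1) * famip v v.
Proof.
have vi i : `|v i| <= sqrtC (famip v v).
  rewrite -(@ler_pXn2r _ 2) ?nnegrE ?sqrtC_ge0 ?famip_ge0// sqrtCK.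
  by rewrite -ip_norm /famip (bigD1 i)//= lerDl sumr_ge0// => j _; apply: ip_ge0.
have h : `|\sum_i xi i (v i)| <= (\sum_i `|xi i|) * sqrtC (famip v v).
  rewrite (le_trans (ler_norm_sum _ _ _))// mulr_suml ler_sum// => i _.
  by rewrite (le_trans (bop_le _ _))// ler_wpM2l.
rewrite (@le_trans _ _ (((\sum_i `|xi i|) * sqrtC (famip v v)) ^+ 2))//.
  by rewrite ler_pXn2r ?nnegrE ?mulr_ge0 ?sqrtC_ge0 ?famip_ge0 ?sumr_ge0.
by rewrite exprMn sqrtCK ler_wpM2r ?famip_ge0// lerDl.
Qed.

Lemma linear_fct (I : Type) H (P : I -> (I -> H) -> H) :
  (forall i, linear (P i)) -> linear (fun v i => P i v).
Proof. by move=> Pl a v w; apply/funext => i; rewrite Pl. Qed.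

(* [M - D] and the Gram operator of [xi] are commuting positive operators on
   [H^I]. *)
Lemma gram_le (I : finType) H L (xi : I -> bop H L) (D : bop H H) M (h : I -> H) :
  (forall x, ip x (D x) <= M * `|x| ^+ 2) ->
  (forall i j, D ** (adj (xi i) ** xi j) = adj (xi i) ** xi j ** D) ->
  ip (\sum_i xi i (h i)) (\sum_i xi i (D (h i))) <= M * `|\sum_i xi i (h i)| ^+ 2.
Proof.
move=> DM Dxi.
pose P (v : I -> H) : I -> H := fun i => adj (xi i) (\sum_j xi j (v j)).
pose D' (v : I -> H) : I -> H := fun i => M *: v i - D (v i).
have Pl : linear P.
  apply: linear_fct => i a v w; rewrite -linearP; congr (adj _ _).
  by rewrite scaler_sumr -big_split; apply: eq_bigr => j _; rewrite !fctE linearP.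
have Dl : linear D'.
  apply: (@linear_fct _ _ (fun i v => M *: v i - D (v i))) => i a v w.
  have -> : (a *: v + w) i = a *: v i + w i by [].
  rewrite [D _]linearP scalerDr opprD scalerBr addrACA; congr (_ + _ + _).
  by rewrite !scalerA mulrC.
have fPE v w : famip v (P w) = ip (\sum_j xi j (v j)) (\sum_j xi j (w j)).
  by rewrite ip_suml; apply: eq_bigr => i _; rewrite adjPr.
have D'E v : \sum_j xi j (D' v j) =
    M *: (\sum_j xi j (v j)) - \sum_j xi j (D (v j)).
  rewrite scaler_sumr -sumrB; apply: eq_bigr => j _.
  by rewrite /D' linearB linearZ.
have : 0 <= famip h (P (D' h)).
  apply: (@comm_pos R (I -> H) (@famip I H) (fun a x y z => famipP x a y z)
    (@famipC I H) (@famip_ge0 I H) P D' ((\sum_i `|xi i|) ^+ 2 + 1) Pl Dl).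
  - by rewrite ltr_wpDl// exprn_ge0// sumr_ge0.
  - by move=> x y; rewrite fPE famipC fPE -ipC.
  - by move=> x; rewrite fPE ip_ge0.
  - by move=> x; rewrite fPE ip_norm row_norm_le.
  - by move=> x; apply: sumr_ge0 => i _; rewrite ipBr ipZr ip_norm subr_ge0.
  - move=> v; apply/funext => i; rewrite /P /D'.
    rewrite D'E.
    rewrite linearB linearZ; congr (_ - _); rewrite !linear_sum; apply: eq_bigr => j _.
    exact: (congr1 (fun f : bop _ _ => f (v j)) (esym (Dxi i j))).
by rewrite fPE D'E ipBr ipZr ip_norm subr_ge0.
Qed.

Lemma sum_pair (I J : finType) (g : I * J -> R[i]) :
  \sum_p g p = \sum_i \sum_j g (i, j).
Proof. by rewrite (pair_bigA _ (fun i j => g (i, j))); apply: eq_bigr => -[]. Qed.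

(* The two Gram matrices act on [K0^(I * I)] as commuting positive operators;
   their product is evaluated on a diagonal vector. *)
Lemma schur_ge0 (I : finType) K0 H K (xi : I -> bop K0 H) (eta : I -> bop K0 K) (z : I -> K0) :
  (forall i j k l, (adj (xi i) ** xi j) ** (adj (eta k) ** eta l) =
                   (adj (eta k) ** eta l) ** (adj (xi i) ** xi j)) ->
  0 <= \sum_i \sum_j ip (z i) ((adj (xi i) ** xi j ** adj (eta i) ** eta j) (z j)).
Proof.
move=> com.
pose P (v : I * I -> K0) : I * I -> K0 := fun p => adj (xi p.1) (\sum_j xi j (v (j, p.2))).
pose D (v : I * I -> K0) : I * I -> K0 := fun p => adj (eta p.2) (\sum_j eta j (v (p.1, j))).
have Pl : linear P.
  apply: linear_fct => i a v w; rewrite -linearP; congr (adj _ _).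
  by rewrite scaler_sumr -big_split; apply: eq_bigr => j _; rewrite !fctE linearP.
have Dl : linear D.
  apply: linear_fct => i a v w; rewrite -linearP; congr (adj _ _).
  by rewrite scaler_sumr -big_split; apply: eq_bigr => j _; rewrite !fctE linearP.
have fPE v w : famip v (P w) =
    \sum_a ip (\sum_j xi j (v (j, a))) (\sum_j xi j (w (j, a))).
  rewrite /famip sum_pair exchange_big.
  by apply: eq_bigr => a _; rewrite ip_suml; apply: eq_bigr => i _; rewrite adjPr.
have fDE v w : famip v (D w) =
    \sum_a ip (\sum_j eta j (v (a, j))) (\sum_j eta j (w (a, j))).
  rewrite /famip sum_pair.
  by apply: eq_bigr => a _; rewrite ip_suml; apply: eq_bigr => i _; rewrite adjPr.
pose h : I * I -> K0 := fun p => if p.1 == p.2 then z p.1 else 0.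
have := @comm_pos R (I * I -> K0) (@famip (I * I)%type K0) (fun a x y z => famipP x a y z)
  (@famipC _ K0) (@famip_ge0 _ K0) P D ((\sum_i `|xi i|) ^+ 2 + 1) Pl Dl _ _ _ _ _ _ h.
have -> : famip h (P (D h)) =
   \sum_i \sum_j ip (z i) ((adj (xi i) ** xi j ** adj (eta i) ** eta j) (z j)).
  rewrite /famip sum_pair.
  apply: eq_bigr => i _; rewrite (bigD1 i)//= [X in _ + X]big1 ?addr0; last first.
    by move=> j ji; rewrite /h/= eq_sym (negbTE ji) ip0l.
  rewrite /h/= eqxx /P/= linear_sum ip_sumr; apply: eq_bigr => j _.
  rewrite /D/= (bigD1 j)//= eqxx [X in _ + X]big1 ?addr0//.
  by move=> k kj; rewrite eq_sym (negbTE kj) linear0.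
apply.
- by rewrite ltr_wpDl// exprn_ge0// sumr_ge0.
- by move=> x y; rewrite fPE famipC fPE rmorph_sum; apply: eq_bigr => a _; exact: ipC.
- by move=> x; rewrite fPE sumr_ge0// => a _; rewrite ip_ge0.
- move=> x; rewrite fPE (@le_trans _ _ (\sum_a ((\sum_i `|xi i|) ^+ 2 + 1) *
     famip (fun i => x (i, a)) (fun i => x (i, a))))//.
    by apply: ler_sum => a _; rewrite ip_norm; exact: row_norm_le.
  rewrite -mulr_sumr ler_wpM2l ?addr_ge0 ?exprn_ge0 ?sumr_ge0//.
  by rewrite /famip sum_pair exchange_big.
- by move=> x; rewrite fDE sumr_ge0// => a _; rewrite ip_ge0.
move=> v; apply/funext => -[i a]; rewrite /P /D /=.
rewrite !linear_sum/=; under eq_bigr do rewrite !linear_sum/=.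
under [RHS]eq_bigr do rewrite !linear_sum/=.
rewrite exchange_big; apply: eq_bigr => k _; apply: eq_bigr => j _.
exact: (congr1 (fun f : bop _ _ => f (v (j, k))) (com i j a k)).
Qed.

End MatrixPositivity.

(** * Extension from generators *)

Section Extension.
Variable R : realType.
Implicit Types H K L : hilbert R.

Lemma extension L L' (G : L -> L' -> Prop) (M : R[i]) : 0 <= M ->
  (forall a x y x' y', G x y -> G x' y' -> G (a *: x + x') (a *: y + y')) ->
  (forall x y, G x y -> `|y| <= M * `|x|) ->
  (forall x e, 0 < e -> exists x' y', G x' y' /\ `|x - x'| <= e) ->
  exists2 W : bop L L', (forall x y, G x y -> W x = y) & `|W| <= M.
Proof.
move=> M0 Gl GM Gd.
pose Gc (x : L) (y : L') := forall e : R[i], 0 < e ->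
  exists x' y', [/\ G x' y', `|x - x'| <= e & `|y - y'| <= e].
have GGc x y : G x y -> Gc x y.
  by move=> xy e e0; exists x, y; rewrite !subrr !normr0; split=> //; exact: ltW.
have Gcl a x y x' y' : Gc x y -> Gc x' y' -> Gc (a *: x + x') (a *: y + y').
  move=> xy xy' e e0; have a1 : 0 < `|a| + 1 by rewrite ltr_wpDl.
  have [u [v [uv xu yv]]] := xy _ (divr_gt0 e0 a1).
  have [u' [v' [uv' xu' yv']]] := xy' _ (divr_gt0 e0 a1).
  have ae : `|a| * (e / (`|a| + 1)) + e / (`|a| + 1) = e.
    by rewrite -[X in _ + X]mul1r -mulrDl mulrC divfK// gt_eqF.
  exists (a *: u + u'), (a *: v + v'); split; first exact: Gl.
    rewrite opprD addrACA -scalerBr (le_trans (ler_normD _ _))// normrZ -[leRHS]ae.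
    by rewrite lerD// ler_wpM2l.
  rewrite opprD addrACA -scalerBr (le_trans (ler_normD _ _))// normrZ -[leRHS]ae.
  by rewrite lerD// ler_wpM2l.
have GcM x y : Gc x y -> `|y| <= M * `|x|.
  move=> xy; apply/ler_addgt0Pr => e e0; have M1 : 0 < M + 1 by rewrite ltr_wpDl.
  have [u [v [uv xu yv]]] := xy _ (divr_gt0 e0 M1).
  have ae : M * (e / (M + 1)) + e / (M + 1) = e.
    by rewrite -[X in _ + X]mul1r -mulrDl mulrC divfK// gt_eqF.
  rewrite -[y](subrK v) (le_trans (ler_normD _ _))//.
  rewrite -[X in _ <= _ + X]ae [leRHS]addrA [leLHS]addrC lerD// (le_trans (GM _ _ uv))// -mulrDr ler_wpM2l//.
  by rewrite -{1}[u](subKr x) (le_trans (ler_normB _ _))// lerD2l.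
have Gcu x y y' : Gc x y -> Gc x y' -> y = y'.
  move=> xy xy'; apply/eqP; rewrite eq_sym -subr_eq0 -normr_le0.
  have := GcM _ _ (Gcl (-1) _ _ _ _ xy xy').
  by rewrite !scaleN1r addNr normr0 mulr0 addrC.
have /choice[g gG] x : exists y, Gc x y.
  pose F := filter_from [set e : R[i] | 0 < e]
    (fun e => [set y | exists x', G x' y /\ `|x - x'| <= e]).
  have FF : ProperFilter F.
    apply: filter_from_proper; last first.
      by move=> e /= /(Gd x)[u [v [uv xu]]]; exists v, u.
    apply: filter_from_filter; first by exists 1; exact: ltr01.
    move=> e e' /= e0 e0'; have [c [c0 ce ce']] := pos_min e0 e0'.
    by exists c => // s [u [us xu]]; split; exists u; split=> //; apply: le_trans xu _.
  have cF : cauchy F.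
    apply/cauchyP => e e0; have M3 : 0 < M * 2 + 1 by rewrite ltr_wpDl// mulr_ge0.
    have e3 := divr_gt0 e0 M3; have [u [v [uv xu]]] := Gd x _ e3.
    exists v, (e / (M * 2 + 1)) => // v' [u' [uv' xu']]; rewrite -ball_normE /=.
    have := GM _ _ (Gl (-1) _ _ _ _ uv uv').
    rewrite !scaleN1r ![- _ + _]addrC distrC => /le_lt_trans; apply.
    rewrite (@le_lt_trans _ _ (M * (e / (M * 2 + 1) *+ 2)))//.
      rewrite ler_wpM2l// mulr2n -(subrKA x) (le_trans (ler_normD _ _))// lerD//.
      by rewrite distrC.
    have -> : M * (e / (M * 2 + 1) *+ 2) = e - e / (M * 2 + 1).
      by field; rewrite gt_eqF.
    by rewrite gtrBl.
  have /cvg_ex[y Fy] := @cauchy_cvg L' F FF cF; exists y => e e0.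
  have Fe : F [set v | `|y - v| <= e] by exact: (@cvgr_dist_le _ _ _ F _ id y Fy).
  have Fx : F [set v | exists u, G u v /\ `|x - u| <= e] by exists e.
  by have [v [/= yv [u [uv xu]]]] := filter_ex (filterI Fe Fx); exists u, v.
have [W WE] : exists W : bop L L', forall x, W x = g x.
  apply: (mkbop M0) => [a x y|x]; last exact: GcM.
  by apply: Gcu (gG _) _; apply: Gcl.
exists W => [x y xy|]; first by rewrite WE; apply: Gcu (gG _) _; apply: GGc.
by apply: bop_norm_le => // x; rewrite WE; exact: GcM.
Qed.

Lemma lift_bound (I : Type) (P : set I) H L L' (xi : I -> bop H L) (xi' : I -> bop H L')
    (D : bop H H) (M : R[i]) : 0 <= M ->
  dense_range (xi @` P) ->
  (forall x, ip x (D x) <= M ^+ 2 * `|x| ^+ 2) ->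
  (forall i j, P i -> P j -> adj (xi' i) ** xi' j = adj (xi i) ** xi j ** D) ->
  (forall i j, P i -> P j -> D ** (adj (xi i) ** xi j) = adj (xi i) ** xi j ** D) ->
  exists2 W : bop L L', (forall i, P i -> W ** xi i = xi' i) & `|W| <= M.
Proof.
move=> M0 dxi DM xixi com.
pose G (x : L) (y : L') := exists (n : nat) (i : 'I_n -> I) (h : 'I_n -> H),
  [/\ forall k, P (i k), x = \sum_k xi (i k) (h k) & y = \sum_k xi' (i k) (h k)].
have Gl a x y x' y' : G x y -> G x' y' -> G (a *: x + x') (a *: y + y').
  move=> [n [i [h [Pi -> ->]]]] [m [j [h' [Pj -> ->]]]].
  exists (n + m)%N, (fun k => match fintype.split k with inl l => i l | inr l => j l end),
    (fun k => match fintype.split k with inl l => a *: h l | inr l => h' l end); split.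
  - by move=> k; case: fintype.split.
  - rewrite big_split_ord /= scaler_sumr; congr (_ + _); apply: eq_bigr => k _.
      by rewrite (unsplitK (inl _ k)) linearZ.
    by rewrite (unsplitK (inr _ k)).
  - rewrite big_split_ord /= scaler_sumr; congr (_ + _); apply: eq_bigr => k _.
      by rewrite (unsplitK (inl _ k)) linearZ.
    by rewrite (unsplitK (inr _ k)).
have [] := @extension L L' G M M0 Gl.
- move=> x y [n [i [h [Pi -> ->]]]].
  rewrite -(@ler_pXn2r _ 2) ?nnegrE ?mulr_ge0// exprMn.
  apply: le_trans (gram_le (xi := fun k => xi (i k)) h DM _); last by move=> k l; exact: com.
  rewrite -ip_norm !ip_suml le_eqVlt; apply/orP; left; apply/eqP; apply: eq_bigr => k _.
  rewrite !ip_sumr; apply: eq_bigr => l _.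
  rewrite -[LHS]adjPr -[RHS]adjPr; congr (ip _ _).
  exact: (congr1 (fun f : bop _ _ => f (h l)) (xixi _ _ (Pi k) (Pi l))).
- have G0 : G 0 0.
    have f : 'I_0 -> I by case.
    by exists 0%N, f, (fun=> 0); rewrite !big_ord0; split=> // -[].
  move=> x e e0.
  have : closure [set x | exists y, G x y] x.
    have : [set: L] x by [].
    rewrite -dxi; apply: closure_subset => _ [n [c [v [vr ->]]]].
    elim/big_rec: _ => [|k u _ [y uy]]; first by exists 0.
    have [_ [i Pi <-] [h _ <-]] := vr k.
    exists (c k *: xi' i h + y); apply: Gl => //.
    exists 1%N, (fun=> i), (fun=> h); rewrite !big_ord1; split=> //.
  by move=> /closure_normP/(_ e e0)[u [y uy] xu]; exists u, y.
move=> W WG WM; exists W => // i Pi; apply: bopP => h /=.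
by apply: WG; exists 1%N, (fun=> i), (fun=> h); rewrite !big_ord1; split.
Qed.

Lemma lift_gram (I : Type) (P : set I) H H' L L' (xi : I -> bop H L) (xi' : I -> bop H L')
    (S : bop H H') :
  dense_range (xi @` P) ->
  (forall i j, P i -> P j -> adj (xi' i) ** xi' j = adj (xi i) ** xi j ** (adj S ** S)) ->
  (forall i j, P i -> P j ->
    adj S ** S ** (adj (xi i) ** xi j) = adj (xi i) ** xi j ** (adj S ** S)) ->
  exists2 W : bop L L', (forall i, P i -> W ** xi i = xi' i) & `|W| <= `|S|.
Proof.
move=> dxi h1 h2; apply: lift_bound h2 => // x.
by rewrite -adj_norm2 -exprMn ler_pXn2r ?nnegrE ?mulr_ge0// bop_le.
Qed.

Lemma lift_intertwine (I : Type) (P : set I) H H' L L' (xi : I -> bop H L)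
    (xi' : I -> bop H' L') (S : bop H H') :
  dense_range (xi @` P) ->
  (forall i j, P i -> P j -> adj (xi' i) ** xi' j ** S = S ** (adj (xi i) ** xi j)) ->
  exists2 W : bop L L', (forall i, P i -> W ** xi i = xi' i ** S) & `|W| <= `|S|.
Proof.
move=> dxi h.
have h' i j : P i -> P j -> adj S ** (adj (xi' i) ** xi' j) = adj (xi i) ** xi j ** adj S.
  by move=> Pi Pj; have := congr1 (@adj _ _ _) (h j i Pj Pi); rewrite !adj_comp !adjK.
apply: (lift_gram (xi' := fun i => xi' i ** S)) => // i j Pi Pj.
  by rewrite adj_comp -compoA (compoA (adj (xi' i))) compoA h' // compoA.
by rewrite -compoA -h// compoA h'// compoA.
Qed.

Lemma lift_isometry (I : Type) (P : set I) H L L' (xi : I -> bop H L) (xi' : I -> bop H L') :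
  dense_range (xi @` P) ->
  (forall i j, P i -> P j -> adj (xi' i) ** xi' j = adj (xi i) ** xi j) ->
  exists W : bop L L', forall i, P i -> W ** xi i = xi' i.
Proof.
move=> dxi h.
have [] := @lift_intertwine I P H H L L' xi xi' (opid H) dxi.
  by move=> i j Pi Pj; rewrite compo1 comp1o h.
by move=> W WE _; exists W => i Pi; rewrite WE// compo1.
Qed.

End Extension.

Section Cancellation.
Variable R : realType.
Implicit Types H K L : hilbert R.

Lemma xget_prop (T : choiceType) (x0 : T) (P : set T) : (exists x, P x) -> P (xget x0 P).
Proof. exact: xgetPex. Qed.

Lemma dense_cancel H K L (S : set (bop H K)) (T T' : bop L K) : dense_range S ->
  (forall s, S s -> adj s ** T = adj s ** T') -> T = T'.
Proof.
move=> dS TT'; rewrite -[T]adjK -[T']adjK; congr adj.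
apply: (dense_ext dS) => s Ss.
by have := congr1 (@adj _ _ _) (TT' s Ss); rewrite !adj_comp !adjK.
Qed.

Lemma dense_image H K (S : set (bop H K)) : dense_range S -> dense_range (id @` S).
Proof. by rewrite image_id. Qed.

Lemma dense_vec_eq H (Y : set H) (u v : H) : cspan Y = [set: H] ->
  (forall y, Y y -> ip y u = ip y v) -> u = v.
Proof.
move=> dY uv; apply: ip_inj => z; rewrite ipC [RHS]ipC; congr (_^*).
apply/eqP; rewrite -subr_eq0 -ipBl; apply/eqP.
have cs : closed_subspace [set x | ip (u - v) x = 0].
  apply: (@ker_closed_subspace _ _ (R[i] : numFieldType) (ip (u - v)) `|u - v|) => //.
    by move=> a x y; rewrite ipP.
  exact: ip_CS.
have : [set: H] z by [].
rewrite -dY; apply: (cspan_sub cs) => y Yy /=.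
by rewrite ipC ipBr uv// subrr rmorph0.
Qed.

End Cancellation.

(** * Relative tensor products *)

Section Representation.
Variable R : realType.
Implicit Types H K : hilbert R.

Definition rho_ok K H (a : set (bop K H)) (c : bop K K) :=
  forall xi xi', a xi -> a xi' -> adj xi ** xi' ** c = c ** (adj xi ** xi').

Lemma rhoP K H (a : set (bop K H)) c : dense_range a -> rho_ok a c ->
  (forall xi, a xi -> rho a c ** xi = xi ** c) /\ `|rho a c| <= `|c|.
Proof.
move=> da ac.
have [|W WE WM] := @lift_intertwine R _ a K K H H id id c (dense_image da).
  by move=> i j ai aj; rewrite ac.
have rE := @xget_prop _ 0 [set T : bop H H | forall xi, a xi -> T ** xi = xi ** c]
  (ex_intro _ W WE).
split; first exact: rE.
suff -> : rho a c = W by [].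
by apply: (dense_ext da) => s sa; rewrite rE// WE.
Qed.

Lemma rhoE K H (a : set (bop K H)) c xi : dense_range a -> rho_ok a c -> a xi ->
  rho a c ** xi = xi ** c.
Proof. by move=> da ac axi; have [->] := rhoP da ac. Qed.

Lemma rho_uniq K H (a : set (bop K H)) c T : dense_range a ->
  (forall xi, a xi -> T ** xi = xi ** c) -> rho a c = T.
Proof.
move=> da TE; have rE := @xget_prop _ 0 [set T : bop H H | forall xi, a xi -> T ** xi = xi ** c]
  (ex_intro _ T TE).
by apply: (dense_ext da) => s sa; rewrite rE// TE.
Qed.

Lemma rho_ok_adj K H (a : set (bop K H)) c : rho_ok a c -> rho_ok a (adj c).
Proof.
move=> ac xi xi' axi axi'.
by have := congr1 (@adj _ _ _) (ac xi' xi axi' axi); rewrite !adj_comp !adjK.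
Qed.

Lemma adj_rho K H (a : set (bop K H)) c : dense_range a -> rho_ok a c ->
  adj (rho a c) = rho a (adj c).
Proof.
move=> da ac; apply/esym/rho_uniq => // xi axi; apply: (dense_cancel da) => xi' axi'.
rewrite compoA -adj_comp rhoE// adj_comp -compoA.
by rewrite -(rho_ok_adj ac)// compoA.
Qed.

Lemma rho_sum K H (a : set (bop K H)) I (r : seq I) (P : pred I) (c : I -> bop K K) :
  dense_range a -> (forall i, rho_ok a (c i)) ->
  \sum_(i <- r | P i) rho a (c i) = rho a (\sum_(i <- r | P i) c i).
Proof.
move=> da ac; apply/esym/rho_uniq => // xi axi.
by rewrite compo_suml compo_sumr; apply: eq_bigr => i _; rewrite rhoE.
Qed.

End Representation.

Section RelativeTensor.
Variables (R : realType) (K0 H K : hilbert R).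
Variables (b : set (bop K0 H)) (g : set (bop K0 K)).

Definition rt_ok := [/\ dense_range b, dense_range g &
  forall xi xi' eta eta', b xi -> b xi' -> g eta -> g eta' ->
    adj xi ** xi' ** (adj eta ** eta') = adj eta ** eta' ** (adj xi ** xi')].

Hypothesis bg : rt_ok.

Let db : dense_range b. Proof. by case: bg. Qed.
Let dg : dense_range g. Proof. by case: bg. Qed.
Let com xi xi' eta eta' : b xi -> b xi' -> g eta -> g eta' ->
    adj xi ** xi' ** (adj eta ** eta') = adj eta ** eta' ** (adj xi ** xi').
Proof. by case: bg => _ _; apply. Qed.

Lemma rho_ok_l eta eta' : g eta -> g eta' -> rho_ok b (adj eta ** eta').
Proof. by move=> ? ? xi xi' ? ?; rewrite com. Qed.

Lemma rho_ok_r xi xi' : b xi -> b xi' -> rho_ok g (adj xi ** xi').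
Proof. by move=> ? ? eta eta' ? ?; rewrite com. Qed.

Let X := (bop K0 H * K0 * bop K0 K)%type.
Let b0 (xi : bop K0 H) := if `[< b xi >] then xi else 0.
Let g0 (eta : bop K0 K) := if `[< g eta >] then eta else 0.
Let kf (x y : X) : R[i] :=
  ip x.1.2 ((adj (b0 x.1.1) ** b0 y.1.1 ** adj (g0 x.2) ** g0 y.2) y.1.2).

Let com0 xi xi' eta eta' : adj (b0 xi) ** b0 xi' ** (adj (g0 eta) ** g0 eta') =
  adj (g0 eta) ** g0 eta' ** (adj (b0 xi) ** b0 xi').
Proof.
rewrite /b0 /g0.
have [bx|_] := asboolP (b xi); last by rewrite adj0 !compo0l !compo0r.
have [bx'|_] := asboolP (b xi'); last by rewrite !compo0r !compo0l.
have [ge|_] := asboolP (g eta); last by rewrite adj0 !compo0l !compo0r.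
have [ge'|_] := asboolP (g eta'); last by rewrite !compo0r !compo0l.
exact: com.
Qed.

Let kfC x y : kf y x = (kf x y)^*.
Proof.
rewrite /kf -ipC -adjP; congr (ip _ _).
by rewrite -!compoA !adj_comp !adjK -compoA -com0 !compoA.
Qed.

Let kf_ge0 (s : seq (R[i] * X)) :
  0 <= \sum_(p <- s) \sum_(q <- s) p.1^* * (q.1 * kf p.2 q.2).
Proof.
pose t := tnth (in_tuple s).
have := @schur_ge0 R _ K0 H K (fun i => b0 (t i).2.1.1) (fun i => g0 (t i).2.2)
  (fun i => (t i).1 *: (t i).2.1.2) (fun i j k l => com0 _ _ _ _).
move=> /le_trans; apply; rewrite le_eqVlt; apply/orP; left; apply/eqP.
rewrite [RHS]big_tnth; apply: eq_bigr => i _; rewrite [RHS]big_tnth; apply: eq_bigr => j _.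
by rewrite linearZ ipZl ipZr.
Qed.

Lemma rtensor_modelP : is_rtensor b g (rtensor_model b g).
Proof.
suff ex : exists M, is_rtensor b g M.
  by rewrite /rtensor_model; case: pselect => // e; exact: svalP.
have [L [j [jE jd]]] := kernel_hilbert (PDKernel kfC kf_ge0).
exists (@RTModel _ _ _ _ L (fun xi z eta => j (xi, z, eta))); split=> /=.
  move=> xi xi' z z' eta eta' bx bx' ge ge'; rewrite jE /= /kf/= /b0 /g0.
  by rewrite !asboolT.
apply/seteqP; split=> // x _; have : [set: L] x by [].
rewrite -jd; apply: cspanS => _ [[[xi z] eta] _ <-].
have [[bx ge]|nbg] := pselect (b xi /\ g eta).
  by apply: sub_cspan; exists xi, z, eta.
have -> : j (xi, z, eta) = 0.
  apply/eqP; rewrite -normr_eq0 -sqrf_eq0 -ip_norm jE /= /kf/=.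
  have [->|->] : b0 xi = 0 \/ g0 eta = 0.
    rewrite /b0 /g0; have [bx|_] := asboolP (b xi); last by left.
    by have [ge|_] := asboolP (g eta); [case: nbg|right].
    by rewrite [adj 0 _](_ : _ = 0) ?ip0r//; exact: (linear0 (adj 0)).
  by rewrite [adj 0 _](_ : _ = 0) ?linear0 ?ip0r//; exact: (linear0 (adj 0)).
by have [] := cspan_closed_subspace [set t | exists xi0 z0 eta0,
  [/\ b xi0, g eta0 & t = j (xi0, z0, eta0)]].
Qed.

Lemma tens_ip xi xi' z z' eta eta' : b xi -> b xi' -> g eta -> g eta' ->
  ip (tens b g xi z eta) (tens b g xi' z' eta') =
  ip z ((adj xi ** xi' ** adj eta ** eta') z').
Proof. by move=> *; apply: rtensor_modelP.1. Qed.

Lemma tens_dense : cspan [set t | exists xi z eta,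
  [/\ b xi, g eta & t = tens b g xi z eta]] = [set: rtensor b g].
Proof. exact: rtensor_modelP.2. Qed.

Lemma tens_ex xi eta : b xi -> g eta ->
  exists T : bop K0 (rtensor b g), forall z, T z = tens b g xi z eta.
Proof.
move=> bx ge; pose M := sqrtC `|adj xi ** xi ** adj eta ** eta|.
apply: (@mkbop _ _ _ (fun z => tens b g xi z eta) M) => [|a z z'|z].
- by rewrite sqrtC_ge0.
- apply: (dense_vec_eq tens_dense) => _ [xi' [w [eta' [bx' ge' ->]]]].
  by rewrite ipP !tens_ip// linearP ipP.
rewrite -(@ler_pXn2r _ 2) ?nnegrE ?mulr_ge0 ?sqrtC_ge0// exprMn sqrtCK -ip_norm tens_ip//.
rewrite -[leLHS]ger0_norm; last by rewrite -tens_ip// ip_ge0.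
rewrite (le_trans (ip_CS _ _))// mulrC expr2 mulrA ler_wpM2r//; exact: bop_le.
Qed.

Lemma ket1_ex xi : b xi -> exists W : bop K (rtensor b g),
   forall eta z, g eta -> W (eta z) = tens b g xi z eta.
Proof.
move=> bx.
pose t eta : bop K0 (rtensor b g) := xget 0 [set T : bop K0 (rtensor b g) | forall z, T z = tens b g xi z eta].
have tE eta z : g eta -> t eta z = tens b g xi z eta.
  move=> ge; exact: (@xget_prop _ 0 [set T : bop K0 (rtensor b g) |
    forall z, T z = tens b g xi z eta] (tens_ex bx ge)).
have [||W WE _] := @lift_gram R _ g K0 H K (rtensor b g) id t xi (dense_image dg).
- move=> i j gi gj; rewrite -com//; apply: bop_ip_eq => x y.
  by rewrite /= adjPr !tE// tens_ip.
- by move=> i j gi gj; rewrite com.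
by exists W => eta z ge; rewrite -tE// -WE.
Qed.

Lemma ket2_ex eta : g eta -> exists W : bop H (rtensor b g),
   forall xi z, b xi -> W (xi z) = tens b g xi z eta.
Proof.
move=> ge.
pose t xi : bop K0 (rtensor b g) := xget 0 [set T : bop K0 (rtensor b g) | forall z, T z = tens b g xi z eta].
have tE xi z : b xi -> t xi z = tens b g xi z eta.
  move=> bx; exact: (@xget_prop _ 0 [set T : bop K0 (rtensor b g) |
    forall z, T z = tens b g xi z eta] (tens_ex bx ge)).
have [||W WE _] := @lift_gram R _ b K0 K H (rtensor b g) id t eta (dense_image db).
- move=> i j gi gj; apply: bop_ip_eq => x y.
  by rewrite /= adjPr !tE// tens_ip.
- by move=> i j gi gj; rewrite com.
by exists W => xi z bx; rewrite -tE// -WE.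
Qed.

Lemma ket1E xi eta z : b xi -> g eta -> ket1 b g xi (eta z) = tens b g xi z eta.
Proof.
move=> bx ge; exact: (@xget_prop _ 0 [set W : bop K (rtensor b g) |
  forall eta z, g eta -> W (eta z) = tens b g xi z eta] (ket1_ex bx)).
Qed.

Lemma ket2E xi eta z : b xi -> g eta -> ket2 b g eta (xi z) = tens b g xi z eta.
Proof.
move=> bx ge; exact: (@xget_prop _ 0 [set W : bop H (rtensor b g) |
  forall xi z, b xi -> W (xi z) = tens b g xi z eta] (ket2_ex ge)).
Qed.

Lemma ket12 xi eta : b xi -> g eta -> ket1 b g xi ** eta = ket2 b g eta ** xi.
Proof. by move=> bx ge; apply: bopP => z; rewrite /= ket1E// ket2E. Qed.

Lemma ket1_dense : dense_range (ket1 b g @` b).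
Proof.
apply/seteqP; split=> // x _; have : [set: rtensor b g] x by [].
rewrite -tens_dense; apply: cspanS => _ [xi [z [eta [bx ge ->]]]].
rewrite -ket1E//; apply: sub_cspan; exists (ket1 b g xi); first by exists xi.
by exists (eta z).
Qed.

Lemma ket2_dense : dense_range (ket2 b g @` g).
Proof.
apply/seteqP; split=> // x _; have : [set: rtensor b g] x by [].
rewrite -tens_dense; apply: cspanS => _ [xi [z [eta [bx ge ->]]]].
rewrite -ket2E//; apply: sub_cspan; exists (ket2 b g eta); first by exists eta.
by exists (xi z).
Qed.

Lemma ket1_gram xi xi' : b xi -> b xi' ->
  adj (ket1 b g xi) ** ket1 b g xi' = rho g (adj xi ** xi').
Proof.
move=> bx bx'; apply/esym/rho_uniq => // eta ge; apply: (dense_cancel dg) => eta' ge'.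
apply: bop_ip_eq => z z'.
rewrite /= !adjPr !ket1E// tens_ip// -[RHS]adjPr; congr (ip _ _).
exact: (congr1 (fun f : bop _ _ => f z') (com bx bx' ge' ge)).
Qed.

Lemma ket2_gram eta eta' : g eta -> g eta' ->
  adj (ket2 b g eta) ** ket2 b g eta' = rho b (adj eta ** eta').
Proof.
move=> ge ge'; apply/esym/rho_uniq => // xi bx; apply: (dense_cancel db) => xi' bx'.
apply: bop_ip_eq => z z'.
by rewrite /= !adjPr !ket2E// tens_ip//= !adjPr.
Qed.

End RelativeTensor.
Arguments rt_ok {R K0 H K} b g.

Section TensorOps.
Variables (R : realType) (K0 : hilbert R).
Implicit Types H K L : hilbert R.

Lemma rt_ok_sym H K (b : set (bop K0 H)) (g : set (bop K0 K)) : rt_ok b g -> rt_ok g b.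
Proof. by move=> [db dg com]; split=> // xi xi' eta eta' ? ? ? ?; rewrite com. Qed.

Lemma rho_intertwine H L (a : set (bop K0 H)) (a' : set (bop K0 L)) c (X : bop H L) :
  dense_range a -> dense_range a' -> rho_ok a c -> rho_ok a' c ->
  (forall xi, a xi -> a' (X ** xi)) -> rho a' c ** X = X ** rho a c.
Proof.
move=> da da' ac ac' aX; apply: (dense_ext da) => xi axi.
rewrite -compoA rhoE//; last exact: aX.
by rewrite -!compoA rhoE.
Qed.

Lemma rho_intertwine_adj H L (a : set (bop K0 H)) (a' : set (bop K0 L)) c (X : bop H L) :
  dense_range a -> dense_range a' -> rho_ok a c -> rho_ok a' c ->
  (forall xi, a xi -> a' (X ** xi)) -> adj X ** rho a' c = rho a c ** adj X.
Proof.
move=> da da' ac ac' aX; have ac1 := rho_ok_adj ac; have ac1' := rho_ok_adj ac'.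
have := congr1 (@adj _ _ _) (rho_intertwine da da' ac1 ac1' aX).
by rewrite !adj_comp !adj_rho// adjK.
Qed.

Lemma opl_uniq H H' K (b : set (bop K0 H)) (b' : set (bop K0 H')) (g : set (bop K0 K))
    (S : bop H H') W : rt_ok b g ->
  (forall eta, g eta -> W ** ket2 b g eta = ket2 b' g eta ** S) -> opl b b' g S = W.
Proof.
move=> bg WE; apply: (dense_ext (ket2_dense bg)) => _ [eta ge <-]; rewrite WE//.
exact: (@xget_prop _ 0 [set W : bop (rtensor b g) (rtensor b' g) |
  forall eta, g eta -> W ** ket2 b g eta = ket2 b' g eta ** S] (ex_intro _ W WE)).
Qed.

Lemma opr_uniq H K K' (b : set (bop K0 H)) (g : set (bop K0 K)) (g' : set (bop K0 K'))
    (T : bop K K') W : rt_ok b g ->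
  (forall xi, b xi -> W ** ket1 b g xi = ket1 b g' xi ** T) -> opr b g g' T = W.
Proof.
move=> bg WE; apply: (dense_ext (ket1_dense bg)) => _ [xi bx <-]; rewrite WE//.
exact: (@xget_prop _ 0 [set W : bop (rtensor b g) (rtensor b g') |
  forall xi, b xi -> W ** ket1 b g xi = ket1 b g' xi ** T] (ex_intro _ W WE)).
Qed.

Definition opl_ok H H' K (b : set (bop K0 H)) (b' : set (bop K0 H')) (g : set (bop K0 K))
    (S : bop H H') := forall eta eta', g eta -> g eta' ->
  rho b' (adj eta ** eta') ** S = S ** rho b (adj eta ** eta').

Definition opr_ok H K K' (b : set (bop K0 H)) (g : set (bop K0 K)) (g' : set (bop K0 K'))
    (T : bop K K') := forall xi xi', b xi -> b xi' ->
  rho g' (adj xi ** xi') ** T = T ** rho g (adj xi ** xi').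

Lemma oplE H H' K (b : set (bop K0 H)) (b' : set (bop K0 H')) (g : set (bop K0 K))
    (S : bop H H') eta : rt_ok b g -> rt_ok b' g -> opl_ok b b' g S -> g eta ->
  opl b b' g S ** ket2 b g eta = ket2 b' g eta ** S.
Proof.
move=> bg bg' Sok ge.
have [|W WE _] := @lift_intertwine R _ g H H' _ _ (ket2 b g) (ket2 b' g) S (ket2_dense bg).
  by move=> i j gi gj; rewrite !ket2_gram// Sok.
by rewrite (opl_uniq bg WE) WE.
Qed.

Lemma oprE H K K' (b : set (bop K0 H)) (g : set (bop K0 K)) (g' : set (bop K0 K'))
    (T : bop K K') xi : rt_ok b g -> rt_ok b g' -> opr_ok b g g' T -> b xi ->
  opr b g g' T ** ket1 b g xi = ket1 b g' xi ** T.
Proof.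
move=> bg bg' Tok bx.
have [|W WE _] := @lift_intertwine R _ b K K' _ _ (ket1 b g) (ket1 b g') T (ket1_dense bg).
  by move=> i j gi gj; rewrite !ket1_gram// Tok.
by rewrite (opr_uniq bg WE) WE.
Qed.

Lemma opl_bra H H' K (b : set (bop K0 H)) (b' : set (bop K0 H')) (g : set (bop K0 K))
    (S : bop H H') eta : rt_ok b g -> rt_ok b' g -> opl_ok b b' g S -> g eta ->
  adj (ket2 b' g eta) ** opl b b' g S = S ** adj (ket2 b g eta).
Proof.
move=> bg bg' Sok ge; apply: (dense_ext (ket2_dense bg)) => _ [eta' ge' <-].
by rewrite -compoA oplE// compoA ket2_gram// Sok// -(ket2_gram bg)// compoA.
Qed.

Lemma opr_bra H K K' (b : set (bop K0 H)) (g : set (bop K0 K)) (g' : set (bop K0 K'))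
    (T : bop K K') xi : rt_ok b g -> rt_ok b g' -> opr_ok b g g' T -> b xi ->
  adj (ket1 b g' xi) ** opr b g g' T = T ** adj (ket1 b g xi).
Proof.
move=> bg bg' Tok bx; apply: (dense_ext (ket1_dense bg)) => _ [xi' bx' <-].
by rewrite -compoA oprE// compoA ket1_gram// Tok// -(ket1_gram bg)// compoA.
Qed.

Lemma flipE2 H K (b : set (bop K0 H)) (g : set (bop K0 K)) eta : rt_ok b g -> g eta ->
  flip b g ** ket2 b g eta = ket1 g b eta.
Proof.
move=> bg ge; have gb := rt_ok_sym bg.
have [|W WE] := @lift_isometry R _ g H _ _ (ket2 b g) (ket1 g b) (ket2_dense bg).
  by move=> i j gi gj; rewrite ket2_gram// ket1_gram.
exact: (@xget_prop _ 0 [set W : bop (rtensor b g) (rtensor g b) |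
  forall eta, g eta -> W ** ket2 b g eta = ket1 g b eta] (ex_intro _ W WE)).
Qed.

Lemma flipE1 H K (b : set (bop K0 H)) (g : set (bop K0 K)) xi : rt_ok b g -> b xi ->
  flip b g ** ket1 b g xi = ket2 g b xi.
Proof.
move=> bg bx; have [_ dg _] := bg; apply: (dense_ext dg) => eta ge.
by rewrite -compoA ket12// compoA flipE2// ket12//; exact: rt_ok_sym.
Qed.

Definition gram_in H (a : set (bop K0 H)) (C : set (bop K0 K0)) :=
  dense_range a /\ forall x y, a x -> a y -> C (adj x ** y).

Lemma gram_rho_ok H (a : set (bop K0 H)) (C : set (bop K0 K0)) c : gram_in a C ->
  (forall d, C d -> d ** c = c ** d) -> rho_ok a c.
Proof. by move=> [_ aC] Cc xi xi' ? ?; apply/Cc/aC. Qed.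

Lemma gram_rt_ok H K (b : set (bop K0 H)) (g : set (bop K0 K)) (C C' : set (bop K0 K0)) :
  gram_in b C -> gram_in g C' -> (forall c c', C c -> C' c' -> c ** c' = c' ** c) ->
  rt_ok b g.
Proof. by move=> [db bC] [dg gC] CC; split=> // *; apply: CC; [exact: bC|exact: gC]. Qed.

Lemma closed_subspace_comp H K L (C : set (bop L K)) (S : bop H K) :
  closed_subspace C -> closed_subspace [set T : bop L H | C (S ** T)].
Proof.
move=> cC; have [_ C0 Cl] := cC; split=> /=.
- move=> T /closure_normP h /=; apply: (closed_subspace_lim cC) => e e0.
  have S1 : 0 < `|S| + 1 by rewrite ltr_wpDl.
  have [T' /= CT' TT'] := h _ (divr_gt0 e0 S1); exists (S ** T') => //.
  rewrite -compoBr (le_trans (compo_le _ _))//.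
  rewrite (@le_trans _ _ ((`|S| + 1) * `|T - T'|))//.
    by rewrite ler_wpM2r// lerDl.
  by rewrite mulrC -ler_pdivlMr.
- by rewrite compo0r.
- by move=> c u v Cu Cv; rewrite compoPr; apply: Cl.
Qed.

Lemma closed_subspace_adj H K L (C : set (bop H L)) (T : bop H K) :
  closed_subspace C -> closed_subspace [set S : bop L K | C (adj S ** T)].
Proof.
move=> cC; have [_ C0 Cl] := cC; split=> /=.
- move=> S /closure_normP h /=; apply: (closed_subspace_lim cC) => e e0.
  have T1 : 0 < `|T| + 1 by rewrite ltr_wpDl.
  have [S' /= CS' SS'] := h _ (divr_gt0 e0 T1); exists (adj S' ** T) => //.
  rewrite -compoBl -adjB (le_trans (compo_le _ _))// norm_adj.
  rewrite (@le_trans _ _ (`|S - S'| * (`|T| + 1)))//.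
    by rewrite ler_wpM2l// lerDl.
  by rewrite -ler_pdivlMr.
- by rewrite adj0 compo0l.
- by move=> c u v Cu Cv; rewrite adj_lin compoPl; apply: Cl.
Qed.

Lemma gram_cspan H (S : set (bop K0 H)) (C : set (bop K0 K0)) : closed_subspace C ->
  (forall x y, S x -> S y -> C (adj x ** y)) ->
  forall x y, cspan S x -> cspan S y -> C (adj x ** y).
Proof.
move=> cC SC x y Sx Sy.
apply: (cspan_sub (closed_subspace_comp (adj x) cC) _ Sy) => z Sz.
by apply: (cspan_sub (closed_subspace_adj z cC) _ Sx) => w Sw; exact: SC.
Qed.

Lemma sub_ltri H K (b : set (bop K0 H)) (g : set (bop K0 K)) (a : set (bop K0 H)) xi eta :
  a xi -> g eta -> ltri b g a (ket2 b g eta ** xi).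
Proof.
by move=> ax ge; apply: sub_cspan; exists (ket2 b g eta); [exists eta|exists xi].
Qed.

Lemma sub_rtri H K (b : set (bop K0 H)) (g : set (bop K0 K)) (d : set (bop K0 K)) xi eta :
  b xi -> d eta -> rtri b g d (ket1 b g xi ** eta).
Proof.
by move=> bx de; apply: sub_cspan; exists (ket1 b g xi); [exists xi|exists eta].
Qed.

Lemma gram_ltri H K (b : set (bop K0 H)) (g : set (bop K0 K)) (a : set (bop K0 H)) C :
  rt_ok b g -> gram_in a C -> closed_subspace C ->
  (forall eta eta' xi, g eta -> g eta' -> a xi -> a (rho b (adj eta ** eta') ** xi)) ->
  gram_in (ltri b g a) C.
Proof.
move=> bg [da aC] cC st; split.
  apply: (sub_dense (dense_comp da (ket2_dense bg))) => _ [s Ss [x _ <-]].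
  by apply: sub_cspan; exists s; [exact: sub_cspan|exists x].
apply: gram_cspan => // _ _ [_ [eta ge <-] [xi ax <-]] [_ [eta' ge' <-] [xi' ax' <-]].
rewrite adj_comp compoA -(compoA (adj xi)) ket2_gram// -compoA.
by apply: aC => //; apply: st.
Qed.

Lemma gram_rtri H K (b : set (bop K0 H)) (g : set (bop K0 K)) (d : set (bop K0 K)) C :
  rt_ok b g -> gram_in d C -> closed_subspace C ->
  (forall xi xi' eta, b xi -> b xi' -> d eta -> d (rho g (adj xi ** xi') ** eta)) ->
  gram_in (rtri b g d) C.
Proof.
move=> bg [dd dC] cC st; split.
  apply: (sub_dense (dense_comp dd (ket1_dense bg))) => _ [s Ss [x _ <-]].
  by apply: sub_cspan; exists s; [exact: sub_cspan|exists x].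
apply: gram_cspan => // _ _ [_ [xi bx <-] [eta de <-]] [_ [xi' bx' <-] [eta' de' <-]].
rewrite adj_comp compoA -(compoA (adj eta)) ket1_gram// -compoA.
by apply: dC => //; apply: st.
Qed.

Lemma opl_rho H K (b : set (bop K0 H)) (g : set (bop K0 K)) (a : set (bop K0 H)) c :
  rt_ok b g -> dense_range a -> rho_ok a c -> dense_range (ltri b g a) ->
  rho_ok (ltri b g a) c -> opl b b g (rho a c) = rho (ltri b g a) c.
Proof.
move=> bg da ac dl lc; apply: opl_uniq => // eta ge; apply: rho_intertwine => // xi ax.
exact: sub_ltri.
Qed.

Lemma opr_rho H K (b : set (bop K0 H)) (g : set (bop K0 K)) (d : set (bop K0 K)) c :
  rt_ok b g -> dense_range d -> rho_ok d c -> dense_range (rtri b g d) ->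
  rho_ok (rtri b g d) c -> opr b g g (rho d c) = rho (rtri b g d) c.
Proof.
move=> bg dd dc dl lc; apply: opr_uniq => // xi bx; apply: rho_intertwine => // eta de.
exact: sub_rtri.
Qed.

Section Assoc.
Variables (H K L : hilbert R) (b : set (bop K0 H)) (g d : set (bop K0 K)).
Variable e : set (bop K0 L).
Hypotheses (bg : rt_ok b g) (de : rt_ok d e) (rde : rt_ok (rtri b g d) e).
Hypothesis bl : rt_ok b (ltri d e g).
Hypothesis comm : forall xi xi' eta eta', b xi -> b xi' -> e eta -> e eta' ->
  rho g (adj xi ** xi') ** rho d (adj eta ** eta') =
  rho d (adj eta ** eta') ** rho g (adj xi ** xi').

Lemma rho_rtri_ket1 xi eta eta' : b xi -> e eta -> e eta' ->
  rho (rtri b g d) (adj eta ** eta') ** ket1 b g xi =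
  ket1 b g xi ** rho d (adj eta ** eta').
Proof.
move=> bx ee ee'; have [dr _ _] := rde; have [dd _ _] := de.
apply: rho_intertwine => //; [exact: (rho_ok_l de)|exact: (rho_ok_l rde)|].
by move=> zeta dz; exact: sub_rtri.
Qed.

Lemma rho_ltri_ket2 xi xi' eta : b xi -> b xi' -> e eta ->
  rho (ltri d e g) (adj xi ** xi') ** ket2 d e eta =
  ket2 d e eta ** rho g (adj xi ** xi').
Proof.
move=> bx bx' ee; have [_ dl _] := bl; have [_ dg _] := bg.
apply: rho_intertwine => //; [exact: (rho_ok_r bg)|exact: (rho_ok_r bl)|].
by move=> zeta dz; exact: sub_ltri.
Qed.

Let P : set (bop K0 H * bop K0 L) := [set p | b p.1 /\ e p.2].

Let dP : dense_range ((fun p => ket2 (rtri b g d) e p.2 ** ket1 b g p.1) @` P).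
Proof.
apply: (sub_dense (dense_comp (ket1_dense bg) (ket2_dense rde))) => _ [_ [_ [eta ee <-] [_ [xi bx <-] <-]] [x _ <-]].
by apply: sub_cspan; exists (ket2 (rtri b g d) e eta ** ket1 b g xi);
  [exists (xi, eta)|exists x].
Qed.

Let gramP (p q : bop K0 H * bop K0 L) : P p -> P q ->
  adj (ket1 b (ltri d e g) p.1 ** ket2 d e p.2) ** (ket1 b (ltri d e g) q.1 ** ket2 d e q.2) =
  adj (ket2 (rtri b g d) e p.2 ** ket1 b g p.1) ** (ket2 (rtri b g d) e q.2 ** ket1 b g q.1).
Proof.
move: p q => [xi eta] [xi' eta'] [/= bx ee] [/= bx' ee'].
rewrite !adj_comp -!compoA (compoA (adj (ket1 _ _ _))) ket1_gram// rho_ltri_ket2//.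
rewrite (compoA (adj (ket2 d e eta))) ket2_gram//.
rewrite (compoA (adj (ket2 _ _ _))) ket2_gram// rho_rtri_ket1// compoA ket1_gram//.
by rewrite comm.
Qed.

Lemma assocE xi eta : b xi -> e eta ->
  assoc b g d e ** ket2 (rtri b g d) e eta ** ket1 b g xi =
  ket1 b (ltri d e g) xi ** ket2 d e eta.
Proof.
move=> bx ee; have [W WE] := lift_isometry dP gramP.
have WE' xi' eta' : b xi' -> e eta' ->
    W ** ket2 (rtri b g d) e eta' ** ket1 b g xi' = ket1 b (ltri d e g) xi' ** ket2 d e eta'.
  by move=> bx' ee'; rewrite -compoA (WE (xi', eta')).
exact: (@xget_prop _ 0 [set W : bop (rtensor (rtri b g d) e) (rtensor b (ltri d e g)) |
  forall xi eta, b xi -> e eta ->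
    W ** ket2 (rtri b g d) e eta ** ket1 b g xi =
    ket1 b (ltri d e g) xi ** ket2 d e eta] (ex_intro _ W WE') xi eta bx ee).
Qed.

Lemma assoc_isometry : adj (assoc b g d e) ** assoc b g d e = opid _.
Proof.
apply: (dense_ext dP) => _ [q Pq <-]; apply: (dense_cancel dP) => _ [p Pp <-].
have aE r : P r -> assoc b g d e ** (ket2 (rtri b g d) e r.2 ** ket1 b g r.1) =
    ket1 b (ltri d e g) r.1 ** ket2 d e r.2.
  by move=> [br er]; rewrite compoA assocE.
rewrite -(compoA (adj (assoc _ _ _ _))) aE// compoA -adj_comp aE// comp1o.
exact: gramP.
Qed.

Lemma assoc_bra xi eta : b xi -> e eta ->
  adj (ket1 b (ltri d e g) xi) ** assoc b g d e ** ket2 (rtri b g d) e eta =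
  ket2 d e eta ** adj (ket1 b g xi).
Proof.
move=> bx ee; apply: (dense_ext (ket1_dense bg)) => _ [xi' bx' <-].
rewrite -!compoA (compoA (assoc _ _ _ _)) assocE// compoA ket1_gram//.
by rewrite rho_ltri_ket2// ket1_gram.
Qed.

End Assoc.

Section Sigma23.
Variables (H : hilbert R) (bhat alpha beta : set (bop K0 H)).
Hypotheses (ha : rt_ok bhat alpha) (ab : rt_ok alpha beta).
Hypotheses (la : rt_ok (ltri alpha beta bhat) alpha) (lb : rt_ok (ltri bhat alpha alpha) beta).
Hypothesis comm : forall xi xi' eta eta', beta xi -> beta xi' -> alpha eta -> alpha eta' ->
  rho alpha (adj xi ** xi') ** rho bhat (adj eta ** eta') =
  rho bhat (adj eta ** eta') ** rho alpha (adj xi ** xi').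

Let P : set (bop K0 H * bop K0 H) := [set p | beta p.1 /\ alpha p.2].

Let rl xi eta eta' : beta xi -> alpha eta -> alpha eta' ->
  rho (ltri alpha beta bhat) (adj eta ** eta') ** ket2 alpha beta xi =
  ket2 alpha beta xi ** rho bhat (adj eta ** eta').
Proof.
move=> bx ae ae'; have [dl _ _] := la; have [dh _ _] := ha.
apply: rho_intertwine => //; [exact: (rho_ok_l ha)|exact: (rho_ok_l la)|].
by move=> zeta dz; exact: sub_ltri.
Qed.

Let rl' xi xi' eta : beta xi -> beta xi' -> alpha eta ->
  rho (ltri bhat alpha alpha) (adj xi ** xi') ** ket2 bhat alpha eta =
  ket2 bhat alpha eta ** rho alpha (adj xi ** xi').
Proof.
move=> bx bx' ae; have [dl _ _] := lb; have [da _ _] := ab.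
apply: rho_intertwine => //; [exact: (rho_ok_l ab)|exact: (rho_ok_l lb)|].
by move=> zeta dz; exact: sub_ltri.
Qed.

Lemma sigma23E xi eta : beta xi -> alpha eta ->
  sigma23 bhat alpha beta ** ket2 (ltri alpha beta bhat) alpha eta ** ket2 alpha beta xi =
  ket2 (ltri bhat alpha alpha) beta xi ** ket2 bhat alpha eta.
Proof.
move=> bx ae.
have dP : dense_range ((fun p => ket2 (ltri alpha beta bhat) alpha p.2 ** ket2 alpha beta p.1) @` P).
  apply: (sub_dense (dense_comp (ket2_dense ab) (ket2_dense la))) => _ [_ [_ [y ee <-] [_ [x bx' <-] <-]] [z _ <-]].
  by apply: sub_cspan; exists (ket2 (ltri alpha beta bhat) alpha y ** ket2 alpha beta x);
    [exists (x, y)|exists z].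
have [|W WE] := @lift_isometry _ _ _ _ _ _ _
  (fun p => ket2 (ltri bhat alpha alpha) beta p.1 ** ket2 bhat alpha p.2) dP.
  move=> [x y] [x' y'] [/= bx1 ay] [/= bx' ay'].
  rewrite !adj_comp -!compoA (compoA (adj (ket2 (ltri bhat alpha alpha) _ _))) ket2_gram// rl'//.
  rewrite (compoA (adj (ket2 bhat alpha y))) ket2_gram//.
  rewrite (compoA (adj (ket2 _ alpha _))) ket2_gram// rl// compoA ket2_gram//.
  by rewrite comm.
have WE' x y : beta x -> alpha y ->
    W ** ket2 (ltri alpha beta bhat) alpha y ** ket2 alpha beta x =
    ket2 (ltri bhat alpha alpha) beta x ** ket2 bhat alpha y.
  by move=> bx' ay'; rewrite -compoA (WE (x, y)).
exact: (@xget_prop _ 0 [set W : bop (rtensor (ltri alpha beta bhat) alpha)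
    (rtensor (ltri bhat alpha alpha) beta) | forall xi eta, beta xi -> alpha eta ->
    W ** ket2 (ltri alpha beta bhat) alpha eta ** ket2 alpha beta xi =
    ket2 (ltri bhat alpha alpha) beta xi ** ket2 bhat alpha eta] (ex_intro _ W WE') xi eta bx ae).
Qed.

Lemma sigma23_bra xi eta : beta xi -> alpha eta ->
  adj (ket2 (ltri bhat alpha alpha) beta xi) ** sigma23 bhat alpha beta **
    ket2 (ltri alpha beta bhat) alpha eta =
  ket2 bhat alpha eta ** adj (ket2 alpha beta xi).
Proof.
move=> bx ae; apply: (dense_ext (ket2_dense ab)) => _ [xi' bx' <-].
rewrite -!compoA (compoA (sigma23 _ _ _)) sigma23E// compoA ket2_gram//.
by rewrite rl'// ket2_gram.
Qed.

End Sigma23.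

End TensorOps.

Section TensorOps2.
Variables (R : realType) (K0 : hilbert R).
Implicit Types H K L : hilbert R.

Lemma opl_le H H' K (b : set (bop K0 H)) (b' : set (bop K0 H')) (g : set (bop K0 K))
    (S : bop H H') : rt_ok b g -> rt_ok b' g -> opl_ok b b' g S ->
  `|opl b b' g S| <= `|S|.
Proof.
move=> bg bg' Sok.
have [|W WE WS] := @lift_intertwine R _ g H H' _ _ (ket2 b g) (ket2 b' g) S (ket2_dense bg).
  by move=> i j gi gj; rewrite !ket2_gram// Sok.
by rewrite (opl_uniq bg WE).
Qed.

Lemma opr_le H K K' (b : set (bop K0 H)) (g : set (bop K0 K)) (g' : set (bop K0 K'))
    (T : bop K K') : rt_ok b g -> rt_ok b g' -> opr_ok b g g' T ->
  `|opr b g g' T| <= `|T|.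
Proof.
move=> bg bg' Tok.
have [|W WE WS] := @lift_intertwine R _ b K K' _ _ (ket1 b g) (ket1 b g') T (ket1_dense bg).
  by move=> i j gi gj; rewrite !ket1_gram// Tok.
by rewrite (opr_uniq bg WE).
Qed.

Lemma opl_lin H H' K (b : set (bop K0 H)) (b' : set (bop K0 H')) (g : set (bop K0 K))
    a (S T : bop H H') : rt_ok b g -> rt_ok b' g -> opl_ok b b' g S -> opl_ok b b' g T ->
  opl b b' g (a *: S + T) = a *: opl b b' g S + opl b b' g T.
Proof.
move=> bg bg' Sok Tok; apply: opl_uniq => // eta ge.
by rewrite compoPl compoPr !oplE.
Qed.

Lemma opr_lin H K K' (b : set (bop K0 H)) (g : set (bop K0 K)) (g' : set (bop K0 K'))
    a (S T : bop K K') : rt_ok b g -> rt_ok b g' -> opr_ok b g g' S -> opr_ok b g g' T ->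
  opr b g g' (a *: S + T) = a *: opr b g g' S + opr b g g' T.
Proof.
move=> bg bg' Sok Tok; apply: opr_uniq => // eta ge.
by rewrite compoPl compoPr !oprE.
Qed.

Lemma rho_rtri_ket2 H K (b : set (bop K0 H)) (g d : set (bop K0 K)) c eta :
  rt_ok b g -> dense_range d -> rho_ok d c -> dense_range (rtri b g d) ->
  rho_ok (rtri b g d) c -> g eta -> g (rho d c ** eta) ->
  rho (rtri b g d) c ** ket2 b g eta = ket2 b g (rho d c ** eta).
Proof.
move=> bg dd dc dr rc ge ge'; have [db _ _] := bg; apply: (dense_ext db) => xi bx.
rewrite -compoA -ket12// -[RHS]ket12// !compoA; congr (_ ** _).
by apply: rho_intertwine => // zeta dz; exact: sub_rtri.
Qed.

Lemma rho_ltri_ket1 H K (b a : set (bop K0 H)) (g : set (bop K0 K)) c xi :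
  rt_ok b g -> dense_range a -> rho_ok a c -> dense_range (ltri b g a) ->
  rho_ok (ltri b g a) c -> b xi -> b (rho a c ** xi) ->
  rho (ltri b g a) c ** ket1 b g xi = ket1 b g (rho a c ** xi).
Proof.
move=> bg dd dc dr rc ge ge'; have [_ dg _] := bg; apply: (dense_ext dg) => eta gx.
rewrite -compoA ket12// ket12// !compoA; congr (_ ** _).
by apply: rho_intertwine => // zeta dz; exact: sub_ltri.
Qed.

Section KetRho.
Variables (H K : hilbert R) (b a : set (bop K0 H)) (g d : set (bop K0 K)).
Variables (C : set (bop K0 K0)) (c : bop K0 K0).
Hypothesis Cc : forall x, C x -> x ** c = c ** x.

Lemma ket1_rho xi : gram_in d C -> gram_in (rtri b g d) C -> b xi ->
  rho (rtri b g d) c ** ket1 b g xi = ket1 b g xi ** rho d c.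
Proof.
move=> gd gr bx; have [dd _] := gd; have [dr _] := gr.
by apply: rho_intertwine => //; [exact: gram_rho_ok gd Cc|exact: gram_rho_ok gr Cc|move=> *; exact: sub_rtri].
Qed.

Lemma bra1_rho xi : gram_in d C -> gram_in (rtri b g d) C -> b xi ->
  adj (ket1 b g xi) ** rho (rtri b g d) c = rho d c ** adj (ket1 b g xi).
Proof.
move=> gd gr bx; have [dd _] := gd; have [dr _] := gr.
by apply: rho_intertwine_adj => //; [exact: gram_rho_ok gd Cc|exact: gram_rho_ok gr Cc|move=> *; exact: sub_rtri].
Qed.

Lemma ket2_rho eta : gram_in a C -> gram_in (ltri b g a) C -> g eta ->
  rho (ltri b g a) c ** ket2 b g eta = ket2 b g eta ** rho a c.
Proof.
move=> gd gr bx; have [dd _] := gd; have [dr _] := gr.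
by apply: rho_intertwine => //; [exact: gram_rho_ok gd Cc|exact: gram_rho_ok gr Cc|move=> *; exact: sub_ltri].
Qed.

Lemma bra2_rho eta : gram_in a C -> gram_in (ltri b g a) C -> g eta ->
  adj (ket2 b g eta) ** rho (ltri b g a) c = rho a c ** adj (ket2 b g eta).
Proof.
move=> gd gr bx; have [dd _] := gd; have [dr _] := gr.
by apply: rho_intertwine_adj => //; [exact: gram_rho_ok gd Cc|exact: gram_rho_ok gr Cc|move=> *; exact: sub_ltri].
Qed.

End KetRho.

End TensorOps2.

(** * The pentagon equation on slices *)

Section Module.
Variables (R : realType) (B : cbase R) (H : hilbert R) (a : set (bop (cK B) H)).

Lemma cmodule_gram : @is_cmodule R B H a -> gram_in a (cB B).
Proof.
move=> [_ da _ <-]; split=> // x y ax ay; apply: sub_cspan.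
by exists (adj x); [exists x|exists y].
Qed.

Lemma rho_stableE L (a' : set (bop L H)) c xi : @rho_stable R B H L a a' ->
  cBd B c -> a' xi -> a' (rho a c ** xi).
Proof.
move=> st Bc ax; rewrite -st; apply: sub_cspan.
by exists (rho a c); [exists c|exists xi].
Qed.

End Module.

Section PseudoMultiplicative.
Variables (R : realType) (B : cbase R) (H : hilbert R).
Variables (bhat alpha beta : set (bop (cK B) H)).
Variable V : bop (rtensor bhat alpha) (rtensor alpha beta).
Hypothesis HV : is_pmu V.

Lemma cB_closed : closed_subspace (cB B). Proof. by have [] := cB_cstar B. Qed.
Lemma cBd_closed : closed_subspace (cBd B). Proof. by have [] := cBd_cstar B. Qed.

Lemma gram_bhat : gram_in bhat (cBd B).
Proof. by have [[]] := pmu_module HV => /(@cmodule_gram _ (dag B)). Qed.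
Lemma gram_alpha : gram_in alpha (cB B).
Proof. by have [[_ /cmodule_gram]] := pmu_module HV. Qed.
Lemma gram_beta : gram_in beta (cBd B).
Proof. by have [[_ _ /(@cmodule_gram _ (dag B))]] := pmu_module HV. Qed.

Lemma stab_bhat_alpha c xi : cB B c -> alpha xi -> alpha (rho bhat c ** xi).
Proof. have [_ [h _] _ _] := pmu_module HV; exact: (@rho_stableE _ (dag B)). Qed.
Lemma stab_bhat_beta c xi : cB B c -> beta xi -> beta (rho bhat c ** xi).
Proof. have [_ [_ h] _ _] := pmu_module HV; exact: (@rho_stableE _ (dag B)). Qed.
Lemma stab_alpha_bhat c xi : cBd B c -> bhat xi -> bhat (rho alpha c ** xi).
Proof. have [_ _ [h _] _] := pmu_module HV; exact: (@rho_stableE _ B). Qed.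
Lemma stab_alpha_beta c xi : cBd B c -> beta xi -> beta (rho alpha c ** xi).
Proof. have [_ _ [_ h] _] := pmu_module HV; exact: (@rho_stableE _ B). Qed.
Lemma stab_beta_bhat c xi : cB B c -> bhat xi -> bhat (rho beta c ** xi).
Proof. have [_ _ _ [h _]] := pmu_module HV; exact: (@rho_stableE _ (dag B)). Qed.
Lemma stab_beta_alpha c xi : cB B c -> alpha xi -> alpha (rho beta c ** xi).
Proof. have [_ _ _ [_ h]] := pmu_module HV; exact: (@rho_stableE _ (dag B)). Qed.

Lemma rho_ok_B L (a : set (bop (cK B) L)) c : gram_in a (cBd B) -> cB B c -> rho_ok a c.
Proof. by move=> ga Bc; apply: gram_rho_ok ga _ => d Bd; rewrite (cBBd Bc Bd). Qed.
Lemma rho_ok_Bd L (a : set (bop (cK B) L)) c : gram_in a (cB B) -> cBd B c -> rho_ok a c.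
Proof. by move=> ga Bc; apply: gram_rho_ok ga _ => d Bd; rewrite (cBBd Bd Bc). Qed.

Lemma ok_BdB L L' (a : set (bop (cK B) L)) (a' : set (bop (cK B) L')) :
  gram_in a (cBd B) -> gram_in a' (cB B) -> rt_ok a a'.
Proof. by move=> ga ga'; apply: gram_rt_ok ga ga' _ => c c' Bd Bc; rewrite (cBBd Bc Bd). Qed.
Lemma ok_BBd L L' (a : set (bop (cK B) L)) (a' : set (bop (cK B) L')) :
  gram_in a (cB B) -> gram_in a' (cBd B) -> rt_ok a a'.
Proof. by move=> ga ga'; apply/rt_ok_sym/ok_BdB. Qed.

Let gh := gram_bhat.
Let ga := gram_alpha.
Let gb := gram_beta.
Let ok_ha := ok_BdB gh ga.
Let ok_ab := ok_BBd ga gb.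
Let ok_ba := ok_BdB gb ga.

Let Bip (x y : bop (cK B) H) : alpha x -> alpha y -> cB B (adj x ** y).
Proof. by have [_] := ga; apply. Qed.
Let Bdip (x y : bop (cK B) H) : beta x -> beta y -> cBd B (adj x ** y).
Proof. by have [_] := gb; apply. Qed.
Let Bdiph (x y : bop (cK B) H) : bhat x -> bhat y -> cBd B (adj x ** y).
Proof. by have [_] := gh; apply. Qed.

Let g_hah : gram_in (rtri bhat alpha bhat) (cBd B).
Proof. by apply: gram_rtri => // [|*]; [exact: cBd_closed|apply: stab_alpha_bhat => //; exact: Bdiph]. Qed.
Let g_abh : gram_in (rtri alpha beta bhat) (cBd B).
Proof. by apply: gram_rtri => // [|*]; [exact: cBd_closed|apply: stab_beta_bhat => //; exact: Bip]. Qed.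
Let g_lhab : gram_in (ltri bhat alpha beta) (cBd B).
Proof. by apply: gram_ltri => // [|*]; [exact: cBd_closed|apply: stab_bhat_beta => //; exact: Bip]. Qed.
Let g_labb : gram_in (ltri alpha beta beta) (cBd B).
Proof. by apply: gram_ltri => // [|*]; [exact: cBd_closed|apply: stab_alpha_beta => //; exact: Bdip]. Qed.
Let g_lhaa : gram_in (ltri bhat alpha alpha) (cB B).
Proof. by apply: gram_ltri => // [|*]; [exact: cB_closed|apply: stab_bhat_alpha => //; exact: Bip]. Qed.
Let g_aba : gram_in (rtri alpha beta alpha) (cB B).
Proof. by apply: gram_rtri => // [|*]; [exact: cB_closed|apply: stab_beta_alpha => //; exact: Bip]. Qed.
Let g_lbaa : gram_in (ltri beta alpha alpha) (cB B).
Proof. by apply: gram_ltri => // [|*]; [exact: cB_closed|apply: stab_beta_alpha => //; exact: Bip]. Qed.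
Let g_hab : gram_in (rtri bhat alpha beta) (cBd B).
Proof. by apply: gram_rtri => // [|*]; [exact: cBd_closed|apply: stab_alpha_beta => //; exact: Bdiph]. Qed.
Let g_labh : gram_in (ltri alpha beta bhat) (cBd B).
Proof. by apply: gram_ltri => // [|*]; [exact: cBd_closed|apply: stab_alpha_bhat => //; exact: Bdip]. Qed.

Let VK : adj V ** V = opid _. Proof. by have [] := pmu_unitary HV. Qed.
Let KV : V ** adj V = opid _. Proof. by have [] := pmu_unitary HV. Qed.

Let V_sub (M : set (bop (cK B) (rtensor bhat alpha))) (M' : set (bop (cK B) (rtensor alpha beta))) x :
  mulset [set V] M = M' -> M x -> M' (V ** x).
Proof. by move=> <- Mx; exists V => //; exists x. Qed.

Let V_lhaa c : cBd B c -> rho (rtri alpha beta alpha) c ** V = V ** rho (ltri bhat alpha alpha) c.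
Proof.
move=> Bc; have [d _] := g_lhaa; have [d' _] := g_aba.
apply: rho_intertwine => //; [exact: rho_ok_Bd|exact: rho_ok_Bd|].
by move=> x; apply: V_sub; exact: pmu_alpha_alpha HV.
Qed.
Let V_hab c : cB B c -> rho (ltri alpha beta bhat) c ** V = V ** rho (rtri bhat alpha beta) c.
Proof.
move=> Bc; have [d _] := g_hab; have [d' _] := g_labh.
apply: rho_intertwine => //; [exact: rho_ok_B|exact: rho_ok_B|].
by move=> x; apply: V_sub; exact: pmu_bhat_beta HV.
Qed.
Let V_hah c : cB B c -> rho (rtri alpha beta bhat) c ** V = V ** rho (rtri bhat alpha bhat) c.
Proof.
move=> Bc; have [d _] := g_hah; have [d' _] := g_abh.
apply: rho_intertwine => //; [exact: rho_ok_B|exact: rho_ok_B|].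
by move=> x; apply: V_sub; exact: pmu_bhat_bhat HV.
Qed.
Let V_lhab c : cB B c -> rho (ltri alpha beta beta) c ** V = V ** rho (ltri bhat alpha beta) c.
Proof.
move=> Bc; have [d _] := g_lhab; have [d' _] := g_labb.
apply: rho_intertwine => //; [exact: rho_ok_B|exact: rho_ok_B|].
by move=> x; apply: V_sub; exact: pmu_beta_alpha HV.
Qed.

Let V_adj (S : bop (rtensor alpha beta) (rtensor alpha beta)) T : S ** V = V ** T -> adj V ** S = T ** adj V.
Proof.
by move=> h; rewrite -[S]compo1 -KV (compoA S) h -compoA (compoA (adj V)) VK comp1o.
Qed.

Let commB c : cB B c -> forall x, cBd B x -> x ** c = c ** x.
Proof. by move=> Bc x Bx; rewrite (cBBd Bc Bx). Qed.
Let commBd c : cBd B c -> forall x, cB B x -> x ** c = c ** x.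
Proof. by move=> Bc x Bx; rewrite (cBBd Bx Bc). Qed.

Definition pi1 e z : bop H H := adj (ket1 alpha beta e) ** V ** ket1 bhat alpha z.
Definition hatpi1 xi eta : bop H H := adj (ket2 alpha beta xi) ** V ** ket2 bhat alpha eta.

Lemma pi1_rho_bhat e z c : alpha e -> bhat z -> cB B c ->
  pi1 e z ** rho bhat c = rho bhat c ** pi1 e z.
Proof.
move=> ae bz Bc; rewrite /pi1 !compoA -(bra1_rho (commB Bc) gh g_abh)//.
rewrite -!compoA (compoA (rho _ _) V) V_hah// -!compoA; do 2!congr (_ ** _).
by rewrite (ket1_rho (commB Bc) gh g_hah).
Qed.

Lemma hatpi1_rho_beta xi eta c : beta xi -> alpha eta -> cB B c ->
  hatpi1 xi eta ** rho beta c = rho beta c ** hatpi1 xi eta.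
Proof.
move=> bx ae Bc; rewrite /hatpi1 !compoA -(bra2_rho (commB Bc) gb g_labb)//.
rewrite -!compoA (compoA (rho _ _) V) V_lhab// -!compoA; do 2!congr (_ ** _).
by rewrite (ket2_rho (commB Bc) gb g_lhab).
Qed.

Lemma mixed_rho_alpha e eta c : alpha e -> alpha eta -> cBd B c ->
  adj (ket1 alpha beta e) ** V ** ket2 bhat alpha eta ** rho alpha c =
  rho alpha c ** (adj (ket1 alpha beta e) ** V ** ket2 bhat alpha eta).
Proof.
move=> ae aee Bc; rewrite !compoA -(bra1_rho (commBd Bc) ga g_aba)//.
rewrite -!compoA (compoA (rho _ _) V) V_lhaa// -!compoA; do 2!congr (_ ** _).
by rewrite (ket2_rho (commBd Bc) ga g_lhaa).
Qed.

Lemma mixed_rho_beta xi z c : beta xi -> bhat z -> cB B c ->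
  adj (ket2 alpha beta xi) ** V ** ket1 bhat alpha z ** rho beta c =
  rho bhat c ** (adj (ket2 alpha beta xi) ** V ** ket1 bhat alpha z).
Proof.
move=> bx bz Bc; rewrite !compoA -(bra2_rho (commB Bc) gh g_labh)//.
rewrite -!compoA (compoA (rho _ _) V) V_hab// -!compoA; do 2!congr (_ ** _).
by rewrite (ket1_rho (commB Bc) gb g_hab).
Qed.

Lemma pi1_dom e z : alpha e -> bhat z -> dom bhat (pi1 e z).
Proof. by move=> ae bz _ [c Bc <-]; rewrite pi1_rho_bhat. Qed.

Lemma hatpi1_hatdom xi eta : beta xi -> alpha eta -> hatdom beta (hatpi1 xi eta).
Proof. by move=> bx ae _ [c Bc <-]; rewrite hatpi1_rho_beta. Qed.

Lemma dom_opl x : dom bhat x -> opl_ok bhat bhat alpha x.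
Proof. by move=> dx e e' ae ae'; rewrite dx//; exists (adj e ** e') => //; exact: Bip. Qed.

Lemma hatdom_opr y : hatdom beta y -> opr_ok alpha beta beta y.
Proof. by move=> dx e e' ae ae'; rewrite dx//; exists (adj e ** e') => //; exact: Bip. Qed.

Lemma Delta_dom2 x : dom bhat x -> @dom2 _ B H bhat alpha beta (Delta V x).
Proof.
move=> dx _ [c Bc [c' Bc' <-]]; have xo := dom_opl dx.
have [dl _] := g_labh; have [dr _] := g_abh; have [dh _] := gh; have [db _] := gb.
have [dhb _] := g_hab; have [dhh _] := g_hah.
rewrite (opl_rho ok_ab dh (rho_ok_B gh Bc) dl (rho_ok_B g_labh Bc)).
rewrite (opr_rho ok_ab dh (rho_ok_B gh Bc') dr (rho_ok_B g_abh Bc')).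
have comx (d : set (bop (cK B) H)) a : cB B a -> gram_in d (cBd B) ->
    gram_in (rtri bhat alpha d) (cBd B) ->
    (forall eta, alpha eta -> alpha (rho d a ** eta)) ->
    opl bhat bhat alpha x ** rho (rtri bhat alpha d) a =
    rho (rtri bhat alpha d) a ** opl bhat bhat alpha x.
  move=> Ba gd gr st; have [dd _] := gd; have [ddr _] := gr.
  apply: (dense_ext (ket2_dense ok_ha)) => _ [eta ae <-].
  have kE : rho (rtri bhat alpha d) a ** ket2 bhat alpha eta = ket2 bhat alpha (rho d a ** eta).
    by apply: rho_rtri_ket2 => //; [exact: rho_ok_B|exact: rho_ok_B|exact: st].
  rewrite -compoA kE oplE//; last exact: st.
  by rewrite -compoA oplE// compoA kE.
have c1 := comx beta c Bc gb g_hab (fun eta => stab_beta_alpha Bc).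
have c2 := comx bhat c' Bc' gh g_hah (fun eta => stab_bhat_alpha Bc').
have com (T : bop (rtensor alpha beta) (rtensor alpha beta)) T' : T ** V = V ** T' ->
    opl bhat bhat alpha x ** T' = T' ** opl bhat bhat alpha x ->
    Delta V x ** T = T ** Delta V x.
  move=> TV Tx; rewrite /Delta -!compoA (V_adj TV) (compoA (opl _ _ _ _)) Tx.
  by rewrite -!compoA (compoA V) -TV -!compoA.
have e1 := com _ _ (V_hab Bc) c1; have e2 := com _ _ (V_hah Bc') c2.
by rewrite compoA e1 -[LHS]compoA e2 compoA.
Qed.

Lemma hatDelta_hatdom2 y : hatdom beta y -> @hatdom2 _ B H bhat alpha beta (hatDelta V y).
Proof.
move=> dy _ [c Bc [c' Bc' <-]]; have yo := hatdom_opr dy.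
have [dl _] := g_lhab; have [dr _] := g_hab; have [dh _] := gh; have [db _] := gb.
have [dlb _] := g_labb; have [dlh _] := g_labh.
rewrite (opl_rho ok_ha db (rho_ok_B gb Bc) dl (rho_ok_B g_lhab Bc)).
rewrite (opr_rho ok_ha db (rho_ok_B gb Bc') dr (rho_ok_B g_hab Bc')).
have comy (a : set (bop (cK B) H)) d : cB B d -> gram_in a (cBd B) ->
    gram_in (ltri alpha beta a) (cBd B) ->
    (forall eta, alpha eta -> alpha (rho a d ** eta)) ->
    opr alpha beta beta y ** rho (ltri alpha beta a) d =
    rho (ltri alpha beta a) d ** opr alpha beta beta y.
  move=> Bd gd gr st; have [dd _] := gd; have [ddr _] := gr.
  apply: (dense_ext (ket1_dense ok_ab)) => _ [eta ae <-].
  have kE : rho (ltri alpha beta a) d ** ket1 alpha beta eta = ket1 alpha beta (rho a d ** eta).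
    by apply: rho_ltri_ket1 => //; [exact: rho_ok_B|exact: rho_ok_B|exact: st].
  rewrite -compoA kE oprE//; last exact: st.
  by rewrite -compoA oprE// compoA kE.
have c1 := comy beta c Bc gb g_labb (fun eta => stab_beta_alpha Bc).
have c2 := comy bhat c' Bc' gh g_labh (fun eta => stab_bhat_alpha Bc').
have com T (T' : bop (rtensor bhat alpha) (rtensor bhat alpha)) : T ** V = V ** T' ->
    opr alpha beta beta y ** T = T ** opr alpha beta beta y ->
    hatDelta V y ** T' = T' ** hatDelta V y.
  move=> TV Ty; rewrite /hatDelta -!compoA -TV (compoA (opr _ _ _ _)) Ty.
  by rewrite -!compoA (compoA (adj V)) (V_adj TV) -!compoA.
have e1 := com _ _ (V_lhab Bc) c1; have e2 := com _ _ (V_hab Bc') c2.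
by rewrite compoA e1 -[LHS]compoA e2 compoA.
Qed.

Let rho_comm (a a' : set (bop (cK B) H)) c c' : dense_range a' -> rho_ok a' c' ->
  (forall xi, a' xi -> a' (rho a c ** xi)) ->
  rho a c ** rho a' c' = rho a' c' ** rho a c.
Proof. by move=> da ac st; apply/esym/rho_intertwine. Qed.

Let C_alpha_bhat c c' : cBd B c -> cB B c' ->
  rho alpha c ** rho bhat c' = rho bhat c' ** rho alpha c.
Proof.
move=> Bc Bc'; have [d _] := gh; apply: rho_comm => //; first exact: rho_ok_B.
by move=> xi; apply: stab_alpha_bhat.
Qed.

Let C_alpha_beta c c' : cBd B c -> cB B c' ->
  rho alpha c ** rho beta c' = rho beta c' ** rho alpha c.
Proof.
move=> Bc Bc'; have [d _] := gb; apply: rho_comm => //; first exact: rho_ok_B.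
by move=> xi; apply: stab_alpha_beta.
Qed.

Let C_beta_bhat c c' : cB B c -> cB B c' ->
  rho beta c ** rho bhat c' = rho bhat c' ** rho beta c.
Proof.
move=> Bc Bc'; have [d _] := gh; apply: rho_comm => //; first exact: rho_ok_B.
by move=> xi; apply: stab_beta_bhat.
Qed.

Let o1 := ok_BdB g_hah ga.
Let o2 := ok_BdB g_abh ga.
Let o3 := ok_BBd ga g_lhab.
Let o4 := ok_BBd ga g_labb.
Let o5 := ok_BdB gh g_lhaa.
Let o6 := ok_BdB gh g_aba.
Let o7 := ok_BBd g_lhaa gb.
Let o8 := ok_BBd g_aba gb.
Let o9 := ok_BdB gh g_lbaa.
Let o10 := ok_BdB g_hab ga.
Let o11 := ok_BdB g_labh ga.

Let k1 : opl_ok (rtri bhat alpha bhat) (rtri alpha beta bhat) alpha V.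
Proof. by move=> *; apply: V_hah; exact: Bip. Qed.
Let k2 : opr_ok alpha (ltri bhat alpha beta) (ltri alpha beta beta) V.
Proof. by move=> *; apply: V_lhab; exact: Bip. Qed.
Let k3 : opl_ok (ltri bhat alpha alpha) (rtri alpha beta alpha) beta V.
Proof. by move=> *; apply: V_lhaa; exact: Bdip. Qed.
Let k4 : opr_ok bhat (ltri bhat alpha alpha) (rtri alpha beta alpha) V.
Proof. by move=> *; apply: V_lhaa; exact: Bdiph. Qed.
Let k5 : opl_ok (rtri bhat alpha beta) (ltri alpha beta bhat) alpha V.
Proof. by move=> *; apply: V_hab; exact: Bip. Qed.
Let k6 : opr_ok bhat (rtri alpha beta alpha) (ltri beta alpha alpha) (flip alpha beta).
Proof.
move=> x y hx hy; have Bc := Bdiph hx hy.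
apply: (dense_ext (ket1_dense ok_ab)) => _ [e ae <-].
rewrite -compoA flipE1// (ket2_rho (commBd Bc) ga g_lbaa)//.
by rewrite -compoA (ket1_rho (commBd Bc) ga g_aba)// compoA flipE1.
Qed.

Let as_hah z eta : bhat z -> alpha eta ->
  ket1 bhat (ltri bhat alpha alpha) z ** ket2 bhat alpha eta =
  assoc bhat alpha bhat alpha ** ket2 (rtri bhat alpha bhat) alpha eta ** ket1 bhat alpha z.
Proof.
move=> bz ae; apply/esym/assocE => // x x' y y' hx hx' ay ay'.
by apply: C_alpha_bhat; [exact: Bdiph|exact: Bip].
Qed.

Let as_abha e eta : alpha e -> alpha eta ->
  assoc alpha beta bhat alpha ** ket2 (rtri alpha beta bhat) alpha eta ** ket1 alpha beta e =
  ket1 alpha (ltri bhat alpha beta) e ** ket2 bhat alpha eta.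
Proof.
move=> ae ae'; apply: assocE => // x x' y y' hx hx' ay ay'.
by apply: C_beta_bhat; exact: Bip.
Qed.

Let as_abha_bra e eta : alpha e -> alpha eta ->
  adj (ket1 alpha (ltri bhat alpha beta) e) ** assoc alpha beta bhat alpha **
    ket2 (rtri alpha beta bhat) alpha eta =
  ket2 bhat alpha eta ** adj (ket1 alpha beta e).
Proof.
move=> ae ae'; apply: assoc_bra => // x x' y y' hx hx' ay ay'.
by apply: C_beta_bhat; exact: Bip.
Qed.

Let C_beta_alpha : forall x x' y y' : bop (cK B) H, alpha x -> alpha x' -> beta y -> beta y' ->
  rho beta (adj x ** x') ** rho alpha (adj y ** y') = rho alpha (adj y ** y') ** rho beta (adj x ** x').
Proof.
by move=> x x' y y' ? ? ? ?; apply/esym/C_alpha_beta; [exact: Bdip|exact: Bip].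
Qed.

Let as_abab_bra e xi : alpha e -> beta xi ->
  adj (ket1 alpha (ltri alpha beta beta) e) ** assoc alpha beta alpha beta **
    ket2 (rtri alpha beta alpha) beta xi =
  ket2 alpha beta xi ** adj (ket1 alpha beta e).
Proof. by move=> ae bx; exact: assoc_bra. Qed.

Let as_abab_iso : adj (assoc alpha beta alpha beta) ** assoc alpha beta alpha beta = opid _.
Proof. exact: assoc_isometry. Qed.

Let sg xi eta : beta xi -> alpha eta ->
  sigma23 bhat alpha beta ** ket2 (ltri alpha beta bhat) alpha eta ** ket2 alpha beta xi =
  ket2 (ltri bhat alpha alpha) beta xi ** ket2 bhat alpha eta.
Proof.
move=> bx ae; apply: sigma23E => // x x' y y' hx hx' ay ay'.
by apply: C_alpha_bhat; [exact: Bdip|exact: Bip].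
Qed.

Let sg_bra xi eta : beta xi -> alpha eta ->
  adj (ket2 (ltri bhat alpha alpha) beta xi) ** sigma23 bhat alpha beta **
    ket2 (ltri alpha beta bhat) alpha eta =
  ket2 bhat alpha eta ** adj (ket2 alpha beta xi).
Proof.
move=> bx ae; apply: sigma23_bra => // x x' y y' hx hx' ay ay'.
by apply: C_alpha_bhat; [exact: Bdip|exact: Bip].
Qed.

Lemma V13E z eta : bhat z -> alpha eta ->
  V13 V ** ket1 bhat (rtri alpha beta alpha) z ** ket1 alpha beta eta =
  sigma23 bhat alpha beta ** ket2 (ltri alpha beta bhat) alpha eta ** V ** ket1 bhat alpha z.
Proof.
move=> bz ae; rewrite /V13.
have aE : assoc bhat alpha beta alpha ** ket2 (rtri bhat alpha beta) alpha eta ** ket1 bhat alpha z =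
    ket1 bhat (ltri beta alpha alpha) z ** ket2 beta alpha eta.
  apply: assocE => // x x' y y' hx hx' ay ay'.
  by apply: C_alpha_beta; [exact: Bdiph|exact: Bip].
have aI : adj (assoc bhat alpha beta alpha) ** assoc bhat alpha beta alpha = opid _.
  apply: assoc_isometry => // x x' y y' hx hx' ay ay'.
  by apply: C_alpha_beta; [exact: Bdiph|exact: Bip].
rewrite -(compoA _ (opr _ _ _ _)) oprE// -!compoA flipE1// -aE.
rewrite -compoA (compoA (adj _)) aI comp1o (compoA (opl _ _ _ _)) oplE//.
by rewrite !compoA.
Qed.

(* The pentagon equation in the form [V_23 V_12 V_23^* = V_12 V_13], sliced at
   the first leg by [e] and [z]. *)
Lemma Delta_pi1 e z : alpha e -> bhat z ->
  Delta V (pi1 e z) =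
  adj (ket1 alpha (ltri alpha beta beta) e) ** assoc alpha beta alpha beta **
  opl (ltri bhat alpha alpha) (rtri alpha beta alpha) beta V **
  V13 V ** ket1 bhat (rtri alpha beta alpha) z.
Proof.
move=> ae bz; set T' := RHS.
have TE : V ** opl bhat bhat alpha (pi1 e z) = T' ** V.
  apply: (dense_ext (ket2_dense ok_ha)) => _ [eta aeta <-].
  rewrite -compoA oplE//; last exact/dom_opl/pi1_dom.
  rewrite /T' -(compoA _ _ V) -(oprE (xi := z) o5 o6 k4)// -!compoA as_hah//.
  have := pmu_pentagon HV; rewrite /pentagon => P.
  have := congr1 (fun S => adj (ket1 alpha (ltri alpha beta beta) e) ** S **
    ket2 (rtri bhat alpha bhat) alpha eta ** ket1 bhat alpha z) P.
  rewrite -!compoA => <-.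
  rewrite (compoA (opl _ _ _ _)) oplE// !compoA (opr_bra o3 o4 k2)//.
  rewrite -!compoA; congr (_ ** _).
  by rewrite !compoA as_abha_bra.
by rewrite /Delta TE -compoA KV compo1.
Qed.

Lemma Delta_pi1_slice xi eta xi' eta' e z :
  beta xi -> alpha eta -> beta xi' -> alpha eta' -> alpha e -> bhat z ->
  adj xi ** adj (ket2 alpha beta xi') ** Delta V (pi1 e z) ** ket1 alpha beta eta ** eta' =
  adj e ** (hatpi1 xi eta ** hatpi1 xi' eta') ** z.
Proof.
move=> bx aeta bx' aeta' ae bz; rewrite Delta_pi1//.
have step : adj (ket2 alpha beta xi') ** (adj (ket1 alpha (ltri alpha beta beta) e) **
    assoc alpha beta alpha beta ** opl (ltri bhat alpha alpha) (rtri alpha beta alpha) beta V **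
    sigma23 bhat alpha beta ** ket2 (ltri alpha beta bhat) alpha eta) =
    adj (ket1 alpha beta e) ** V ** ket2 bhat alpha eta ** adj (ket2 alpha beta xi').
  apply: (dense_ext (ket2_dense ok_ab)) => _ [y by_ <-].
  rewrite -!compoA (compoA (sigma23 _ _ _)) sg// (compoA (opl _ _ _ _)) oplE//.
  have := congr1 (fun S => adj (ket2 alpha beta xi') ** S ** V ** ket2 bhat alpha eta)
    (as_abab_bra ae by_).
  rewrite -!compoA => ->; rewrite !compoA ket2_gram// -!compoA ket2_gram// !compoA.
  by rewrite mixed_rho_alpha ?compoA//; exact: Bdip.
have vE := V13E bz aeta; move: (V13 V) vE => W vE.
have := congr1 (fun S => S ** eta') vE; rewrite -!compoA => ->.
move: step; rewrite -!compoA => step.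
have := congr1 (fun S => adj xi ** S ** V ** ket1 bhat alpha z ** eta') step.
rewrite -!compoA => ->; rewrite ket12// !compoA -adj_comp ket12//.
by rewrite adj_comp /hatpi1.
Qed.

(* The pentagon equation in the form [V_12^* V_23 V_12 = V_13 V_23], sliced at
   the third leg by [xi] and [k]. *)
Lemma hatDelta_hatpi1 xi k z : beta xi -> alpha k -> bhat z ->
  hatDelta V (hatpi1 xi k) ** ket1 bhat alpha z =
  adj (ket2 (ltri bhat alpha alpha) beta xi) ** V13 V ** ket1 bhat (rtri alpha beta alpha) z **
  V ** ket2 bhat alpha k.
Proof.
move=> bx ak bz; have := pmu_pentagon HV; rewrite /pentagon => P.
move: (V13 V) P => W P.
have step : adj (ket2 (rtri alpha beta alpha) beta xi) ** adj (assoc alpha beta alpha beta) **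
   opr alpha (ltri bhat alpha beta) (ltri alpha beta beta) V **
   assoc alpha beta bhat alpha ** ket2 (rtri alpha beta bhat) alpha k =
   opr alpha beta beta (hatpi1 xi k).
  apply: (dense_ext (ket1_dense ok_ab)) => _ [e ae <-].
  rewrite oprE//; last exact/hatdom_opr/hatpi1_hatdom.
  rewrite -!compoA (compoA (assoc _ _ _ _)) as_abha// (compoA (opr _ _ _ _)) oprE//.
  have := congr1 (@adj _ _ _) (as_abab_bra ae bx); rewrite !adj_comp !adjK => h.
  by rewrite /hatpi1 !compoA -h !compoA.
have e2 := congr1 (fun S => adj V ** (adj (ket2 (rtri alpha beta alpha) beta xi) **
   adj (assoc alpha beta alpha beta) ** S **
   ket2 (rtri bhat alpha bhat) alpha k ** ket1 bhat alpha z)) P.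
rewrite -!compoA (compoA (opl (rtri bhat alpha bhat) _ _ _)) oplE// -!compoA in e2.
have e1 := congr1 (fun S => adj V ** S ** V ** ket1 bhat alpha z) step.
rewrite -!compoA in e1.
rewrite /hatDelta -!compoA -e1 e2.
rewrite (compoA (adj (assoc _ _ _ _))) as_abab_iso comp1o.
rewrite (compoA (adj (ket2 (rtri _ _ _) _ _))) (opl_bra o7 o8 k3)//.
rewrite -!compoA (compoA (adj V)) VK comp1o; do 2!congr (_ ** _).
rewrite (compoA (assoc _ _ _ _)) -as_hah// compoA oprE//.
by rewrite !compoA.
Qed.

Lemma hatDelta_hatpi1_slice eta z eta' z' xi k :
  alpha eta -> bhat z -> alpha eta' -> bhat z' -> beta xi -> alpha k ->
  adj eta ** adj (ket2 bhat alpha eta') ** hatDelta V (hatpi1 xi k) ** ket1 bhat alpha z ** z' =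
  adj xi ** (pi1 eta z ** pi1 eta' z') ** k.
Proof.
move=> ae bz ae' bz' bx ak.
rewrite -(compoA _ _ (ket1 bhat alpha z)) hatDelta_hatpi1//.
have vE y (ay : alpha y) := V13E bz ay; move: (V13 V) vE => W vE.
have step : adj (ket2 bhat alpha eta') ** (adj (ket2 (ltri bhat alpha alpha) beta xi) **
    W ** ket1 bhat (rtri alpha beta alpha) z) =
    adj (ket2 alpha beta xi) ** V ** ket1 bhat alpha z ** adj (ket1 alpha beta eta').
  apply: (dense_ext (ket1_dense ok_ab)) => _ [y ay <-].
  have := congr1 (fun S => adj (ket2 bhat alpha eta') **
    (adj (ket2 (ltri bhat alpha alpha) beta xi) ** S)) (vE y ay).
  rewrite -!compoA => ->.
  have := congr1 (fun S => adj (ket2 bhat alpha eta') ** S ** V ** ket1 bhat alpha z)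
    (sg_bra bx ay).
  rewrite -!compoA => ->; rewrite !compoA ket2_gram// -!compoA ket1_gram// !compoA.
  by rewrite mixed_rho_beta ?compoA//; exact: Bip.
have := congr1 (fun S => adj eta ** S ** V ** ket2 bhat alpha k ** z') step.
rewrite -!compoA => ->; rewrite -ket12// !compoA -adj_comp -ket12//.
by rewrite adj_comp /pi1.
Qed.

End PseudoMultiplicative.

(** * Square summable sequences *)

Section Limits.
Variables (R : realType).
Implicit Types E F : normedModType R[i].

Definition has_lim E (u : nat -> E) (l : E) := forall e : R[i], 0 < e ->
  exists N : nat, forall n, (N <= n)%N -> `|l - u n| <= e.

Lemma has_limP E (u : nat -> E) l : has_lim u l <-> u n @[n --> \oo] --> l.
Proof.
split=> [h|h e e0].
  apply/cvgrPdist_le => e e0; have [N hN] := h e e0.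
  by exists N => // n /= Nn; exact: hN.
have [N _ hN] : \forall n \near \oo, `|l - u n| <= e by exact: (cvgr_dist_le _ _ h).
by exists N.
Qed.

Lemma has_lim_limn E (u : nat -> E) l : has_lim u l -> limn u = l.
Proof. by move=> /has_limP; apply: cvg_lim; exact: norm_hausdorff. Qed.

Lemma has_lim_uniq E (u : nat -> E) l l' : has_lim u l -> has_lim u l' -> l = l'.
Proof. by move=> /has_lim_limn <- /has_lim_limn. Qed.

Lemma has_lim_ext E (u v : nat -> E) l : (forall n, u n = v n) -> has_lim u l -> has_lim v l.
Proof. by move=> /funext ->. Qed.

Lemma has_lim_map E F (u : nat -> E) l (f : E -> F) (M : R[i]) : 0 <= M ->
  (forall n, `|f l - f (u n)| <= M * `|l - u n|) -> has_lim u l -> has_lim (f \o u) (f l).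
Proof.
move=> M0 fM ul e e0; have M1 : 0 < M + 1 by rewrite ltr_wpDl.
have [N hN] := ul _ (divr_gt0 e0 M1); exists N => n /hN h /=.
rewrite (le_trans (fM n))// (@le_trans _ _ (M * (e / (M + 1))))// ?ler_wpM2l//.
by rewrite mulrA ler_pdivrMr// mulrC ler_wpM2l ?(ltW e0)// lerDl.
Qed.

Lemma has_limD E (u v : nat -> E) l m a : has_lim u l -> has_lim v m ->
  has_lim (fun n => a *: u n + v n) (a *: l + m).
Proof.
by move=> /has_limP ul /has_limP vm; apply/has_limP; apply: cvgD => //; exact: cvgZl_tmp.
Qed.

Lemma has_lim_le E (u : nat -> E) l (M : R[i]) : has_lim u l -> (forall n, `|u n| <= M) ->
  `|l| <= M.
Proof.
move=> ul uM; apply/ler_addgt0Pr => e e0; have [N hN] := ul e e0.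
rewrite -[l](subrK (u N)) addrC [M + e]addrC (le_trans (ler_normD _ _))// addrC lerD//.
exact: hN.
Qed.

Variables H K : hilbert R.

Lemma has_lim_ex (u : nat -> bop H K) :
  (forall e : R[i], 0 < e -> exists N : nat, forall m n, (N <= m)%N -> (m <= n)%N ->
     `|u n - u m| <= e) ->
  exists l, has_lim u l.
Proof.
move=> cu; suff /cvg_ex[l ul] : cvgn u by exists l; apply/has_limP.
apply: bop_complete; apply/cauchyP => e e0.
have e2 : 0 < e / 2 by rewrite divr_gt0.
have [N hN] := cu _ e2; exists (u N); rewrite -ball_normE; exists N => // n /= Nn.
rewrite /= distrC (@le_lt_trans _ _ (e / 2))//; first exact: hN.
by rewrite ltr_pdivrMr// ltr_pMr// ltr1n.
Qed.

End Limits.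

Section SquareSummable.
Variable R : realType.
Implicit Types H K L : hilbert R.

(* A bound on a quadratic form, unlike one on the norm of a sum of operators,
   passes to subfamilies. *)
Definition qle I (r : seq I) H L (X : I -> bop H L) (M : R[i]) :=
  forall z, \sum_(i <- r) `|X i z| ^+ 2 <= M * `|z| ^+ 2.

Lemma sum_CS I (r : seq I) H L H' L' (X : I -> bop H L) (Y : I -> bop H' L')
    (T : bop L' L) M N : 0 <= M -> 0 <= N -> qle r X (M ^+ 2) -> qle r Y (N ^+ 2) ->
  `|\sum_(i <- r) adj (X i) ** T ** Y i| <= M * N * `|T|.
Proof.
move=> M0 N0 XM YN; apply: norm_ip_le => [|x y]; first by rewrite !mulr_ge0.
pose f (u v : I -> L) := \sum_(i <- r) ip (u i) (v i).
have fP a u v w : f u (a *: v + w) = a * f u v + f u w.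
  by rewrite /f mulr_sumr -big_split; apply: eq_bigr => i _; rewrite !fctE ipP.
have fC u v : f v u = (f u v)^*.
  by rewrite /f rmorph_sum; apply: eq_bigr => i _; exact: ipC.
have f0 u : 0 <= f u u by apply: sumr_ge0 => i _; exact: ip_ge0.
have -> : ip x ((\sum_(i <- r) adj (X i) ** T ** Y i) y) =
    f (fun i => X i x) (fun i => T (Y i y)).
  by rewrite bop_sumE ip_sumr; apply: eq_bigr => i _; rewrite /= adjPr.
rewrite -(@ler_pXn2r _ 2) ?nnegrE ?mulr_ge0//.
rewrite (le_trans (semi_CS (lin := fun a u v => a *: u + v) fP fC f0 _ _))//.
have -> : (M * N * `|T| * `|x| * `|y|) ^+ 2 =
  (M ^+ 2 * `|x| ^+ 2) * (`|T| ^+ 2 * (N ^+ 2 * `|y| ^+ 2)) by ring.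
apply: ler_pM => //.
  by apply: le_trans (XM x); rewrite /f le_eqVlt; apply/orP; left; apply/eqP;
    apply: eq_bigr => i _; rewrite ip_norm.
apply: le_trans (ler_wpM2l _ (YN y)); last exact: exprn_ge0.
rewrite /f mulr_sumr; apply: ler_sum => i _; rewrite ip_norm -exprMn.
by rewrite ler_pXn2r ?nnegrE ?mulr_ge0// bop_le.
Qed.

Lemma qle_gram I (r : seq I) H L (X : I -> bop H L) :
  qle r X `|\sum_(i <- r) adj (X i) ** X i|.
Proof.
move=> z; have -> : \sum_(i <- r) `|X i z| ^+ 2 = ip z ((\sum_(i <- r) adj (X i) ** X i) z).
  by rewrite bop_sumE ip_sumr; apply: eq_bigr => i _; rewrite adj_norm2.
set A := \sum_(i <- r) _.
have A0 : 0 <= ip z (A z).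
  rewrite /A bop_sumE ip_sumr sumr_ge0// => i _; rewrite -adj_norm2 exprn_ge0//.
rewrite -[leLHS]ger0_norm// (le_trans (ip_CS _ _))// expr2 mulrA [leLHS]mulrC.
by rewrite ler_wpM2r// bop_le.
Qed.

Lemma qle_le I (r : seq I) H L (X : I -> bop H L) M N : qle r X M -> M <= N -> qle r X N.
Proof.
by move=> XM MN z; rewrite (le_trans (XM z))// ler_wpM2r// exprn_ge0.
Qed.

Lemma qle_sub (I : eqType) (r s : seq I) H L (X : I -> bop H L) M :
  uniq r -> uniq s -> {subset r <= s} -> qle s X M -> qle r X M.
Proof.
move=> ur us rs XM z; apply: le_trans (XM z).
rewrite [leRHS](bigID (mem r))/= -[leLHS]addr0 lerD//; last first.
  by apply: sumr_ge0 => i _; rewrite exprn_ge0.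
rewrite -[leRHS]big_filter le_eqVlt; apply/orP; left; apply/eqP.
apply: perm_big; apply: uniq_perm => //; first exact: filter_uniq.
by move=> i; rewrite mem_filter andbC; case: (boolP (i \in r)) => [/rs ->|]; rewrite ?andbF.
Qed.

Definition sqs H L (X : nat -> bop H L) :=
  (exists2 M : R[i], 0 <= M & forall n, qle (index_iota 0 n) X (M ^+ 2)) /\
  forall e : R[i], 0 < e -> exists N : nat, forall n, qle (index_iota N n) X (e ^+ 2).

Definition cauchy_squares H L (X : nat -> bop H L) := forall e : R[i], 0 < e ->
  exists N : nat, forall m n, (N <= m)%N ->
    `|\sum_(m <= k < n) adj (X k) ** X k| <= e.

Lemma sqsum_cauchy H K0 (a : set (bop K0 H)) eta : sqsum a eta -> cauchy_squares eta.
Proof.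
move=> [_ /cvg_ex[l /has_limP h]] e e0; have e2 : 0 < e / 2 by rewrite divr_gt0.
have [N hN] := h _ e2; exists N => m n Nm.
have [mn|nm] := leqP m n; last by rewrite big_geq ?normr0 ?(ltW e0)// ltnW.
rewrite -sub_series_geq// -(subrKA l) (le_trans (ler_normD _ _))// [leRHS]splitr.
rewrite lerD//; last exact: hN.
by rewrite distrC hN// (leq_trans Nm).
Qed.

Lemma cauchy_squares_sqs H L (X : nat -> bop H L) : cauchy_squares X -> sqs X.
Proof.
move=> cX; split; last first.
  move=> e e0; have [N hN] := cX (e ^+ 2) (exprn_gt0 _ e0); exists N => n.
  by apply: qle_le (qle_gram _ _) _; exact: hN.
have [N hN] := cX 1 ltr01.
set c := `|\sum_(0 <= k < N) adj (X k) ** X k| + 1.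
have c0 : 0 <= c by rewrite addr_ge0.
exists (sqrtC c); first by rewrite sqrtC_ge0.
move=> n; rewrite sqrtCK.
apply: (@qle_sub _ _ (index_iota 0 (maxn n N))); rewrite ?iota_uniq//.
  by move=> i; rewrite !mem_index_iota /= => h; exact: leq_trans h (leq_maxl _ _).
move=> z; rewrite (big_cat_nat (n := N))//= ?leq_maxr// /c mulrDl lerD//.
  exact: qle_gram.
exact: (qle_le (qle_gram _ X) (hN N (maxn n N) (leqnn N))).
Qed.

Lemma sqsum_sqs H K0 (a : set (bop K0 H)) eta : sqsum a eta -> sqs eta.
Proof. by move/sqsum_cauchy/cauchy_squares_sqs. Qed.

Lemma sqs_ket1 H K K0 (b : set (bop K0 H)) (g : set (bop K0 K)) xi :
  rt_ok b g -> sqsum b xi -> sqs (fun n => ket1 b g (xi n)).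
Proof.
move=> bg bxi; apply: cauchy_squares_sqs => e e0.
have [N hN] := sqsum_cauchy bxi e0; exists N => m n Nm; have [bk _] := bxi.
have [_ dg _] := bg; under eq_bigr do rewrite ket1_gram//.
rewrite rho_sum//; last by move=> i; apply: (rho_ok_r bg).
apply: le_trans (hN m n Nm); apply: (rhoP dg _).2 => eta eta' ge ge'.
rewrite compo_sumr compo_suml; apply: eq_bigr => i _; exact: (rho_ok_r bg).
Qed.

Lemma sqs_ket2 H K K0 (b : set (bop K0 H)) (g : set (bop K0 K)) eta :
  rt_ok b g -> sqsum g eta -> sqs (fun n => ket2 b g (eta n)).
Proof.
move=> bg bxi; apply: cauchy_squares_sqs => e e0.
have [N hN] := sqsum_cauchy bxi e0; exists N => m n Nm; have [bk _] := bxi.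
have [db _ _] := bg; under eq_bigr do rewrite ket2_gram//.
rewrite rho_sum//; last by move=> i; apply: (rho_ok_l bg).
apply: le_trans (hN m n Nm); apply: (rhoP db _).2 => xi xi' ge ge'.
rewrite compo_sumr compo_suml; apply: eq_bigr => i _; exact: (rho_ok_l bg).
Qed.

Definition ssum H L H' L' (X : nat -> bop H L) (Y : nat -> bop H' L') (T : bop L' L) :=
  limn (series (fun k => adj (X k) ** T ** Y k)).

Section Ssum.
Variables (H L H' L' : hilbert R) (X : nat -> bop H L) (Y : nat -> bop H' L').
Hypotheses (sX : sqs X) (sY : sqs Y).
Implicit Types T S : bop L' L.

Lemma ssumP T : has_lim (series (fun k => adj (X k) ** T ** Y k)) (ssum X Y T).
Proof.
suff [l hl] : exists l, has_lim (series (fun k => adj (X k) ** T ** Y k)) l.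
  by rewrite /ssum (has_lim_limn hl).
apply: has_lim_ex => e e0; have [_ tX] := sX; have [[M M0 bY] _] := sY.
have c0 : 0 < M * `|T| + 1 by rewrite ltr_wpDl// mulr_ge0.
have [N hN] := tX _ (divr_gt0 e0 c0); exists N => m n Nm mn.
rewrite sub_series_geq// (le_trans (sum_CS T (M := e / (M * `|T| + 1)) (N := M) _ _ _ _))//.
- by rewrite divr_ge0// ltW.
- apply: qle_sub (hN n); rewrite ?iota_uniq// => i.
  by rewrite !mem_index_iota => /andP[mi ->]; rewrite (leq_trans Nm).
- by apply: qle_sub (bY n); rewrite ?iota_uniq// => i; rewrite !mem_index_iota => /andP[].
rewrite -mulrA mulrAC ler_pdivrMr// ler_wpM2l ?(ltW e0)//.
by rewrite lerDl.
Qed.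

Lemma ssum_le : exists2 c : R[i], 0 <= c & forall T, `|ssum X Y T| <= c * `|T|.
Proof.
have [[M M0 bX] _] := sX; have [[N N0 bY] _] := sY; exists (M * N); first exact: mulr_ge0.
move=> T; apply: has_lim_le (ssumP T) _ => n; exact: sum_CS.
Qed.

Lemma ssum_lin a T S : ssum X Y (a *: T + S) = a *: ssum X Y T + ssum X Y S.
Proof.
apply: has_lim_uniq (ssumP _) _.
apply: has_lim_ext (has_limD a (ssumP T) (ssumP S)) => n.
rewrite /series/= scaler_sumr -big_split; apply: eq_bigr => i _ /=.
by rewrite compoPr compoPl.
Qed.

Lemma ssum_sum I (r : seq I) (P : pred I) (T : I -> bop L' L) :
  ssum X Y (\sum_(i <- r | P i) T i) = \sum_(i <- r | P i) ssum X Y (T i).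
Proof.
have s0 : ssum X Y 0 = 0.
  by have := ssum_lin (-1) 0 0; rewrite scaler0 addr0 scaleN1r addNr.
apply: (big_morph _ _ s0) => S T'.
by have := ssum_lin 1 S T'; rewrite !scale1r.
Qed.

Lemma ssum_cvg (T : nat -> bop L' L) S : has_lim T S ->
  has_lim (fun n => ssum X Y (T n)) (ssum X Y S).
Proof.
have [c c0 hc] := ssum_le; apply: (has_lim_map c0) => n.
have -> : ssum X Y S - ssum X Y (T n) = ssum X Y (S - T n).
  by have := ssum_lin (-1) (T n) S; rewrite !scaleN1r ![- _ + _]addrC.
exact: hc.
Qed.

End Ssum.

Lemma has_lim_compo H K L M (A : bop K L) (B : bop M H) (u : nat -> bop H K) l :
  has_lim u l -> has_lim (fun n => A ** u n ** B) (A ** l ** B).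
Proof.
apply: (@has_lim_map _ _ _ u l (fun T => A ** T ** B) (`|A| * `|B|)) => [|n].
  exact: mulr_ge0.
rewrite -compoBl -compoBr (le_trans (compo_le _ _))// mulrAC ler_wpM2r//.
exact: compo_le.
Qed.

Lemma has_lim_mul H K L (u : nat -> bop K L) (v : nat -> bop H K) l m :
  has_lim u l -> has_lim v m -> has_lim (fun n => u n ** v n) (l ** m).
Proof.
move=> ul vm e e0.
have c0 : 0 < `|l| + `|m| + 1 by rewrite ltr_wpDl// addr_ge0.
have [d [d0 dc d1]] := pos_min (divr_gt0 e0 c0) ltr01.
have [N1 h1] := ul _ d0; have [N2 h2] := vm _ d0.
exists (maxn N1 N2) => n; rewrite geq_max => /andP[/h1 un /h2 vn].
have -> : l ** m - u n ** v n = (l - u n) ** m + (l ** (m - v n) - (l - u n) ** (m - v n)).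
  by rewrite !compoBl subKr compoBr subrKA.
rewrite (le_trans (ler_normD _ _))//.
rewrite (@le_trans _ _ (d * `|m| + (`|l| * d + d * 1)))//.
  rewrite lerD// ?(le_trans (compo_le _ _))// ?ler_wpM2r//.
  rewrite (le_trans (ler_normB _ _))// lerD// (le_trans (compo_le _ _))// ?ler_wpM2l//.
  by rewrite ler_pM// (le_trans vn).
have -> : d * `|m| + (`|l| * d + d * 1) = d * (`|l| + `|m| + 1) by ring.
by rewrite -ler_pdivlMr.
Qed.

End SquareSummable.

Section PairSums.
Variable R : realType.

Lemma sum_allpairs (E : zmodType) (r s : seq nat) (f : nat * nat -> E) :
  \sum_(p <- [seq (m, n) | m <- r, n <- s]) f p = \sum_(m <- r) \sum_(n <- s) f (m, n).
Proof. by rewrite big_allpairs_dep. Qed.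

Section Families.
Variables (H L K : hilbert R) (A : nat -> bop H L) (a : nat -> bop K H).
Let X (p : nat * nat) := A p.2 ** a p.1.

Lemma qle_box r s M N : 0 <= M -> qle s A M -> qle r a N ->
  qle [seq (m, n) | m <- r, n <- s] X (M * N).
Proof.
move=> M0 sA ra z; rewrite sum_allpairs -mulrA.
apply: le_trans (ler_wpM2l M0 (ra z)); rewrite mulr_sumr.
by apply: ler_sum => m _; move: (sA (a m z)); rewrite /X /=.
Qed.

Lemma seq_pair_bound (F : seq (nat * nat)) : exists M, forall p, p \in F ->
  (p.1 < M)%N && (p.2 < M)%N.
Proof.
elim: F => [|q F [M h]]; first by exists 0%N.
exists (maxn (maxn q.1 q.2).+1 M) => p; rewrite inE => /orP[/eqP ->|/h /andP[p1 p2]].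
  by rewrite !leq_max !ltnS !leq_max !leqnn orbT.
by rewrite !leq_max p1 p2 !orbT.
Qed.

Hypotheses (sA : sqs A) (sa : sqs a).

Lemma pair_bound : exists2 C : R[i], 0 <= C & forall F, uniq F -> qle F X (C ^+ 2).
Proof.
have [[M M0 bA] _] := sA; have [[N N0 ba] _] := sa.
exists (M * N) => [|F uF]; first exact: mulr_ge0.
have [n hn] := seq_pair_bound F.
apply: (@qle_sub _ _ _ [seq (i, j) | i <- index_iota 0 n, j <- index_iota 0 n]) => //.
- by apply: allpairs_uniq; rewrite ?iota_uniq// => -[? ?] [? ?] _ _ [-> ->].
- move=> [i j] /hn /=/andP[i1 j1]; apply/allpairsP; exists (i, j) => /=.
  by rewrite !mem_index_iota.
by rewrite exprMn; apply: qle_box => //; exact: exprn_ge0.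
Qed.

Lemma pair_tail (e : R[i]) : 0 < e -> exists N : nat, forall F, uniq F ->
  (forall p, p \in F -> (N <= p.1)%N || (N <= p.2)%N) -> qle F X (e ^+ 2).
Proof.
move=> e0; have [[M M0 bA] tA] := sA; have [[N N0 ba] ta] := sa.
have c0 : 0 < M + N + 1 by rewrite ltr_wpDl// addr_ge0.
have d0 := divr_gt0 e0 c0; set d := e / (M + N + 1) in d0.
have [n1 h1] := tA _ d0; have [n2 h2] := ta _ d0.
pose k := maxn n1 n2; exists k => F uF hF z.
have [n hn] := seq_pair_bound F.
rewrite (bigID (fun p : nat * nat => (k <= p.1)%N))/= -[X in X + _]big_filter -[X in _ + X]big_filter.
have -> : e = d * (M + N + 1) by rewrite /d divfK// gt_eqF.
apply: (@le_trans _ _ (M ^+ 2 * d ^+ 2 * `|z| ^+ 2 + d ^+ 2 * N ^+ 2 * `|z| ^+ 2)); last first.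
  rewrite -mulrDl ler_wpM2r ?exprn_ge0//.
  have -> : M ^+ 2 * d ^+ 2 + d ^+ 2 * N ^+ 2 = d ^+ 2 * (M ^+ 2 + N ^+ 2) by ring.
  rewrite [leRHS]exprMn.
  rewrite ler_wpM2l ?exprn_ge0 ?(ltW d0)//.
  have -> : (M + N + 1) ^+ 2 = M ^+ 2 + N ^+ 2 + (M * N *+ 2 + (M + N) *+ 2 + 1) by ring.
  by rewrite lerDl !addr_ge0 ?mulrn_wge0 ?mulr_ge0 ?addr_ge0.
have uniq_box (r s : seq nat) : uniq r -> uniq s -> uniq [seq (i, j) | i <- r, j <- s].
  by move=> ur us; apply: allpairs_uniq => // -[? ?] [? ?] _ _ [-> ->].
have q1 : qle [seq i <- F | (k <= i.1)%N] X (M ^+ 2 * d ^+ 2).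
  apply: (@qle_sub _ _ _ [seq (i, j) | i <- index_iota k n, j <- index_iota 0 n]).
  - exact: filter_uniq.
  - by apply: uniq_box; exact: iota_uniq.
  - move=> [i j]; rewrite mem_filter /= => /andP[ki /hn /=/andP[i1 j1]].
    by apply/allpairsP; exists (i, j) => /=; rewrite !mem_index_iota ki.
  apply: qle_box => //; first exact: exprn_ge0.
  apply: qle_sub (h2 n); rewrite ?iota_uniq// => i.
  by rewrite !mem_index_iota => /andP[ki ->]; rewrite (leq_trans _ ki)// leq_maxr.
have q2 : qle [seq i <- F | ~~ (k <= i.1)%N] X (d ^+ 2 * N ^+ 2).
  apply: (@qle_sub _ _ _ [seq (i, j) | i <- index_iota 0 n, j <- index_iota k n]).
  - exact: filter_uniq.
  - by apply: uniq_box; exact: iota_uniq.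
  - move=> [i j]; rewrite mem_filter /= => /andP[ki ijF]; have /andP[i1 j1] := hn _ ijF.
    have := hF _ ijF; rewrite (negbTE ki) /= => kj.
    by apply/allpairsP; exists (i, j) => /=; rewrite !mem_index_iota kj.
  apply: qle_box => //; first by rewrite exprn_ge0// ltW.
  apply: qle_sub (h1 n); rewrite ?iota_uniq// => i.
  by rewrite !mem_index_iota => /andP[ki ->]; rewrite (leq_trans _ ki)// leq_maxl.
exact: lerD (q1 z) (q2 z).
Qed.

End Families.

Variables (H L K H' L' K' : hilbert R).
Variables (A : nat -> bop H L) (a : nat -> bop K H).
Variables (B : nat -> bop H' L') (b : nat -> bop K' H').
Hypotheses (sA : sqs A) (sa : sqs a) (sB : sqs B) (sb : sqs b).
Variables (T : bop L' L) (l : bop K' K).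

Lemma pair_sum_cvg :
  has_lim (fun N => \sum_(0 <= m < N) \sum_(0 <= n < N)
    adj (a m) ** adj (A n) ** T ** B m ** b n) l ->
  summability.sum (fun mn : nat * nat =>
    adj (a mn.1) ** adj (A mn.2) ** T ** B mn.1 ** b mn.2) = l.
Proof.
move=> hl; set f := (fun mn => _ : bop K' K).
apply: cvg_lim; [exact: norm_hausdorff|exact: totally_filter|].
have FF : Filter (@totally (nat * nat)%type) by apply: @filter_filter; exact: totally_filter.
apply/cvgrPdist_le => e e0.
have e2 : 0 < e / 2 by rewrite divr_gt0.
have [N1 h1] := hl _ e2.
have [C C0 bX] := pair_bound sA sa.
have [C' C'0 bY'] := pair_bound sB sb.
have bY F : uniq F -> qle F (fun p : nat * nat => B p.1 ** b p.2) (C' ^+ 2).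
  move=> uF z; have := bY' [seq (p.2, p.1) | p <- F] _ z; rewrite big_map; apply.
  by rewrite map_inj_uniq// => -[? ?] [? ?] [-> ->].
have c0 : 0 < C' * `|T| + 1 by rewrite ltr_wpDl// mulr_ge0.
have d0 := divr_gt0 e2 c0.
have [N2 h2] := pair_tail sA sa d0.
pose N := maxn N1 N2.
pose box := [seq (m, n) | m <- index_iota 0 N, n <- index_iota 0 N].
have ubox : uniq box.
  by apply: allpairs_uniq; rewrite ?iota_uniq// => -[? ?] [? ?] _ _ [-> ->].
have boxP p : (p \in box) = (p.1 < N)%N && (p.2 < N)%N.
  apply/allpairsP/andP => [[[i j] /= []]|[p1 p2]].
    by rewrite !mem_index_iota /= => ? ? ->.
  by exists p; rewrite !mem_index_iota/= -surjective_pairing.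
exists [fset p in box]%fset => // F /= /fsubsetP boxF.
have -> : partial_sum f F = \sum_(p <- F) f p by exact: (esym (big_seq_fsetE _ F predT f)).
rewrite (bigID (mem box))/=.
have -> : \sum_(p <- F | p \in box) f p = \sum_(0 <= m < N) \sum_(0 <= n < N)
    adj (a m) ** adj (A n) ** T ** B m ** b n.
  rewrite -(sum_allpairs _ _ f) -big_filter; apply: perm_big; apply: uniq_perm => //.
    by rewrite filter_uniq// fset_uniq.
  move=> p; rewrite mem_filter andbC; case: (boolP (p \in box)) => [pb|]; last by rewrite andbF.
  by rewrite boxF// in_fset.
rewrite opprD addrA (le_trans (ler_normB _ _))// [leRHS]splitr lerD//.
  by apply: h1; exact: leq_maxl.
rewrite -big_filter; under eq_bigr do rewrite /f -adj_comp -(compoA _ _ (b _)).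
have uF : uniq [seq i <- F | i \notin box] by rewrite filter_uniq// fset_uniq.
apply: le_trans (sum_CS T (M := e / 2 / (C' * `|T| + 1)) (N := C') _ _ _ _) _ => //.
- exact: ltW.
- apply: h2 => // p; rewrite mem_filter boxP negb_and -!leqNgt => /andP[+ _].
  by move=> /orP[|] /(leq_trans (leq_maxr _ _)) ->; rewrite ?orbT.
- exact: bY.
rewrite -mulrA mulrAC ler_pdivrMr// ler_wpM2l ?(ltW e2)//.
by rewrite lerDl.
Qed.

End PairSums.

Section Commutants.
Variables (R : realType) (H : hilbert R) (S : set (bop H H)).

Lemma commutant_lin a x y : commutant S x -> commutant S y -> commutant S (a *: x + y).
Proof. by move=> cx cy s Ss; rewrite compoPl compoPr cx// cy. Qed.

Lemma commutant0 : commutant S 0.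
Proof. by move=> s _; rewrite compo0l compo0r. Qed.

Lemma commutant_sum I (r : seq I) (P : pred I) (F : I -> bop H H) :
  (forall i, P i -> commutant S (F i)) -> commutant S (\sum_(i <- r | P i) F i).
Proof.
move=> cF; elim/big_rec : _ => [|i x Pi cx]; first exact: commutant0.
by rewrite -[F i]scale1r; apply: commutant_lin => //; exact: cF.
Qed.

Lemma commutantM x y : commutant S x -> commutant S y -> commutant S (x ** y).
Proof. by move=> cx cy s Ss; rewrite -compoA cy// compoA cx// compoA. Qed.

Lemma commutant_lim (u : nat -> bop H H) l : (forall n, commutant S (u n)) ->
  has_lim u l -> commutant S l.
Proof.
move=> cu ul s Ss.
have h1 : has_lim (fun n => opid H ** u n ** s) (opid H ** l ** s) by exact: has_lim_compo.
have h2 : has_lim (fun n => s ** u n ** opid H) (s ** l ** opid H) by exact: has_lim_compo.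
rewrite -[l ** s]comp1o compoA -[RHS]compo1; apply: has_lim_uniq h1 _.
by apply: has_lim_ext h2 => n; rewrite compo1 comp1o cu.
Qed.

End Commutants.

Section SingleTerm.
Variables (R : realType) (K0 H : hilbert R).

Definition single (x : bop K0 H) (k : nat) : bop K0 H := if k is 0%N then x else 0.

Lemma series_single (x y : bop K0 H) T n :
  series (fun k => adj (single x k) ** T ** single y k) n.+1 = adj x ** T ** y.
Proof.
rewrite /series/= big_nat_recl// big1 ?addr0// => i _.
by rewrite compo0r.
Qed.

Lemma single_lim (x y : bop K0 H) T :
  has_lim (series (fun k => adj (single x k) ** T ** single y k)) (adj x ** T ** y).
Proof.
by move=> e e0; exists 1%N => -[//|n] _; rewrite series_single subrr normr0 ltW.
Qed.

Lemma sqsum_single (a : set (bop K0 H)) x : a 0 -> a x -> sqsum a (single x).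
Proof.
move=> a0 ax; split; first by case.
apply/cvg_ex; exists (adj x ** x); apply/has_limP.
have := single_lim x x (opid H); rewrite compo1.
by apply: has_lim_ext => n; apply: eq_bigr => k _; rewrite compo1.
Qed.

Lemma ssum_single (x y : bop K0 H) T : ssum (single x) (single y) T = adj x ** T ** y.
Proof. exact: has_lim_limn (single_lim x y T). Qed.

Lemma omegaE (A : set (bop H H)) (xi eta : nat -> bop K0 H) T : A T ->
  omega A xi eta T = ssum xi eta T.
Proof. by move=> AT; rewrite /omega /patch mem_set. Qed.

End SingleTerm.

(** * The pairing of the Fourier algebras *)

Section DualPairing.
Variables (R : realType) (B : cbase R) (H : hilbert R).
Variables (bhat alpha beta : set (bop (cK B) H)).
Variable V : bop (rtensor bhat alpha) (rtensor alpha beta).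
Hypothesis HV : is_pmu V.

Let gh := gram_bhat HV.
Let ga := gram_alpha HV.
Let gb := gram_beta HV.
Let ok_ha := ok_BdB gh ga.
Let ok_ab := ok_BBd ga gb.
Let da : dense_range alpha. Proof. by case: ga. Qed.
Let db : dense_range beta. Proof. by case: gb. Qed.
Let dh : dense_range bhat. Proof. by case: gh. Qed.

Let zero_bhat : bhat 0. Proof. by have [[[[]]]] := pmu_module HV. Qed.
Let zero_alpha : alpha 0. Proof. by have [[_ [[]]]] := pmu_module HV. Qed.
Let zero_beta : beta 0. Proof. by have [[_ _ [[]]]] := pmu_module HV. Qed.

Definition hatpi_sum (xi eta : nat -> bop (cK B) H) : bop H H :=
  ssum (fun n => ket2 alpha beta (xi n)) (fun n => ket2 bhat alpha (eta n)) V.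
Definition pi_sum (e z : nat -> bop (cK B) H) : bop H H :=
  ssum (fun n => ket1 alpha beta (e n)) (fun n => ket1 bhat alpha (z n)) V.

Section Sequences.
Variables xi eta e z : nat -> bop (cK B) H.
Hypotheses (sxi : sqsum beta xi) (seta : sqsum alpha eta).
Hypotheses (se : sqsum alpha e) (sz : sqsum bhat z).

Lemma hatpi_sum_lim :
  has_lim (fun n => \sum_(0 <= k < n) hatpi1 V (xi k) (eta k)) (hatpi_sum xi eta).
Proof. by apply: ssumP; apply: sqs_ket2. Qed.

Lemma pi_sum_lim : has_lim (fun n => \sum_(0 <= k < n) pi1 V (e k) (z k)) (pi_sum e z).
Proof. by apply: ssumP; apply: sqs_ket1. Qed.

Lemma hatpi_sum_hatdom : hatdom beta (hatpi_sum xi eta).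
Proof.
apply: commutant_lim hatpi_sum_lim => n; apply: commutant_sum => k _.
by apply: hatpi1_hatdom => //; [have [] := sxi|have [] := seta].
Qed.

Lemma pi_sum_dom : dom bhat (pi_sum e z).
Proof.
apply: commutant_lim pi_sum_lim => n; apply: commutant_sum => k _.
by apply: pi1_dom => //; [have [] := se|have [] := sz].
Qed.

End Sequences.

(* Both sides are the same matrix element of [V], as [|eta>_1 xi = |xi>_2 eta]. *)
Lemma slice_pi1 xi eta e z : beta xi -> alpha eta -> alpha e -> bhat z ->
  adj e ** hatpi1 V xi eta ** z = adj xi ** pi1 V e z ** eta.
Proof.
move=> bx aeta ae bz; rewrite /hatpi1 /pi1.
rewrite !compoA -!adj_comp -(ket12 ok_ab ae bx) -!compoA.
by rewrite -(ket12 ok_ha bz aeta).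
Qed.

Lemma hatpi_sum_slice xi eta e z : sqsum beta xi -> sqsum alpha eta -> alpha e -> bhat z ->
  adj e ** hatpi_sum xi eta ** z = ssum xi eta (pi1 V e z).
Proof.
move=> sxi seta ae bz.
apply: has_lim_uniq (has_lim_compo (adj e) z (hatpi_sum_lim sxi seta)) _.
apply: has_lim_ext (ssumP (sqsum_sqs sxi) (sqsum_sqs seta) (pi1 V e z)) => n.
rewrite /series/= compo_sumr compo_suml; apply: eq_bigr => k _.
by rewrite slice_pi1//; [have [] := sxi|have [] := seta].
Qed.

Lemma pi_sum_slice xi eta e z : beta xi -> alpha eta -> sqsum alpha e -> sqsum bhat z ->
  adj xi ** pi_sum e z ** eta = ssum e z (hatpi1 V xi eta).
Proof.
move=> bx aeta se sz.
apply: has_lim_uniq (has_lim_compo (adj xi) eta (pi_sum_lim se sz)) _.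
apply: has_lim_ext (ssumP (sqsum_sqs se) (sqsum_sqs sz) (hatpi1 V xi eta)) => n.
rewrite /series/= compo_sumr compo_suml; apply: eq_bigr => k _.
by rewrite slice_pi1//; [have [] := se|have [] := sz].
Qed.

Lemma pairing_sym xi eta e z :
  sqsum beta xi -> sqsum alpha eta -> sqsum alpha e -> sqsum bhat z ->
  ssum xi eta (pi_sum e z) = ssum e z (hatpi_sum xi eta).
Proof.
move=> sxi seta se sz; have qx := sqsum_sqs sxi; have qe := sqsum_sqs seta.
apply: has_lim_uniq (ssum_cvg qx qe (pi_sum_lim se sz)) _.
apply: has_lim_ext (ssumP (sqsum_sqs se) (sqsum_sqs sz) (hatpi_sum xi eta)) => n.
rewrite ssum_sum// /series/=; apply: eq_bigr => k _.
by rewrite hatpi_sum_slice//; [have [] := se|have [] := sz].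
Qed.

Lemma hatpiV_omega xi eta : sqsum beta xi -> sqsum alpha eta ->
  hatpiV V (omega (dom bhat) xi eta) = hatpi_sum xi eta.
Proof.
move=> sxi seta.
have [xi' [eta' [sxi' seta' wE ->]]] : exists xi' eta', [/\ sqsum beta xi', sqsum alpha eta',
    omega (dom bhat) xi eta = omega (dom bhat) xi' eta' &
    hatpiV V (omega (dom bhat) xi eta) = hatpi_sum xi' eta'].
  exact: (@xget_prop _ 0 [set x : bop H H |
  exists xi' eta', [/\ sqsum beta xi', sqsum alpha eta',
    omega (dom bhat) xi eta = omega (dom bhat) xi' eta' & x = hatpi_sum xi' eta']]
  (ex_intro _ (hatpi_sum xi eta)
    (ex_intro _ xi (ex_intro _ eta (And4 sxi seta erefl erefl))))).
apply: (dense_ext dh) => z bz; apply: (dense_cancel da) => e ae.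
rewrite !compoA !hatpi_sum_slice// -!(@omegaE _ _ _ (dom bhat)) ?wE//.
all: exact: pi1_dom.
Qed.

Lemma piV_omega e z : sqsum alpha e -> sqsum bhat z ->
  piV V (omega (hatdom beta) e z) = pi_sum e z.
Proof.
move=> se sz.
have [e' [z' [se' sz' wE ->]]] : exists e' z', [/\ sqsum alpha e', sqsum bhat z',
    omega (hatdom beta) e z = omega (hatdom beta) e' z' &
    piV V (omega (hatdom beta) e z) = pi_sum e' z'].
  exact: (@xget_prop _ 0 [set x : bop H H |
  exists e' z', [/\ sqsum alpha e', sqsum bhat z',
    omega (hatdom beta) e z = omega (hatdom beta) e' z' & x = pi_sum e' z']]
  (ex_intro _ (pi_sum e z) (ex_intro _ e (ex_intro _ z (And4 se sz erefl erefl))))).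
apply: (dense_ext da) => eta aeta; apply: (dense_cancel db) => xi bx.
rewrite !compoA !pi_sum_slice// -!(@omegaE _ _ _ (hatdom beta)) ?wE//.
all: exact: hatpi1_hatdom.
Qed.

Lemma Delta_lin a x y : dom bhat x -> dom bhat y ->
  Delta V (a *: x + y) = a *: Delta V x + Delta V y.
Proof.
move=> dx dy; rewrite /Delta opl_lin//; [|exact: (dom_opl HV)..].
by rewrite compoPr compoPl.
Qed.

Lemma hatDelta_lin a x y : hatdom beta x -> hatdom beta y ->
  hatDelta V (a *: x + y) = a *: hatDelta V x + hatDelta V y.
Proof.
move=> dx dy; rewrite /hatDelta opr_lin//; [|exact: (hatdom_opr HV)..].
by rewrite compoPr compoPl.
Qed.

Lemma Delta_le x : dom bhat x -> `|Delta V x| <= (`|V| * `|adj V|) * `|x|.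
Proof.
move=> dx; rewrite /Delta (le_trans (compo_le _ _))// mulrAC ler_wpM2r//.
rewrite (le_trans (compo_le _ _))// ler_wpM2l//; apply: opl_le => //.
exact: (dom_opl HV).
Qed.

Lemma hatDelta_le x : hatdom beta x -> `|hatDelta V x| <= (`|adj V| * `|V|) * `|x|.
Proof.
move=> dx; rewrite /hatDelta (le_trans (compo_le _ _))// mulrAC ler_wpM2r//.
rewrite (le_trans (compo_le _ _))// ler_wpM2l//; apply: opr_le => //.
exact: (hatdom_opr HV).
Qed.

Lemma commutant_series (S : set (bop H H)) L (D : bop H H -> bop L L) M (x : nat -> bop H H) l :
  0 <= M ->
  (forall a x y, commutant S x -> commutant S y -> D (a *: x + y) = a *: D x + D y) ->
  (forall x, commutant S x -> `|D x| <= M * `|x|) ->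
  (forall k, commutant S (x k)) ->
  has_lim (fun n => \sum_(0 <= k < n) x k) l ->
  has_lim (fun n => \sum_(0 <= k < n) D (x k)) (D l).
Proof.
move=> M0 Dl DM cx xl.
have D0 : D 0 = 0.
  have := Dl (-1) 0 0 (@commutant0 _ _ S) (@commutant0 _ _ S).
  by rewrite scaler0 addr0 scaleN1r addNr.
have cs n : commutant S (\sum_(0 <= k < n) x k) by apply: commutant_sum.
have cl : commutant S l := commutant_lim cs xl.
have DE n : \sum_(0 <= k < n) D (x k) = D (\sum_(0 <= k < n) x k).
  elim: n => [|n IH]; first by rewrite !big_geq.
  rewrite !big_nat_recr//= IH addrC [in RHS]addrC -[in RHS](scale1r (x n)) Dl//.
  by rewrite scale1r.
have -> : (fun n => \sum_(0 <= k < n) D (x k)) = D \o (fun n => \sum_(0 <= k < n) x k).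
  by apply/funext => n; rewrite DE.
apply: (has_lim_map M0 _ xl) => n.
have e : D l - D (\sum_(0 <= k < n) x k) = D (l - \sum_(0 <= k < n) x k).
  by have := Dl (-1) _ _ (cs n) cl; rewrite !scaleN1r ![- _ + _]addrC.
rewrite e; apply: DM; rewrite addrC -scaleN1r; exact: commutant_lin.
Qed.

Lemma Delta_pi_sum_slice xi eta xi' eta' e z :
  beta xi -> alpha eta -> beta xi' -> alpha eta' -> sqsum alpha e -> sqsum bhat z ->
  adj xi ** adj (ket2 alpha beta xi') ** Delta V (pi_sum e z) ** ket1 alpha beta eta ** eta' =
  ssum e z (hatpi1 V xi eta ** hatpi1 V xi' eta').
Proof.
move=> bx aeta bx' aeta' se sz; have [ae _] := se; have [bz _] := sz.
have DL := @commutant_series _ _ (Delta V) (`|V| * `|adj V|) _ _ (mulr_ge0 (normr_ge0 _) (normr_ge0 _))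
  Delta_lin Delta_le (fun k => pi1_dom HV (ae k) (bz k)) (pi_sum_lim se sz).
rewrite -compoA.
apply: has_lim_uniq (has_lim_compo _ _ DL) _.
apply: has_lim_ext (ssumP (sqsum_sqs se) (sqsum_sqs sz) (hatpi1 V xi eta ** hatpi1 V xi' eta')) => n.
rewrite /series/= compo_sumr compo_suml.
apply: eq_bigr => k _; rewrite -(Delta_pi1_slice HV bx aeta bx' aeta')//.
by rewrite -[LHS]compoA.
Qed.

Lemma hatDelta_hatpi_sum_slice eta z eta' z' xi k :
  alpha eta -> bhat z -> alpha eta' -> bhat z' -> sqsum beta xi -> sqsum alpha k ->
  adj eta ** adj (ket2 bhat alpha eta') ** hatDelta V (hatpi_sum xi k) **
    ket1 bhat alpha z ** z' =
  ssum xi k (pi1 V eta z ** pi1 V eta' z').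
Proof.
move=> ae bz ae' bz' sxi sk; have [bx _] := sxi; have [ak _] := sk.
have DL := @commutant_series _ _ (hatDelta V) (`|adj V| * `|V|) _ _
  (mulr_ge0 (normr_ge0 _) (normr_ge0 _))
  hatDelta_lin hatDelta_le (fun n => hatpi1_hatdom HV (bx n) (ak n)) (hatpi_sum_lim sxi sk).
rewrite -compoA.
apply: has_lim_uniq (has_lim_compo _ _ DL) _.
apply: has_lim_ext (ssumP (sqsum_sqs sxi) (sqsum_sqs sk) (pi1 V eta z ** pi1 V eta' z')) => n.
rewrite /series/= compo_sumr compo_suml.
apply: eq_bigr => i _; rewrite -(hatDelta_hatpi1_slice HV ae bz ae' bz')//.
by rewrite -[LHS]compoA.
Qed.

Lemma box_Delta w w' e z :
  Omega_beta_alpha bhat alpha beta w -> Omega_beta_alpha bhat alpha beta w' ->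
  sqsum alpha e -> sqsum bhat z ->
  box bhat w w' (Delta V (pi_sum e z)) = ssum e z (hatpiV V w ** hatpiV V w').
Proof.
move=> [xi0 sxi0 [eta0 seta0 wE]] [xi1 sxi1 [eta1 seta1 wE']] se sz.
have [xi [eta [xi' [eta' [[sxi seta sxi' seta'] -> -> bE]]]]] : exists xi eta xi' eta',
    [/\ [/\ sqsum beta xi, sqsum alpha eta, sqsum beta xi' & sqsum alpha eta'],
        w = omega (dom bhat) xi eta, w' = omega (dom bhat) xi' eta' &
        box bhat w w' = omega2 (@dom2 _ B H bhat alpha beta) xi eta xi' eta'].
  exact: (@xget_prop _ (fun=> 0) [set F | exists xi eta xi' eta',
    [/\ [/\ sqsum beta xi, sqsum alpha eta, sqsum beta xi' & sqsum alpha eta'],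
        w = omega (dom bhat) xi eta, w' = omega (dom bhat) xi' eta' &
        F = omega2 (@dom2 _ B H bhat alpha beta) xi eta xi' eta']]
    (ex_intro _ _ (ex_intro _ xi0 (ex_intro _ eta0 (ex_intro _ xi1 (ex_intro _ eta1
    (And4 (And4 sxi0 seta0 sxi1 seta1) (esym wE) (esym wE') erefl))))))).
rewrite bE /omega2 /patch mem_set; last exact/(Delta_dom2 HV)/pi_sum_dom.
rewrite !hatpiV_omega//.
apply: (pair_sum_cvg (A := fun n => ket2 alpha beta (xi' n)) (a := xi)
  (B := fun n => ket1 alpha beta (eta n)) (b := eta')).
- exact: sqs_ket2.
- exact: sqsum_sqs sxi.
- exact: sqs_ket1.
- exact: sqsum_sqs seta'.
have qe := sqsum_sqs se; have qz := sqsum_sqs sz.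
apply: has_lim_ext (ssum_cvg qe qz
  (has_lim_mul (hatpi_sum_lim sxi seta) (hatpi_sum_lim sxi' seta'))) => n.
rewrite compo_suml ssum_sum//; apply: eq_bigr => i _.
rewrite compo_sumr ssum_sum//; apply: eq_bigr => j _.
have [bx _] := sxi; have [ax _] := seta; have [bx' _] := sxi'; have [ax' _] := seta'.
by rewrite -(Delta_pi_sum_slice (bx i) (ax i) (bx' j) (ax' j)).
Qed.

Lemma hatbox_hatDelta u u' xi k :
  Omega_alpha_bhat bhat alpha beta u -> Omega_alpha_bhat bhat alpha beta u' ->
  sqsum beta xi -> sqsum alpha k ->
  hatbox beta u u' (hatDelta V (hatpi_sum xi k)) = ssum xi k (piV V u ** piV V u').
Proof.
move=> [e0 se0 [z0 sz0 uE]] [e1 se1 [z1 sz1 uE']] sxi sk.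
have [e [z [e' [z' [[se sz se' sz'] -> -> bE]]]]] : exists e z e' z',
    [/\ [/\ sqsum alpha e, sqsum bhat z, sqsum alpha e' & sqsum bhat z'],
        u = omega (hatdom beta) e z, u' = omega (hatdom beta) e' z' &
        hatbox beta u u' = omega2 (@hatdom2 _ B H bhat alpha beta) e z e' z'].
  exact: (@xget_prop _ (fun=> 0) [set F | exists e z e' z',
    [/\ [/\ sqsum alpha e, sqsum bhat z, sqsum alpha e' & sqsum bhat z'],
        u = omega (hatdom beta) e z, u' = omega (hatdom beta) e' z' &
        F = omega2 (@hatdom2 _ B H bhat alpha beta) e z e' z']]
    (ex_intro _ _ (ex_intro _ e0 (ex_intro _ z0 (ex_intro _ e1 (ex_intro _ z1
    (And4 (And4 se0 sz0 se1 sz1) (esym uE) (esym uE') erefl))))))).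
rewrite bE /omega2 /patch mem_set; last exact/(hatDelta_hatdom2 HV)/hatpi_sum_hatdom.
rewrite !piV_omega//.
apply: (pair_sum_cvg (A := fun n => ket2 bhat alpha (e' n)) (a := e)
  (B := fun n => ket1 bhat alpha (z n)) (b := z')).
- exact: sqs_ket2.
- exact: sqsum_sqs se.
- exact: sqs_ket1.
- exact: sqsum_sqs sz'.
have qx := sqsum_sqs sxi; have qk := sqsum_sqs sk.
apply: has_lim_ext (ssum_cvg qx qk
  (has_lim_mul (pi_sum_lim se sz) (pi_sum_lim se' sz'))) => n.
rewrite compo_suml ssum_sum//; apply: eq_bigr => i _.
rewrite compo_sumr ssum_sum//; apply: eq_bigr => j _.
have [ae _] := se; have [bz _] := sz; have [ae' _] := se'; have [bz' _] := sz'.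
by rewrite -(hatDelta_hatpi_sum_slice (ae i) (bz i) (ae' j) (bz' j)).
Qed.

Lemma Omega_pairing w u :
  Omega_beta_alpha bhat alpha beta w -> Omega_alpha_bhat bhat alpha beta u ->
  w (piV V u) = u (hatpiV V w).
Proof.
move=> [xi sxi [eta seta <-]] [e se [z sz <-]].
rewrite hatpiV_omega// piV_omega// !omegaE; first exact: pairing_sym.
  exact: hatpi_sum_hatdom.
exact: pi_sum_dom.
Qed.

Lemma Omega_lin (A : set (bop H H)) (b a : set (bop (cK B) H)) w c x y :
  (forall x y, A x -> A y -> A (c *: x + y)) -> Omega b a A w ->
  A x -> A y -> w (c *: x + y) = c *: w x + w y.
Proof.
move=> Al [xi sxi [eta seta <-]] Ax Ay; rewrite !omegaE//; last exact: Al.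
exact: (ssum_lin (sqsum_sqs sxi) (sqsum_sqs seta)).
Qed.

Lemma A0_dom x : A0 V x -> dom bhat x.
Proof. by move=> [u [e se [z sz <-]] <-]; rewrite piV_omega//; exact: pi_sum_dom. Qed.

Lemma hatA0_hatdom y : hatA0 V y -> hatdom beta y.
Proof.
by move=> [w [xi sxi [eta seta <-]] <-]; rewrite hatpiV_omega//; exact: hatpi_sum_hatdom.
Qed.

Lemma hatA0_separated y : hatA0 V y ->
  (forall u, Omega_alpha_bhat bhat alpha beta u -> u y = 0) -> y = 0.
Proof.
move=> /hatA0_hatdom dy y0; apply: (dense_ext dh) => z bz; apply: (dense_cancel da) => e ae.
have := y0 (omega (hatdom beta) (single e) (single z)).
rewrite omegaE// ssum_single compoA compo0l compo0r => ->//.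
by exists (single e); [exact: sqsum_single|exists (single z) => //; exact: sqsum_single].
Qed.

Lemma A0_separated x : A0 V x ->
  (forall w, Omega_beta_alpha bhat alpha beta w -> w x = 0) -> x = 0.
Proof.
move=> /A0_dom dx x0; apply: (dense_ext da) => eta ae; apply: (dense_cancel db) => xi bx.
have := x0 (omega (dom bhat) (single xi) (single eta)).
rewrite omegaE// ssum_single compoA compo0l compo0r => ->//.
by exists (single xi); [exact: sqsum_single|exists (single eta) => //; exact: sqsum_single].
Qed.

End DualPairing.

Theorem proposition3p16 (R : realType) (B : cbase R) (H : hilbert R)
    (bhat alpha beta : set (bop (cK B) H))
    (V : bop (rtensor bhat alpha) (rtensor alpha beta))
    (HV : is_pmu V) :
  exists form : bop H H -> bop H H -> bop (cK B) (cK B),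
    [/\ bilinear_on (hatA0 V) (A0 V) form,
        (forall w u,
           Omega_beta_alpha bhat alpha beta w ->
           Omega_alpha_bhat bhat alpha beta u ->
           w (piV V u) = form (hatpiV V w) (piV V u) /\
           form (hatpiV V w) (piV V u) = u (hatpiV V w)),
        (forall ha x, hatA0 V ha -> ha <> 0 -> A0 V x -> x <> 0 ->
           exists ha' x', [/\ hatA0 V ha', A0 V x',
             form ha x' <> 0 & form ha' x <> 0]),
        (forall w w' x,
           Omega_beta_alpha bhat alpha beta w ->
           Omega_beta_alpha bhat alpha beta w' ->
           A0 V x ->
           form (hatpiV V w ** hatpiV V w') x = box bhat w w' (Delta V x)) &
        (forall ha u u',
           hatA0 V ha ->
           Omega_alpha_bhat bhat alpha beta u ->
           Omega_alpha_bhat bhat alpha beta u' ->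
           form ha (piV V u ** piV V u') = hatbox beta u u' (hatDelta V ha))].
Proof.
have /choice[U UE] x : exists u, A0 V x ->
    Omega_alpha_bhat bhat alpha beta u /\ piV V u = x.
  have [[u Ou ux]|nx] := pselect (A0 V x); first by exists u.
  by exists (fun=> 0).
have /choice[W WE] y : exists w, hatA0 V y ->
    Omega_beta_alpha bhat alpha beta w /\ hatpiV V w = y.
  have [[w Ow wy]|ny] := pselect (hatA0 V y); first by exists w.
  by exists (fun=> 0).
(* [U] and [W] choose preimages under [piV] and [hatpiV]. Reading the value off
   from either side makes [form] linear in both arguments and defined on
   products, without showing that [A0] and [hatA0] are subalgebras. *)
pose form y x := if `[< A0 V x >] then U x y else W y x.
have formU y x : A0 V x -> form y x = U x y by move=> Ax; rewrite /form asboolT.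
have formW y x : hatA0 V y -> form y x = W y x.
  move=> Ay; rewrite /form; case: asboolP => // Ax.
  have [Ow wy] := WE y Ay; have [Ou ux] := UE x Ax.
  by rewrite -{1}wy -(Omega_pairing HV Ow Ou) ux.
have form_omega w u : Omega_beta_alpha bhat alpha beta w ->
    Omega_alpha_bhat bhat alpha beta u -> form (hatpiV V w) (piV V u) = u (hatpiV V w).
  move=> Ow Ou; have Ax : A0 V (piV V u) by exists u.
  have [Ou' uE] := UE _ Ax.
  by rewrite formU// -(Omega_pairing HV Ow Ou') uE (Omega_pairing HV Ow Ou).
exists form; split.
- split=> [c y y' x Ay Ay' Ax|c y x x' Ay Ax Ax'].
    rewrite !(formU _ _ Ax); have [Ou _] := UE x Ax.
    apply: Omega_lin Ou _ _; [|exact: hatA0_hatdom HV _ Ay|exact: hatA0_hatdom HV _ Ay'].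
    by move=> *; exact: commutant_lin.
  rewrite !(formW _ _ Ay); have [Ow _] := WE y Ay.
  apply: Omega_lin Ow _ _; [|exact: A0_dom HV _ Ax|exact: A0_dom HV _ Ax'].
  by move=> *; exact: commutant_lin.
- by move=> w u Ow Ou; rewrite form_omega// Omega_pairing.
- move=> y x Ay y0 Ax x0.
  have [u Ou uy] : exists2 u, Omega_alpha_bhat bhat alpha beta u & u y <> 0.
    apply: contrapT => /forall2NP h; apply/y0/(hatA0_separated HV Ay) => u Ou.
    by have [//|/contrapT] := h u.
  have [w Ow wx] : exists2 w, Omega_beta_alpha bhat alpha beta w & w x <> 0.
    apply: contrapT => /forall2NP h; apply/x0/(A0_separated HV Ax) => w Ow.
    by have [//|/contrapT] := h w.
  exists (hatpiV V w), (piV V u); split; [by exists w|by exists u|..].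
    by have [Ow' <-] := WE y Ay; rewrite form_omega//; have [_ ->] := WE y Ay.
  have [Ou' ux] := UE x Ax.
  by rewrite -ux form_omega// -(Omega_pairing HV Ow Ou') ux.
- move=> w w' x Ow Ow' Ax; rewrite formU//.
  have [[e se [z sz uE]] ux] := UE x Ax.
  rewrite -[in RHS]ux -uE piV_omega// box_Delta// omegaE//.
  by apply: commutantM; apply: (hatA0_hatdom HV); [exists w|exists w'].
- move=> y u u' Ay Ou Ou'; rewrite formW//.
  have [[xi sxi [k sk wE]] wy] := WE y Ay.
  rewrite -[in RHS]wy -wE hatpiV_omega// hatbox_hatDelta// omegaE//.
  by apply: commutantM; apply: (A0_dom HV); [exists u|exists u'].
Qed.
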